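(* Let $f$ be an analytic function on the unit disk $\mathbb{U}=\{z\in\mathbb{C}:|z|<1\}$. (i) The function $f$ is Bloch if and only if $$\sqrt{1-|z|^2}\,\sqrt{1-|w|^2}\;\frac{|f(z)-f(w)|}{|z-w|}$$ is bounded as a function of $z,w\in\mathbb{U}$ with $z\neq w$. (ii) The function $f$ is normal if and only if $$\frac{\sqrt{1-|z|^2}\,\sqrt{1-|w|^2}}{\sqrt{1+|f(z)|^2}\,\sqrt{1+|f(w)|^2}}\;\frac{|f(z)-f(w)|}{|z-w|}$$ is bounded as a function of $z,w\in\mathbb{U}$ with $z\neq w$.
   Context: An analytic function $f:\mathbb{U}\to\mathbb{C}$ is called Bloch if $\sup_{z\in\mathbb{U}}(1-|z|^2)|f'(z)|<\infty$. Let $\mathrm{Aut}(\mathbb{U})$ be the group of all conformal transforms of the unit disk onto itself. An analytic function $f$ on $\mathbb{U}$ is called normal if $\{f\circ\varphi:\varphi\in\mathrm{Aut}(\mathbb{U})\}$ is a normal family on $\mathbb{U}$, in the standard sense that every sequence in the family has a subsequence which, locally uniformly on $\mathbb{U}$, either converges to an analytic function or diverges to $\infty$. *)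

(* Defs.v *)
From Stdlib Require Import Reals.
From Coquelicot Require Import Coquelicot.

Open Scope R_scope.

(* A function on a domain D of the complex plane is represented by a total
   function C -> C, whose values outside D are never used. *)

Definition unit_disk (z : C) : Prop := Cmod z < 1.

(* [ex_derive] over the absolute ring [C_AbsRing] is complex
   differentiability.  As the unit disk is open, differentiability at z does
   not depend on the values of f outside the disk. *)
Definition analytic_on (D : C -> Prop) (f : C -> C) : Prop :=
  forall z : C, D z -> @ex_derive C_AbsRing C_NormedModule f z.

(* The inverse of an analytic bijection of the disk is automatically analytic,
   so these are the conformal self-maps of the disk. *)
Definition disk_automorphism (phi : C -> C) : Prop :=
  analytic_on unit_disk phi /\
  (forall z : C, unit_disk z -> unit_disk (phi z)) /\
  (forall z w : C, unit_disk z -> unit_disk w -> phi z = phi w -> z = w) /\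
  (forall w : C, unit_disk w -> exists z : C, unit_disk z /\ phi z = w).

Definition converges_locally_uniformly
    (D : C -> Prop) (g : nat -> C -> C) (h : C -> C) : Prop :=
  forall z : C, D z -> exists V : C -> Prop, locally z V /\
    forall eps : R, 0 < eps ->
      eventually (fun n => forall w : C, D w -> V w -> Cmod (g n w - h w) < eps).

Definition diverges_locally_uniformly
    (D : C -> Prop) (g : nat -> C -> C) : Prop :=
  forall z : C, D z -> exists V : C -> Prop, locally z V /\
    forall M : R,
      eventually (fun n => forall w : C, D w -> V w -> M < Cmod (g n w)).

Definition normal_family (D : C -> Prop) (F : (C -> C) -> Prop) : Prop :=
  forall g : nat -> C -> C, (forall n : nat, F (g n)) ->
    exists sigma : nat -> nat,
      (forall i j : nat, (i < j)%nat -> (sigma i < sigma j)%nat) /\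
      ((exists h : C -> C, analytic_on D h /\
          converges_locally_uniformly D (fun k => g (sigma k)) h) \/
       diverges_locally_uniformly D (fun k => g (sigma k))).

(* [C_derive] takes limits along the real direction only; it is the complex
   derivative because f is assumed complex differentiable
   (cf. [C_derive_correct]). *)
Definition is_bloch (f : C -> C) : Prop :=
  analytic_on unit_disk f /\
  exists M : R, forall z : C, unit_disk z ->
    (1 - Cmod z ^ 2) * Cmod (C_derive f z) <= M.

Definition is_normal (f : C -> C) : Prop :=
  analytic_on unit_disk f /\
  normal_family unit_disk
    (fun g => exists phi : C -> C, disk_automorphism phi /\
       forall z : C, unit_disk z -> g z = f (phi z)).

(* Main.v *)
(** Both difference quotients become derivative bounds in the limit w -> z.
    Conversely, a bound on (1-|z|^2)|f'(z)|, or on the spherical analogue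
    (1-|z|^2)|f'(z)| / (1+|f(z)|^2), is invariant under Moebius maps, so it can
    be integrated along a hyperbolic radius; this controls |f(z)-f(w)|, or the
    chordal distance of f(z) and f(w), by the hyperbolic distance rho of z and
    w, and rho <= sinh rho = |z-w| / (sqrt(1-|z|^2) sqrt(1-|w|^2)).  It remains
    to see that f is normal iff its weighted spherical derivative is bounded
    (Marty's criterion for the family of the f o phi): one direction rescales
    at bad points and applies Cauchy's estimate to f o phi_n - h or to
    1 / (f o phi_n); the other is Arzela-Ascoli in the Riemann sphere, where
    Hurwitz' argument shows that a limit taking the value infinity is constant.
    Cauchy's formula comes from Goursat's theorem in logarithmic coordinates,
    which makes circle means independent of the radius.  Multiplicative
    constants are immaterial throughout and are not optimized. *)

Require Import Defs.
From Stdlib Require Import Reals Lra Lia Classical ClassicalEpsilon.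
From Stdlib Require Cantor.
From Coquelicot Require Import Coquelicot.

Open Scope R_scope.

(** * Complex differentiability *)

(** Normality allows a limit equal to infinity, while functions here take values in [C]; so a limit
    in the sphere is never named. Compactness is stated as a Cauchy condition on the three
    stereographic coordinates, which are bounded real functions. Only afterwards is the disk split
    into the points where the sequence tends to infinity and the others; both sets are open and the
    disk is connected. The same coordinates reduce the spherical Lipschitz estimate to three real
    mean value arguments, as real and imaginary parts do in the Bloch case. The other obstacle is
    the removable singularity of the difference quotient in Cauchy's formula, where mere continuity
    is known. Circle means get past it, since a whole circle may be exempted from differentiability.
    Derivatives are slopes, so the limit w -> z is continuity of the slope. Moduli of integrals are
    estimated by components, which costs a factor 2 in Cauchy's estimates and in the mean value
    inequality. *)

Definition cnear (z : C) (P : C -> Prop) : Prop :=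
  exists d : R, 0 < d /\ forall w : C, Cmod (w - z) < d -> P w.

Definition ccont (f : C -> C) (z : C) : Prop :=
  forall e : R, 0 < e -> cnear z (fun w => Cmod (f w - f z) < e).

(* Caratheodory's formulation: the difference quotient extends continuously. *)
Definition cderiv (f : C -> C) (z l : C) : Prop :=
  exists q : C -> C, ccont q z /\ q z = l /\
    cnear z (fun w => (f w - f z)%C = (q w * (w - z))%C).

Lemma Cmod_triangle_inv (a b : C) : Cmod a - Cmod b <= Cmod (a - b).
Proof.
  pose proof (Cmod_triangle (a - b) b) as H.
  replace (a - b + b)%C with a in H by ring. lra.
Qed.

Lemma Cmod_minus_sym (a b : C) : Cmod (a - b) = Cmod (b - a).
Proof. rewrite <- (Cmod_opp (b - a)). f_equal. ring. Qed.

Lemma Cmod_triangle_minus (a b : C) : Cmod (a - b) <= Cmod a + Cmod b.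
Proof.
  unfold Cminus. rewrite <- (Cmod_opp b). apply Cmod_triangle.
Qed.

Lemma Cmod_sub_triangle (a b c : C) : Cmod (a - c) <= Cmod (a - b) + Cmod (b - c).
Proof.
  replace (a - c)%C with ((a - b) + (b - c))%C by ring. apply Cmod_triangle.
Qed.

Lemma Cmod_sqr (z : C) : Cmod z ^ 2 = fst z ^ 2 + snd z ^ 2.
Proof.
  unfold Cmod. rewrite pow2_sqrt; [reflexivity|].
  pose proof (pow2_ge_0 (fst z)); pose proof (pow2_ge_0 (snd z)); lra.
Qed.

(** The crude constant 2, in place of sqrt 2, is the source of the factors 2 in the integral
    bounds. *)
Lemma Cmod_le_components (z : C) (m : R) :
  Rabs (fst z) <= m -> Rabs (snd z) <= m -> Cmod z <= 2 * m.
Proof.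
  intros H1 H2.
  assert (0 <= m) by (pose proof (Rabs_pos (fst z)); lra).
  destruct (Rle_lt_dec (Cmod z) (2 * m)) as [|K]; [assumption|exfalso].
  pose proof (Cmod_sqr z) as E.
  assert (fst z ^ 2 <= m ^ 2) by (rewrite <- (pow2_abs (fst z)); apply pow_incr; split; [apply Rabs_pos|lra]).
  assert (snd z ^ 2 <= m ^ 2) by (rewrite <- (pow2_abs (snd z)); apply pow_incr; split; [apply Rabs_pos|lra]).
  nra.
Qed.

Lemma fst_le_Cmod (z : C) : Rabs (fst z) <= Cmod z.
Proof. eapply Rle_trans; [apply Rmax_l|apply Rmax_Cmod]. Qed.

Lemma snd_le_Cmod (z : C) : Rabs (snd z) <= Cmod z.
Proof. eapply Rle_trans; [apply Rmax_r|apply Rmax_Cmod]. Qed.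

Lemma cnear_and (z : C) (P Q : C -> Prop) :
  cnear z P -> cnear z Q -> cnear z (fun w => P w /\ Q w).
Proof.
  intros [d [Hd HP]] [d' [Hd' HQ]]. exists (Rmin d d'). split.
  - apply Rmin_glb_lt; assumption.
  - intros w Hw. split; [apply HP|apply HQ]; eapply Rlt_le_trans; try exact Hw;
      [apply Rmin_l|apply Rmin_r].
Qed.

Lemma cnear_impl (z : C) (P Q : C -> Prop) :
  (forall w, P w -> Q w) -> cnear z P -> cnear z Q.
Proof. intros H [d [Hd HP]]. exists d. split; [assumption|auto]. Qed.

Lemma cnear_self (z : C) (P : C -> Prop) : cnear z P -> P z.
Proof.
  intros [d [Hd HP]]. apply HP. replace (z - z)%C with (RtoC 0) by ring.
  rewrite Cmod_0. assumption.
Qed.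

Lemma cnear_locally (z : C) (P : C -> Prop) : cnear z P -> locally z P.
Proof.
  intros [d [Hd HP]].
  apply (proj2 (locally_C z P)).
  exists (mkposreal d Hd). intros w Hw. apply HP. exact Hw.
Qed.

Lemma locally_cnear (z : C) (P : C -> Prop) : locally z P -> cnear z P.
Proof.
  intros H. apply (proj1 (locally_C z P)) in H. destruct H as [d Hd].
  exists d. split; [apply cond_pos|]. intros w Hw. apply Hd. exact Hw.
Qed.

Lemma ccont_const (c z : C) : ccont (fun _ => c) z.
Proof.
  intros e He. exists 1. split; [lra|]. intros w _.
  replace (c - c)%C with (RtoC 0) by ring. rewrite Cmod_0. assumption.
Qed.

Lemma ccont_id (z : C) : ccont (fun w => w) z.
Proof. intros e He. exists e. split; [assumption|auto]. Qed.

Lemma ccont_plus (f g : C -> C) (z : C) :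
  ccont f z -> ccont g z -> ccont (fun w => f w + g w)%C z.
Proof.
  intros Hf Hg e He. specialize (Hf (e / 2)). specialize (Hg (e / 2)).
  eapply cnear_impl; [|apply cnear_and; [apply Hf|apply Hg]; lra].
  intros w [H1 H2]. simpl in *.
  replace (f w + g w - (f z + g z))%C with ((f w - f z) + (g w - g z))%C by ring.
  eapply Rle_lt_trans; [apply Cmod_triangle|lra].
Qed.

Lemma ccont_mult (f g : C -> C) (z : C) :
  ccont f z -> ccont g z -> ccont (fun w => f w * g w)%C z.
Proof.
  intros Hf Hg e He.
  pose proof (Cmod_ge_0 (f z)). pose proof (Cmod_ge_0 (g z)).
  set (m := 1 + Cmod (f z) + Cmod (g z)).
  assert (Hm : 1 <= m) by (unfold m; lra).
  assert (He' : 0 < Rmin 1 (e / (2 * m))).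
  { apply Rmin_glb_lt; [lra|]. apply Rdiv_lt_0_compat; lra. }
  eapply cnear_impl; [|apply cnear_and; [apply Hf|apply Hg]; exact He'].
  intros w [H1 H2].
  assert (L1 : Cmod (f w - f z) < e / (2 * m)) by (eapply Rlt_le_trans; [exact H1|apply Rmin_r]).
  assert (L2 : Cmod (g w - g z) < e / (2 * m)) by (eapply Rlt_le_trans; [exact H2|apply Rmin_r]).
  assert (L3 : Cmod (g w - g z) < 1) by (eapply Rlt_le_trans; [exact H2|apply Rmin_l]).
  replace (f w * g w - f z * g z)%C with ((f w - f z) * g w + f z * (g w - g z))%C by ring.
  eapply Rle_lt_trans; [apply Cmod_triangle|]. rewrite !Cmod_mult.
  assert (L4 : Cmod (g w) <= m).
  { pose proof (Cmod_triangle (g w - g z) (g z)) as T.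
    replace (g w - g z + g z)%C with (g w) in T by ring. unfold m. lra. }
  assert (Hk : e / (2 * m) * m = e / 2) by (field; lra).
  pose proof (Cmod_ge_0 (f w - f z)). pose proof (Cmod_ge_0 (g w - g z)).
  assert (Cmod (f w - f z) * Cmod (g w) <= Cmod (f w - f z) * m) by (apply Rmult_le_compat_l; lra).
  assert (Cmod (f z) * Cmod (g w - g z) <= m * Cmod (g w - g z)) by (apply Rmult_le_compat_r; unfold m in *; lra).
  assert (Cmod (f w - f z) * m < e / (2 * m) * m) by (apply Rmult_lt_compat_r; lra).
  assert (Cmod (g w - g z) * m < e / (2 * m) * m) by (apply Rmult_lt_compat_r; lra).
  lra.
Qed.

Lemma ccont_opp (f : C -> C) (z : C) : ccont f z -> ccont (fun w => - f w)%C z.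
Proof.
  intros Hf e He. eapply cnear_impl; [|apply (Hf e He)]. intros w Hw. simpl in *.
  replace (- f w - - f z)%C with (- (f w - f z))%C by ring. rewrite Cmod_opp. exact Hw.
Qed.

Lemma ccont_ext (f g : C -> C) (z : C) :
  cnear z (fun w => f w = g w) -> ccont f z -> ccont g z.
Proof.
  intros H Hf e He. pose proof (cnear_self _ _ H) as Hz. simpl in Hz.
  eapply cnear_impl; [|apply cnear_and; [apply H|apply (Hf e He)]].
  intros w [H1 H2]. simpl in *. rewrite <- H1, <- Hz. exact H2.
Qed.

Lemma ccont_minus (f g : C -> C) (z : C) :
  ccont f z -> ccont g z -> ccont (fun w => f w - g w)%C z.
Proof. intros Hf Hg. apply ccont_plus; [exact Hf|apply ccont_opp; exact Hg]. Qed.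

Lemma ccont_nonzero (f : C -> C) (z : C) :
  ccont f z -> f z <> 0 -> cnear z (fun w => Cmod (f z) / 2 < Cmod (f w)).
Proof.
  intros Hf Hz. apply Cmod_gt_0 in Hz.
  eapply cnear_impl; [|apply (Hf (Cmod (f z) / 2)); lra].
  intros w Hw. simpl in *. rewrite Cmod_minus_sym in Hw.
  pose proof (Cmod_triangle_inv (f z) (f w)). lra.
Qed.

Lemma Cmod_pos_neq (z : C) (r : R) : 0 <= r -> r < Cmod z -> z <> 0.
Proof. intros H1 H2. apply Cmod_gt_0. lra. Qed.

Lemma ccont_inv (f : C -> C) (z : C) :
  ccont f z -> f z <> 0 -> ccont (fun w => / f w)%C z.
Proof.
  intros Hf Hz e He. pose proof (proj1 (Cmod_gt_0 _) Hz) as Hm.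
  set (m := Cmod (f z)) in *.
  assert (He' : 0 < e * (m * m / 2)) by (apply Rmult_lt_0_compat; nra).
  eapply cnear_impl; [|apply cnear_and; [apply (ccont_nonzero f z Hf Hz)|apply (Hf _ He')]].
  intros w [H1 H2]. simpl in *. fold m in H1.
  assert (Hw : f w <> 0) by (apply (Cmod_pos_neq _ (m / 2)); lra).
  replace (/ f w - / f z)%C with ((f z - f w) / (f w * f z))%C by (field; auto).
  rewrite Cmod_div by (apply Cmult_neq_0; auto).
  rewrite Cmod_mult, Cmod_minus_sym. fold m.
  apply Rmult_lt_reg_r with (Cmod (f w) * m); [nra|].
  unfold Rdiv. rewrite Rmult_assoc, Rinv_l, Rmult_1_r by nra.
  eapply Rlt_le_trans; [exact H2|]. apply Rmult_le_compat_l; nra.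
Qed.

Lemma ccont_div (f g : C -> C) (z : C) :
  ccont f z -> ccont g z -> g z <> 0 -> ccont (fun w => f w / g w)%C z.
Proof. intros. apply ccont_mult; [assumption|apply ccont_inv; assumption]. Qed.

Lemma ccont_comp (f g : C -> C) (z : C) :
  ccont g z -> ccont f (g z) -> ccont (fun w => f (g w)) z.
Proof.
  intros Hg Hf e He. destruct (Hf e He) as [d [Hd H]].
  eapply cnear_impl; [|apply (Hg d Hd)]. intros w Hw. apply H. exact Hw.
Qed.

Lemma cderiv_ccont (f : C -> C) (z l : C) : cderiv f z l -> ccont f z.
Proof.
  intros [q [Hq [_ Hn]]].
  apply ccont_ext with (fun w => f z + q w * (w - z))%C.
  - eapply cnear_impl; [|exact Hn]. intros w Hw. simpl in *. rewrite <- Hw. ring.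
  - apply ccont_plus; [apply ccont_const|]. apply ccont_mult; [exact Hq|].
    apply ccont_minus; [apply ccont_id|apply ccont_const].
Qed.

Lemma cderiv_ext (f g : C -> C) (z l : C) :
  cnear z (fun w => f w = g w) -> cderiv f z l -> cderiv g z l.
Proof.
  intros H [q [Hq [Hl Hn]]]. exists q. split; [exact Hq|split; [exact Hl|]].
  pose proof (cnear_self _ _ H) as Hz. simpl in Hz.
  eapply cnear_impl; [|apply cnear_and; [apply H|apply Hn]].
  intros w [H1 H2]. simpl in *. rewrite <- H1, <- Hz. exact H2.
Qed.

Lemma cnear_true (z : C) (P : C -> Prop) : (forall w, P w) -> cnear z P.
Proof. intros H. exists 1. split; [lra|auto]. Qed.

Lemma cderiv_const (c z : C) : cderiv (fun _ => c) z 0.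
Proof.
  exists (fun _ => RtoC 0). split; [apply ccont_const|split; [reflexivity|]].
  apply cnear_true. intros w. ring.
Qed.

Lemma cderiv_id (z : C) : cderiv (fun w => w) z 1.
Proof.
  exists (fun _ => RtoC 1). split; [apply ccont_const|split; [reflexivity|]].
  apply cnear_true. intros w. ring.
Qed.

Lemma cderiv_plus (f g : C -> C) (z l m : C) :
  cderiv f z l -> cderiv g z m -> cderiv (fun w => f w + g w)%C z (l + m).
Proof.
  intros [q [Hq [Hl Hn]]] [p [Hp [Hm Hn']]]. exists (fun w => q w + p w)%C.
  split; [apply ccont_plus; assumption|split; [congruence|]].
  eapply cnear_impl; [|apply cnear_and; [apply Hn|apply Hn']].
  intros w [H1 H2]. simpl in *.
  replace (f w + g w - (f z + g z))%C with ((f w - f z) + (g w - g z))%C by ring.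
  rewrite H1, H2. ring.
Qed.

Lemma cderiv_mult (f g : C -> C) (z l m : C) :
  cderiv f z l -> cderiv g z m -> cderiv (fun w => f w * g w)%C z (l * g z + f z * m).
Proof.
  intros Hf Hg. pose proof (cderiv_ccont _ _ _ Hg) as Cg.
  destruct Hf as [q [Hq [Hl Hn]]]. destruct Hg as [p [Hp [Hm Hn']]].
  exists (fun w => q w * g w + f z * p w)%C.
  split; [|split; [congruence|]].
  - apply ccont_plus; apply ccont_mult; auto. apply ccont_const.
  - eapply cnear_impl; [|apply cnear_and; [apply Hn|apply Hn']].
    intros w [H1 H2]. simpl in *.
    replace (f w * g w - f z * g z)%C with ((f w - f z) * g w + f z * (g w - g z))%C by ring.
    rewrite H1, H2. ring.
Qed.

Lemma cderiv_opp (f : C -> C) (z l : C) : cderiv f z l -> cderiv (fun w => - f w)%C z (- l).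
Proof.
  intros Hf. replace (- l)%C with (0 * f z + (- (1)) * l)%C by ring.
  apply cderiv_ext with (fun w => (- (1)) * f w)%C.
  - apply cnear_true. intros w. ring.
  - apply (cderiv_mult (fun _ => - (1))%C f); [apply cderiv_const|exact Hf].
Qed.

Lemma cderiv_minus (f g : C -> C) (z l m : C) :
  cderiv f z l -> cderiv g z m -> cderiv (fun w => f w - g w)%C z (l - m).
Proof. intros Hf Hg. apply cderiv_plus; [exact Hf|apply cderiv_opp; exact Hg]. Qed.

Lemma cderiv_inv (f : C -> C) (z l : C) :
  cderiv f z l -> f z <> 0 -> cderiv (fun w => / f w)%C z (- l / (f z * f z)).
Proof.
  intros Hf Hz. pose proof (cderiv_ccont _ _ _ Hf) as Cf.
  destruct Hf as [q [Hq [Hl Hn]]].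
  exists (fun w => - q w / (f w * f z))%C. split; [|split; [congruence|]].
  - apply ccont_div; [apply ccont_opp; exact Hq|apply ccont_mult; [exact Cf|apply ccont_const]|].
    apply Cmult_neq_0; assumption.
  - eapply cnear_impl; [|apply cnear_and; [apply Hn|apply (ccont_nonzero f z Cf Hz)]].
    intros w [H1 H2]. simpl in *.
    assert (Hw : f w <> 0).
    { apply (Cmod_pos_neq _ (Cmod (f z) / 2)); [pose proof (Cmod_ge_0 (f z)); lra|exact H2]. }
    replace (/ f w - / f z)%C with (- (f w - f z) / (f w * f z))%C by (field; auto).
    rewrite H1. field. auto.
Qed.

Lemma cderiv_comp (f g : C -> C) (z l m : C) :
  cderiv g z m -> cderiv f (g z) l -> cderiv (fun w => f (g w)) z (l * m).
Proof.
  intros Hg [q [Hq [Hl Hn]]]. pose proof (cderiv_ccont _ _ _ Hg) as Cg.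
  destruct Hg as [p [Hp [Hm Hn']]].
  exists (fun w => q (g w) * p w)%C. split; [|split; [congruence|]].
  - apply ccont_mult; [apply ccont_comp; assumption|exact Hp].
  - destruct Hn as [d [Hd Hn]].
    eapply cnear_impl; [|apply cnear_and; [apply Hn'|apply (Cg d Hd)]].
    intros w [H1 H2]. simpl in *. rewrite (Hn _ H2), H1. ring.
Qed.

Lemma cderiv_eq (f : C -> C) (z l m : C) : cderiv f z l -> l = m -> cderiv f z m.
Proof. intros H <-. exact H. Qed.

Lemma cderiv_eps (f : C -> C) (z l : C) :
  cderiv f z l <->
  forall e, 0 < e -> cnear z (fun w => Cmod (f w - f z - l * (w - z)) <= e * Cmod (w - z)).
Proof.
  split.
  - intros [q [Hq [Hl Hn]]] e He.
    eapply cnear_impl; [|apply cnear_and; [apply Hn|apply (Hq e He)]].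
    intros w [H1 H2]. simpl in *. rewrite H1, <- Hl.
    replace (q w * (w - z) - q z * (w - z))%C with ((q w - q z) * (w - z))%C by ring.
    rewrite Cmod_mult. apply Rmult_le_compat_r; [apply Cmod_ge_0|lra].
  - intros H.
    (* The slope is the difference quotient filled in by [l] at [z]. The hypothesis is used with
       [e / 2] because continuity asks for a strict inequality. *)
    exists (fun w => if Ceq_dec w z then l else ((f w - f z) / (w - z))%C).
    split; [|split].
    + intros e He. eapply cnear_impl; [|apply (H (e / 2)); lra].
      intros w Hw. simpl in *. destruct (Ceq_dec z z) as [_|]; [|congruence].
      destruct (Ceq_dec w z) as [_|Hne].
      * replace (l - l)%C with (RtoC 0) by ring. rewrite Cmod_0. assumption.
      * apply Cminus_eq_contra in Hne.
        replace ((f w - f z) / (w - z) - l)%C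
          with ((f w - f z - l * (w - z)) / (w - z))%C by (field; auto).
        rewrite Cmod_div by auto. apply Cmod_gt_0 in Hne.
        apply Rle_lt_trans with (e / 2); [|lra].
        apply Rmult_le_reg_r with (Cmod (w - z)); [assumption|].
        unfold Rdiv at 1. rewrite Rmult_assoc, Rinv_l, Rmult_1_r by lra. exact Hw.
    + destruct (Ceq_dec z z); congruence.
    + apply cnear_true. intros w. destruct (Ceq_dec w z) as [->|Hne]; [ring|].
      apply Cminus_eq_contra in Hne. field. auto.
Qed.

Lemma is_derive_cderiv (f : C -> C) (z l : C) :
  @is_derive C_AbsRing C_NormedModule f z l <-> cderiv f z l.
Proof.
  rewrite cderiv_eps. split.
  - intros [_ H] e He. specialize (H z (fun P HP => HP) (mkposreal e He)).
    destruct H as [d Hd]. exists d. split; [apply cond_pos|].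
    intros w Hw. specialize (Hd w Hw). simpl in Hd.
    rewrite Cmult_comm. exact Hd.
  - intros H. split; [apply is_linear_scal_l|].
    (* The little-o clause of [is_derive] ranges over all limits of the filter; only [z] is one. *)
    intros x Hx e.
    assert (Hxz : z = x).
    { apply (is_filter_lim_locally_unique (K := C_AbsRing) (V := AbsRing_NormedModule C_AbsRing)). exact Hx. }
    subst x. destruct (H e (cond_pos e)) as [d [Hd Hn]].
    exists (mkposreal d Hd). intros w Hw. specialize (Hn w Hw).
    simpl in Hn. rewrite Cmult_comm in Hn. exact Hn.
Qed.

Lemma cderiv_C_derive (f : C -> C) (z : C) :
  @ex_derive C_AbsRing C_NormedModule f z -> cderiv f z (C_derive f z).
Proof.
  intros [l Hl]. rewrite (is_C_derive_unique f z l).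
  - apply is_derive_cderiv. exact Hl.
  - exact Hl.
Qed.

(** * Goursat's theorem for rectangles *)

Lemma Cminus_0_r (z : C) : (z - 0)%C = z.
Proof. ring. Qed.

(** * Componentwise integrals of complex-valued functions of a real variable *)

Definition pcont (g : R -> C) (t : R) : Prop :=
  forall e, 0 < e -> exists d, 0 < d /\ forall s, Rabs (s - t) < d -> Cmod (g s - g t) < e.

Definition CInt (g : R -> C) (a b : R) : C :=
  (RInt (fun t => fst (g t)) a b, RInt (fun t => snd (g t)) a b).

Lemma pcont_fst (g : R -> C) (t : R) : pcont g t -> continuous (fun s => fst (g s)) t.
Proof.
  intros H. apply continuity_pt_filterlim. intros e He. destruct (H e He) as [d [Hd Hs]].
  exists d. split; [exact Hd|]. intros s [_ Hst].
  unfold dist, R_met, R_dist in *; simpl in *; unfold R_dist in *.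
  eapply Rle_lt_trans; [|apply (Hs s Hst)].
  exact (fst_le_Cmod (g s - g t)).
Qed.

Lemma pcont_snd (g : R -> C) (t : R) : pcont g t -> continuous (fun s => snd (g s)) t.
Proof.
  intros H. apply continuity_pt_filterlim. intros e He. destruct (H e He) as [d [Hd Hs]].
  exists d. split; [exact Hd|]. intros s [_ Hst].
  simpl in *; unfold R_dist in *.
  eapply Rle_lt_trans; [|apply (Hs s Hst)].
  exact (snd_le_Cmod (g s - g t)).
Qed.

Lemma pcont_comp (f : C -> C) (g : R -> C) (t : R) :
  pcont g t -> ccont f (g t) -> pcont (fun s => f (g s)) t.
Proof.
  intros Hg Hf e He. destruct (Hf e He) as [d [Hd Hn]]. destruct (Hg d Hd) as [d' [Hd' Hs]].
  exists d'. split; [exact Hd'|]. intros s Hst. apply Hn. auto.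
Qed.

Lemma pcont_pair (u v : R -> R) (t : R) :
  continuity_pt u t -> continuity_pt v t -> pcont (fun s => (u s, v s)) t.
Proof.
  intros Hu Hv e He.
  destruct (Hu (e / 3)) as [d1 [Hd1 H1]]; [lra|]. destruct (Hv (e / 3)) as [d2 [Hd2 H2]]; [lra|].
  exists (Rmin d1 d2). split; [apply Rmin_glb_lt; assumption|]. intros s Hs.
  (* [continuity_pt] says nothing at [s = t], so that case is separate. *)
  assert (A : forall w d, (forall x, D_x no_cond t x /\ Rdist x t < d -> Rdist (w x) (w t) < e / 3) ->
     Rabs (s - t) < d -> Rabs (w s - w t) <= e / 3).
  { intros w d Hw Hd. destruct (Req_dec s t) as [->|Hne].
    - replace (w t - w t) with 0 by ring. rewrite Rabs_R0. lra.
    - left. apply (Hw s). split; [split; [exact I|congruence]|exact Hd]. }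
  eapply Rle_lt_trans; [apply (Cmod_le_components _ (e / 3))|lra].
  - exact (A u d1 H1 (Rlt_le_trans _ _ _ Hs (Rmin_l _ _))).
  - exact (A v d2 H2 (Rlt_le_trans _ _ _ Hs (Rmin_r _ _))).
Qed.

Definition Cint (g : R -> C) (a b : R) : Prop :=
  ex_RInt (fun t => fst (g t)) a b /\ ex_RInt (fun t => snd (g t)) a b.

Lemma Cint_pcont (g : R -> C) (a b : R) :
  a <= b -> (forall t, a <= t <= b -> pcont g t) -> Cint g a b.
Proof.
  intros Hab H. split; apply (ex_RInt_continuous (V := R_CompleteNormedModule)); intros t Ht;
    rewrite Rmin_left, Rmax_right in Ht by lra; [apply pcont_fst|apply pcont_snd]; auto.
Qed.

Lemma CInt_ext (f g : R -> C) (a b : R) :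
  a <= b -> (forall t, a < t < b -> f t = g t) -> CInt f a b = CInt g a b.
Proof.
  intros Hab H. unfold CInt.
  f_equal; apply RInt_ext; intros t Ht; rewrite Rmin_left, Rmax_right in Ht by lra;
    rewrite H; auto.
Qed.

Lemma CInt_plus (f g : R -> C) (a b : R) :
  Cint f a b -> Cint g a b -> CInt (fun t => f t + g t)%C a b = (CInt f a b + CInt g a b)%C.
Proof.
  intros [H1 H2] [H3 H4]. apply injective_projections; simpl.
  - exact (RInt_plus (fun t => fst (f t)) (fun t => fst (g t)) a b H1 H3).
  - exact (RInt_plus (fun t => snd (f t)) (fun t => snd (g t)) a b H2 H4).
Qed.

Lemma CInt_scal (c : C) (f : R -> C) (a b : R) :
  Cint f a b -> CInt (fun t => c * f t)%C a b = (c * CInt f a b)%C.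
Proof.
  intros [H1 H2].
  pose proof (RInt_scal _ a b (fst c) H1) as A1. pose proof (RInt_scal _ a b (fst c) H2) as A2.
  pose proof (RInt_scal _ a b (snd c) H1) as A3. pose proof (RInt_scal _ a b (snd c) H2) as A4.
  assert (B1 := ex_RInt_scal _ a b (fst c) H1). assert (B2 := ex_RInt_scal _ a b (fst c) H2).
  assert (B3 := ex_RInt_scal _ a b (snd c) H1). assert (B4 := ex_RInt_scal _ a b (snd c) H2).
  apply injective_projections; simpl.
  - pose proof (RInt_minus _ _ a b B1 B4) as E. unfold minus, plus, opp, scal in *; simpl in *.
    unfold mult in *; simpl in *. rewrite A1, A4 in E. unfold Rminus. exact E.
  - pose proof (RInt_plus _ _ a b B2 B3) as E. unfold minus, plus, opp, scal in *; simpl in *.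
    unfold mult in *; simpl in *. rewrite A2, A3 in E. exact E.
Qed.

Lemma Cint_scal (c : C) (f : R -> C) (a b : R) :
  Cint f a b -> Cint (fun t => c * f t)%C a b.
Proof.
  intros [H1 H2].
  assert (B1 := ex_RInt_scal _ a b (fst c) H1). assert (B2 := ex_RInt_scal _ a b (fst c) H2).
  assert (B3 := ex_RInt_scal _ a b (snd c) H1). assert (B4 := ex_RInt_scal _ a b (snd c) H2).
  split.
  - exact (ex_RInt_minus _ _ a b B1 B4).
  - exact (ex_RInt_plus _ _ a b B2 B3).
Qed.

Lemma Cint_plus (f g : R -> C) (a b : R) :
  Cint f a b -> Cint g a b -> Cint (fun t => f t + g t)%C a b.
Proof.
  intros [H1 H2] [H3 H4]. split.
  - exact (ex_RInt_plus _ _ a b H1 H3).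
  - exact (ex_RInt_plus _ _ a b H2 H4).
Qed.

Lemma CInt_minus (f g : R -> C) (a b : R) :
  Cint f a b -> Cint g a b -> CInt (fun t => f t - g t)%C a b = (CInt f a b - CInt g a b)%C.
Proof.
  intros [H1 H2] [H3 H4]. apply injective_projections; simpl.
  - exact (RInt_minus (fun t => fst (f t)) (fun t => fst (g t)) a b H1 H3).
  - exact (RInt_minus (fun t => snd (f t)) (fun t => snd (g t)) a b H2 H4).
Qed.

Lemma CInt_Chasles (f : R -> C) (a b c : R) :
  Cint f a b -> Cint f b c -> (CInt f a b + CInt f b c)%C = CInt f a c.
Proof.
  intros [H1 H2] [H3 H4]. apply injective_projections; simpl.
  - exact (RInt_Chasles _ a b c H1 H3).
  - exact (RInt_Chasles _ a b c H2 H4).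
Qed.

Lemma CInt_bound (f : R -> C) (a b m : R) :
  a <= b -> Cint f a b -> (forall t, a <= t <= b -> Cmod (f t) <= m) ->
  Cmod (CInt f a b) <= 2 * ((b - a) * m).
Proof.
  intros Hab [H1 H2] H. apply Cmod_le_components; simpl.
  - apply abs_RInt_le_const; auto. intros t Ht. eapply Rle_trans; [apply fst_le_Cmod|auto].
  - apply abs_RInt_le_const; auto. intros t Ht. eapply Rle_trans; [apply snd_le_Cmod|auto].
Qed.

Lemma CInt_const (c : C) (a b : R) : CInt (fun _ => c) a b = (RtoC (b - a) * c)%C.
Proof.
  apply injective_projections; simpl; rewrite RInt_const; unfold scal; simpl; unfold mult; simpl; ring.
Qed.

Lemma RInt_affine (u v a b : R) :
  RInt (fun t => u + v * t) a b = u * (b - a) + v * ((b ^ 2 - a ^ 2) / 2).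
Proof.
  apply is_RInt_unique.
  replace (u * (b - a) + v * ((b ^ 2 - a ^ 2) / 2))
    with (minus (u * b + v * (b ^ 2 / 2)) (u * a + v * (a ^ 2 / 2)))
    by (unfold minus, plus, opp; simpl; field).
  apply (is_RInt_derive (fun t => u * t + v * (t ^ 2 / 2)) (fun t => u + v * t)).
  - intros x _. auto_derive; [auto|field].
  - intros x _. apply continuity_pt_filterlim. apply derivable_continuous_pt.
    exists v. apply is_derive_Reals. auto_derive; [auto|ring].
Qed.

(** The integral of F(z) dz along the positively oriented boundary: bottom minus top, then [Ci]
    times right minus left. *)
Definition rect_int (F : C -> C) (x0 x1 y0 y1 : R) : C :=
  (CInt (fun s => F (s, y0)) x0 x1 - CInt (fun s => F (s, y1)) x0 x1
   + Ci * (CInt (fun t => F (x1, t)) y0 y1 - CInt (fun t => F (x0, t)) y0 y1))%C.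

Lemma pcont_hor (y s : R) : pcont (fun s => (s, y)) s.
Proof. apply pcont_pair; [apply continuity_pt_id|apply continuity_pt_const; intros ? ?; reflexivity]. Qed.

Lemma pcont_ver (x t : R) : pcont (fun t => (x, t)) t.
Proof. apply pcont_pair; [apply continuity_pt_const; intros ? ?; reflexivity|apply continuity_pt_id]. Qed.

Definition on_rect (P : C -> Prop) (x0 x1 y0 y1 : R) : Prop :=
  forall x y, x0 <= x <= x1 -> y0 <= y <= y1 -> P (x, y).

Lemma Cint_hor (F : C -> C) (x0 x1 y0 y1 a b y : R) :
  on_rect (ccont F) x0 x1 y0 y1 -> x0 <= a -> a <= b -> b <= x1 -> y0 <= y <= y1 ->
  Cint (fun s => F (s, y)) a b.
Proof.
  intros H H1 H2 H3 H4. apply Cint_pcont; [exact H2|]. intros t Ht.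
  apply (pcont_comp F (fun s => (s, y))); [apply pcont_hor|apply H; lra].
Qed.

Lemma Cint_ver (F : C -> C) (x0 x1 y0 y1 a b x : R) :
  on_rect (ccont F) x0 x1 y0 y1 -> y0 <= a -> a <= b -> b <= y1 -> x0 <= x <= x1 ->
  Cint (fun t => F (x, t)) a b.
Proof.
  intros H H1 H2 H3 H4. apply Cint_pcont; [exact H2|]. intros t Ht.
  apply (pcont_comp F (fun s => (x, s))); [apply pcont_ver|apply H; lra].
Qed.

Lemma rect_int_split (F : C -> C) (x0 x1 y0 y1 xm ym : R) :
  on_rect (ccont F) x0 x1 y0 y1 -> x0 <= xm <= x1 -> y0 <= ym <= y1 ->
  rect_int F x0 x1 y0 y1 =
    (rect_int F x0 xm y0 ym + rect_int F xm x1 y0 ym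
     + rect_int F x0 xm ym y1 + rect_int F xm x1 ym y1)%C.
Proof.
  intros H Hx Hy. unfold rect_int.
  assert (A : forall y, y0 <= y <= y1 ->
    CInt (fun s => F (s, y)) x0 x1 = (CInt (fun s => F (s, y)) x0 xm + CInt (fun s => F (s, y)) xm x1)%C).
  { intros y Hyy. symmetry. apply CInt_Chasles; apply (Cint_hor F x0 x1 y0 y1); (assumption || lra). }
  assert (B : forall x, x0 <= x <= x1 ->
    CInt (fun s => F (x, s)) y0 y1 = (CInt (fun s => F (x, s)) y0 ym + CInt (fun s => F (x, s)) ym y1)%C).
  { intros x Hxx. symmetry. apply CInt_Chasles; apply (Cint_ver F x0 x1 y0 y1); (assumption || lra). }
  rewrite !A, !B by lra. ring.
Qed.

Lemma rect_int_minus (F G : C -> C) (x0 x1 y0 y1 : R) :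
  x0 <= x1 -> y0 <= y1 -> on_rect (ccont F) x0 x1 y0 y1 -> on_rect (ccont G) x0 x1 y0 y1 ->
  rect_int (fun z => F z - G z)%C x0 x1 y0 y1 = (rect_int F x0 x1 y0 y1 - rect_int G x0 x1 y0 y1)%C.
Proof.
  intros Hx Hy HF HG. unfold rect_int.
  assert (A : forall y, y0 <= y <= y1 -> CInt (fun s => F (s, y) - G (s, y))%C x0 x1
    = (CInt (fun s => F (s, y)) x0 x1 - CInt (fun s => G (s, y)) x0 x1)%C).
  { intros y Hyy. apply (CInt_minus (fun s => F (s, y)) (fun s => G (s, y)));
      apply (Cint_hor _ x0 x1 y0 y1); (assumption || lra). }
  assert (B : forall x, x0 <= x <= x1 -> CInt (fun s => F (x, s) - G (x, s))%C y0 y1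
    = (CInt (fun s => F (x, s)) y0 y1 - CInt (fun s => G (x, s)) y0 y1)%C).
  { intros x Hxx. apply (CInt_minus (fun s => F (x, s)) (fun s => G (x, s)));
      apply (Cint_ver _ x0 x1 y0 y1); (assumption || lra). }
  rewrite !A, !B by lra. ring.
Qed.

Lemma rect_int_affine (c l : C) (x0 x1 y0 y1 : R) :
  rect_int (fun z => c + l * z)%C x0 x1 y0 y1 = 0.
Proof.
  destruct c as [c1 c2]. destruct l as [l1 l2]. unfold rect_int, CInt. simpl.
  (* [A], [B], [A'] and [B'] are the shapes that the components of c + l z take on horizontal and
     vertical sides. *)
  assert (A : forall u v w a b, RInt (fun t => u + (v * t - w)) a b
     = (u - w) * (b - a) + v * ((b ^ 2 - a ^ 2) / 2)).
  { intros. rewrite <- RInt_affine. apply RInt_ext. intros; simpl; ring. }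
  assert (B : forall u v w a b, RInt (fun t => u + (w + v * t)) a b
     = (u + w) * (b - a) + v * ((b ^ 2 - a ^ 2) / 2)).
  { intros. rewrite <- RInt_affine. apply RInt_ext. intros; simpl; ring. }
  assert (A' : forall u v w a b, RInt (fun t => u + (w - v * t)) a b
     = (u + w) * (b - a) + (- v) * ((b ^ 2 - a ^ 2) / 2)).
  { intros. rewrite <- RInt_affine. apply RInt_ext. intros; simpl; ring. }
  assert (B' : forall u v w a b, RInt (fun t => u + (v * t + w)) a b
     = (u + w) * (b - a) + v * ((b ^ 2 - a ^ 2) / 2)).
  { intros. rewrite <- RInt_affine. apply RInt_ext. intros; simpl; ring. }
  rewrite !A, !B, !A', !B'.
  apply injective_projections; simpl; field.
Qed.

Lemma rect_int_bound (F : C -> C) (x0 x1 y0 y1 m : R) :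
  x0 <= x1 -> y0 <= y1 -> on_rect (ccont F) x0 x1 y0 y1 ->
  on_rect (fun z => Cmod (F z) <= m) x0 x1 y0 y1 ->
  Cmod (rect_int F x0 x1 y0 y1) <= 4 * ((x1 - x0) + (y1 - y0)) * m.
Proof.
  intros Hx Hy HF Hm. unfold rect_int.
  assert (A : forall y, y0 <= y <= y1 -> Cmod (CInt (fun s => F (s, y)) x0 x1) <= 2 * ((x1 - x0) * m)).
  { intros y Hyy. apply CInt_bound; [lra| |intros t Ht; apply Hm; lra].
    apply (Cint_hor F x0 x1 y0 y1); (assumption || lra). }
  assert (B : forall x, x0 <= x <= x1 -> Cmod (CInt (fun s => F (x, s)) y0 y1) <= 2 * ((y1 - y0) * m)).
  { intros x Hxx. apply CInt_bound; [lra| |intros t Ht; apply Hm; lra].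
    apply (Cint_ver F x0 x1 y0 y1); (assumption || lra). }
  eapply Rle_trans; [apply Cmod_triangle|]. rewrite Cmod_mult, Cmod_Ci.
  pose proof (Cmod_triangle_minus (CInt (fun s => F (s, y0)) x0 x1) (CInt (fun s => F (s, y1)) x0 x1)).
  pose proof (Cmod_triangle_minus (CInt (fun t => F (x1, t)) y0 y1) (CInt (fun t => F (x0, t)) y0 y1)).
  pose proof (A y0). pose proof (A y1). pose proof (B x0). pose proof (B x1). lra.
Qed.

Lemma pow2_unbounded (x : R) : exists n : nat, x < 2 ^ n.
Proof.
  destruct (Pow_x_infinity 2) with (b := x + 1) as [n Hn].
  - rewrite Rabs_right; lra.
  - exists n. specialize (Hn n (le_n n)). rewrite Rabs_right in Hn; [lra|].
    apply Rle_ge, pow_le; lra.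
Qed.

Lemma two_pow_pos (n : nat) : 0 < 2 ^ n.
Proof. apply pow_lt; lra. Qed.

(** [p] is the supremum of the left endpoints: each of them lies below every right endpoint. *)
Lemma nested_intervals (x : nat -> R) (a : R) :
  0 <= a -> (forall n, x n <= x (S n) /\ x (S n) + a / 2 ^ S n <= x n + a / 2 ^ n) ->
  exists p, forall n, x n <= p <= x n + a / 2 ^ n.
Proof.
  intros Ha H.
  assert (M : forall n k, x n <= x (n + k)%nat /\ x (n + k)%nat + a / 2 ^ (n + k) <= x n + a / 2 ^ n).
  { intros n. induction k as [|k [I1 I2]].
    - rewrite Nat.add_0_r. lra.
    - rewrite Nat.add_succ_r. pose proof (H (n + k)%nat). lra. }
  assert (Pos : forall n, 0 <= a / 2 ^ n).
  { intros n. apply Rdiv_le_0_compat; [exact Ha|apply two_pow_pos]. }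
  assert (U : forall n m, x m <= x n + a / 2 ^ n).
  { intros n m. destruct (Nat.le_ge_cases n m) as [L|L].
    - replace m with (n + (m - n))%nat by lia. pose proof (M n (m - n)%nat).
      pose proof (Pos (n + (m - n))%nat). lra.
    - pose proof (M m (n - m)%nat) as K. replace (m + (n - m))%nat with n in K by lia.
      pose proof (Pos n). lra. }
  destruct (completeness (fun y => exists n, y = x n)) as [p [P1 P2]].
  - exists (x 0%nat + a / 2 ^ 0). intros y [n ->]. apply U.
  - exists (x 0%nat), 0%nat. reflexivity.
  - exists p. intros n. split.
    + apply P1. exists n. reflexivity.
    + apply P2. intros y [m ->]. apply U.
Qed.

(** Quartering: one of four subrectangles keeps at least a quarter of the modulus of the integral,
    so after n rounds E / 4^n is left, a fixed multiple of the squared size. Differentiability at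
    the limit point makes the integral of smaller order than the squared size. *)
Lemma goursat (F : C -> C) (x0 x1 y0 y1 : R) :
  x0 <= x1 -> y0 <= y1 -> on_rect (fun z => exists l, cderiv F z l) x0 x1 y0 y1 ->
  rect_int F x0 x1 y0 y1 = 0.
Proof.
  intros Hx Hy HF.
  assert (HC : on_rect (ccont F) x0 x1 y0 y1).
  { intros x y Hxx Hyy. destruct (HF x y Hxx Hyy) as [l Hl]. eapply cderiv_ccont, Hl. }
  apply NNPP. intros Hne. apply Cmod_gt_0 in Hne.
  set (E := Cmod (rect_int F x0 x1 y0 y1)) in *.
  set (a := x1 - x0). set (b := y1 - y0).
  assert (Ha : 0 <= a) by (unfold a; lra). assert (Hb : 0 <= b) by (unfold b; lra).
  (* A subrectangle of generation [n] is recorded by its lower left corner alone, its sides being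
     [a / 2 ^ n] and [b / 2 ^ n]. *)
  set (P := fun (n : nat) (c : R * R) =>
    x0 <= fst c /\ fst c + a / 2 ^ n <= x1 /\ y0 <= snd c /\ snd c + b / 2 ^ n <= y1 /\
    E / 4 ^ n <= Cmod (rect_int F (fst c) (fst c + a / 2 ^ n) (snd c) (snd c + b / 2 ^ n))).
  set (Q := fun (n : nat) (c c' : R * R) =>
    fst c <= fst c' /\ fst c' + a / 2 ^ S n <= fst c + a / 2 ^ n /\
    snd c <= snd c' /\ snd c' + b / 2 ^ S n <= snd c + b / 2 ^ n).
  assert (Step : forall n c, P n c -> exists c', P (S n) c' /\ Q n c c').
  { intros n [x y] [P1 [P2 [P3 [P4 P5]]]]. simpl fst in *; simpl snd in *.
    assert (Ea : a / 2 ^ n = a / 2 ^ S n + a / 2 ^ S n) by (simpl; field; apply pow_nonzero; lra).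
    assert (Eb : b / 2 ^ n = b / 2 ^ S n + b / 2 ^ S n) by (simpl; field; apply pow_nonzero; lra).
    assert (Pa : 0 <= a / 2 ^ S n) by (apply Rdiv_le_0_compat; [exact Ha|apply two_pow_pos]).
    assert (Pb : 0 <= b / 2 ^ S n) by (apply Rdiv_le_0_compat; [exact Hb|apply two_pow_pos]).
    set (h := a / 2 ^ S n) in *. set (k := b / 2 ^ S n) in *.
    rewrite Ea, Eb in P5.
    rewrite (rect_int_split F _ _ _ _ (x + h) (y + k)) in P5;
      [|intros u v Hu Hv; apply HC; lra|lra|lra].
    replace (x + (h + h)) with (x + h + h) in P5 by ring.
    replace (y + (k + k)) with (y + k + k) in P5 by ring.
    assert (E4 : E / 4 ^ n = 4 * (E / 4 ^ S n)) by (simpl; field; apply pow_nonzero; lra).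
    assert (K : E / 4 ^ S n <= Cmod (rect_int F x (x + h) y (y + k)) \/
                E / 4 ^ S n <= Cmod (rect_int F (x + h) (x + h + h) y (y + k)) \/
                E / 4 ^ S n <= Cmod (rect_int F x (x + h) (y + k) (y + k + k)) \/
                E / 4 ^ S n <= Cmod (rect_int F (x + h) (x + h + h) (y + k) (y + k + k))).
    { apply NNPP. intros N.
      assert (N1 : Cmod (rect_int F x (x + h) y (y + k)) < E / 4 ^ S n) by (apply Rnot_le_lt; tauto).
      assert (N2 : Cmod (rect_int F (x + h) (x + h + h) y (y + k)) < E / 4 ^ S n) by (apply Rnot_le_lt; tauto).
      assert (N3 : Cmod (rect_int F x (x + h) (y + k) (y + k + k)) < E / 4 ^ S n) by (apply Rnot_le_lt; tauto).
      assert (N4 : Cmod (rect_int F (x + h) (x + h + h) (y + k) (y + k + k)) < E / 4 ^ S n)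
        by (apply Rnot_le_lt; tauto).
      match type of P5 with _ <= Cmod (?A + ?B + ?C + ?D)%C =>
        pose proof (Cmod_triangle (A + B + C)%C D);
        pose proof (Cmod_triangle (A + B)%C C);
        pose proof (Cmod_triangle A B) end.
      lra. }
    unfold P, Q. fold h. fold k.
    destruct K as [K|[K|[K|K]]];
      [exists (x, y)|exists (x + h, y)|exists (x, y + k)|exists (x + h, y + k)];
      simpl fst; simpl snd; repeat split; try exact K; lra. }
  assert (P0 : P 0%nat (x0, y0)).
  { unfold P, a, b; simpl. repeat split; try lra.
    replace (x0 + (x1 - x0) / 1) with x1 by field. replace (y0 + (y1 - y0) / 1) with y1 by field.
    fold E. lra. }
  (* Dependent choice: each corner carries its proof of [P n], from which [Step] yields the next
     one. *)
  set (step := fun n (c : {c : R * R | P n c}) =>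
    constructive_indefinite_description _ (Step n (proj1_sig c) (proj2_sig c))).
  set (seq := fix seq n : {c : R * R | P n c} :=
    match n with
    | O => exist _ (x0, y0) P0
    | S n => exist _ (proj1_sig (step n (seq n))) (proj1 (proj2_sig (step n (seq n))))
    end).
  set (c := fun n => proj1_sig (seq n)).
  assert (HP : forall n, P n (c n)) by (intros n; apply (proj2_sig (seq n))).
  assert (HQ : forall n, Q n (c n) (c (S n))).
  { intros n. exact (proj2 (proj2_sig (step n (seq n)))). }
  destruct (nested_intervals (fun n => fst (c n)) a Ha) as [px Hpx].
  { intros n. destruct (HQ n) as [? [? _]]. split; assumption. }
  destruct (nested_intervals (fun n => snd (c n)) b Hb) as [py Hpy].
  { intros n. destruct (HQ n) as [_ [_ [? ?]]]. split; assumption. }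
  destruct (HF px py) as [l Hl].
  { pose proof (Hpx 0%nat). destruct (HP 0%nat) as [A1 [A2 _]]. lra. }
  { pose proof (Hpy 0%nat). destruct (HP 0%nat) as [_ [_ [A1 [A2 _]]]]. lra. }
  (* With this [e] the final bound E <= 8 e (a + b)^2 contradicts 16 e (a + b + 1)^2 = E. The
     summand 1 covers degenerate rectangles. *)
  apply cderiv_eps with (e := E / (16 * (a + b + 1) ^ 2)) in Hl;
    [|apply Rdiv_lt_0_compat; nra].
  destruct Hl as [d [Hd Hn]]. set (e := E / (16 * (a + b + 1) ^ 2)) in *.
  destruct (pow2_unbounded (2 * (a + b) / d)) as [n Hnd].
  destruct (HP n) as [A1 [A2 [A3 [A4 A5]]]].
  specialize (Hpx n). specialize (Hpy n). simpl in Hpx, Hpy.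
  set (x := fst (c n)) in *. set (y := snd (c n)) in *.
  set (h := a / 2 ^ n) in *. set (k := b / 2 ^ n) in *.
  assert (Hh : 0 <= h) by (apply Rdiv_le_0_compat; [exact Ha|apply two_pow_pos]).
  assert (Hk : 0 <= k) by (apply Rdiv_le_0_compat; [exact Hb|apply two_pow_pos]).
  assert (Hhk : 2 * (h + k) < d).
  { unfold h, k. replace (2 * (a / 2 ^ n + b / 2 ^ n)) with (2 * (a + b) / 2 ^ n)
      by (field; apply pow_nonzero; lra).
    apply Rmult_lt_reg_r with (2 ^ n); [apply two_pow_pos|].
    unfold Rdiv. rewrite Rmult_assoc, Rinv_l, Rmult_1_r by (apply pow_nonzero; lra).
    apply Rmult_lt_reg_r with (/ d); [apply Rinv_0_lt_compat; exact Hd|].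
    replace (d * 2 ^ n * / d) with (2 ^ n) by (field; lra). exact Hnd. }
  set (p := (px, py) : C) in *.
  (* The affine approximation of [F] at [p] has zero boundary integral, so only the remainder, at
     most e * 2 (h + k), has to be estimated. *)
  set (G := fun z : C => ((F p - l * p) + l * z)%C).
  assert (HG : forall z, ccont G z).
  { intros z. apply ccont_plus; [apply ccont_const|]. apply ccont_mult; [apply ccont_const|apply ccont_id]. }
  assert (HCn : on_rect (ccont F) x (x + h) y (y + k)) by (intros u v Hu Hv; apply HC; lra).
  assert (B : Cmod (rect_int (fun z => F z - G z)%C x (x + h) y (y + k))
     <= 4 * ((x + h - x) + (y + k - y)) * (e * (2 * (h + k)))).
  { apply rect_int_bound; [lra|lra| |].
    - intros u v Hu Hv. apply ccont_minus; [apply HCn; assumption|apply HG].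
    - intros u v Hu Hv.
      assert (Cmod ((u, v) - p) <= 2 * (h + k)).
      { apply Cmod_le_components; simpl; apply Rabs_le; lra. }
      assert (K := Hn (u, v) ltac:(lra)). simpl in K.
      unfold G. replace (F (u, v) - (F p - l * p + l * (u, v)))%C
        with (F (u, v) - F p - l * ((u, v) - p))%C by ring.
      eapply Rle_trans; [exact K|]. apply Rmult_le_compat_l; [|assumption].
      unfold e. left. apply Rdiv_lt_0_compat; nra. }
  rewrite rect_int_minus in B; [|lra|lra|exact HCn|intros u v _ _; apply HG].
  unfold G in B. rewrite rect_int_affine in B.
  rewrite (Cminus_0_r (rect_int F x (x + h) y (y + k))) in B.
  assert (B' : E / 4 ^ n <= 8 * e * (h + k) ^ 2) by nra.
  replace ((h + k) ^ 2) with ((a + b) ^ 2 / 4 ^ n) in B'.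
  2:{ unfold h, k. replace 4 with (2 * 2) by ring. rewrite Rpow_mult_distr. field.
      apply pow_nonzero; lra. }
  assert (H4 : 0 < 4 ^ n) by (apply pow_lt; lra).
  assert (B2 : E <= 8 * e * (a + b) ^ 2).
  { apply Rmult_le_reg_r with (/ 4 ^ n); [apply Rinv_0_lt_compat; exact H4|].
    unfold Rdiv in B'. lra. }
  assert (B3 : 16 * e * (a + b + 1) ^ 2 = E) by (unfold e; field; nra).
  assert (0 < e) by (apply Rdiv_lt_0_compat; nra).
  nra.
Qed.

(** * Means over circles *)

Definition cexp (z : C) : C := (exp (fst z) * cos (snd z), exp (fst z) * sin (snd z)).

Lemma cexp_plus (z w : C) : cexp (z + w) = (cexp z * cexp w)%C.
Proof.
  destruct z as [a b]. destruct w as [c d]. unfold cexp, Cplus, Cmult; simpl.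
  rewrite exp_plus, cos_plus, sin_plus. f_equal; ring.
Qed.

Lemma derivable_pt_lim_0 (f : R -> R) (l e : R) :
  derivable_pt_lim f 0 l -> 0 < e ->
  exists d, 0 < d /\ forall h, Rabs h < d -> Rabs (f h - f 0 - l * h) <= e * Rabs h.
Proof.
  intros H He. destruct (H e He) as [d Hd]. exists d. split; [apply cond_pos|].
  intros h Hh. destruct (Req_dec h 0) as [->|Hne].
  - replace (f 0 - f 0 - l * 0) with 0 by ring. rewrite Rabs_R0. lra.
  - specialize (Hd h Hne Hh). rewrite Rplus_0_l in Hd.
    replace (f h - f 0 - l * h) with (((f h - f 0) / h - l) * h) by (field; exact Hne).
    rewrite Rabs_mult. apply Rmult_le_compat_r; [apply Rabs_pos|lra].
Qed.

Lemma cderiv_cexp_0 : cderiv cexp 0 1.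
Proof.
  apply cderiv_eps. intros e0 He0.
  (* Each component will err by at most 5 e m, hence the total by 10 e m <= (e0 / 2) m. *)
  set (e := Rmin 1 (e0 / 20)).
  assert (He : 0 < e) by (apply Rmin_glb_lt; lra).
  assert (He1 : e <= 1) by apply Rmin_l. assert (He2 : e <= e0 / 20) by apply Rmin_r.
  destruct (derivable_pt_lim_0 exp 1 e) as [d1 [Hd1 H1]];
    [rewrite <- exp_0; apply derivable_pt_lim_exp|exact He|].
  destruct (derivable_pt_lim_0 cos 0 e) as [d2 [Hd2 H2]];
    [replace 0 with (- sin 0) at 2 by (rewrite sin_0; ring); apply derivable_pt_lim_cos|exact He|].
  destruct (derivable_pt_lim_0 sin 1 e) as [d3 [Hd3 H3]];
    [rewrite <- cos_0; apply derivable_pt_lim_sin|exact He|].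
  (* As m < e / 2, the product (exp x - 1) sin y, at most 4 m^2, stays below 2 e m. *)
  exists (Rmin (e / 2) (Rmin d1 (Rmin d2 d3))). split.
  - repeat apply Rmin_glb_lt; lra.
  - intros [x y] Hw.
    rewrite (Cminus_0_r (x, y)) in *.
    set (m := Cmod (x, y)) in *.
    assert (Hx : Rabs x <= m) by apply (fst_le_Cmod (x, y)).
    assert (Hy : Rabs y <= m) by apply (snd_le_Cmod (x, y)).
    pose proof (Rmin_l (e / 2) (Rmin d1 (Rmin d2 d3))).
    pose proof (Rmin_r (e / 2) (Rmin d1 (Rmin d2 d3))).
    pose proof (Rmin_l d1 (Rmin d2 d3)). pose proof (Rmin_r d1 (Rmin d2 d3)).
    pose proof (Rmin_l d2 d3). pose proof (Rmin_r d2 d3).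
    specialize (H1 x ltac:(lra)). specialize (H2 y ltac:(lra)). specialize (H3 y ltac:(lra)).
    rewrite exp_0 in H1. rewrite cos_0 in H2. rewrite sin_0 in H3.
    pose proof (Rabs_pos x). pose proof (Rabs_pos y).
    assert (Ex : Rabs (exp x - 1) <= 2 * m).
    { replace (exp x - 1) with ((exp x - 1 - 1 * x) + x) by ring.
      eapply Rle_trans; [apply Rabs_triang|]. nra. }
    assert (Ex2 : Rabs (exp x) <= 3).
    { replace (exp x) with ((exp x - 1) + 1) by ring.
      eapply Rle_trans; [apply Rabs_triang|]. rewrite Rabs_R1. lra. }
    assert (Cy : Rabs (cos y - 1) <= e * m).
    { replace (cos y - 1) with (cos y - 1 - 0 * y) by ring. nra. }
    assert (Sy : Rabs (sin y) <= 2 * m).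
    { replace (sin y) with ((sin y - 0 - 1 * y) + y) by ring.
      eapply Rle_trans; [apply Rabs_triang|]. nra. }
    assert (Sy' : Rabs (sin y - y) <= e * m).
    { replace (sin y - y) with (sin y - 0 - 1 * y) by ring. nra. }
    assert (Ex' : Rabs (exp x - 1 - x) <= e * m).
    { replace (exp x - 1 - x) with (exp x - 1 - 1 * x) by ring. nra. }
    apply Rle_trans with (2 * (5 * (e * m))); [|nra].
    apply Cmod_le_components; unfold cexp; simpl.
    + match goal with |- Rabs ?t <= _ => replace t with ((exp x - 1 - x) + exp x * (cos y - 1))
        by (rewrite exp_0, cos_0; ring) end.
      eapply Rle_trans; [apply Rabs_triang|]. rewrite Rabs_mult.
      pose proof (Rabs_pos (exp x)). pose proof (Rabs_pos (cos y - 1)). nra.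
    + match goal with |- Rabs ?t <= _ => replace t with ((exp x - 1) * sin y + (sin y - y))
        by (rewrite sin_0; ring) end.
      eapply Rle_trans; [apply Rabs_triang|]. rewrite Rabs_mult.
      pose proof (Rabs_pos (exp x - 1)). pose proof (Rabs_pos (sin y)).
      assert (Rabs (exp x - 1) * Rabs (sin y) <= (2 * m) * (2 * m)) by (apply Rmult_le_compat; lra).
      nra.
Qed.

Lemma cderiv_cexp (z : C) : cderiv cexp z (cexp z).
Proof.
  apply cderiv_ext with (fun w => cexp z * cexp (w - z))%C.
  - apply cnear_true. intros w. rewrite <- cexp_plus. f_equal. ring.
  - eapply cderiv_eq.
    + apply (cderiv_mult (fun _ => cexp z) (fun w => cexp (w - z))); [apply cderiv_const|].
      apply (cderiv_comp cexp (fun w => w - z)%C);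
        [apply (cderiv_minus (fun w => w) (fun _ => z)); [apply cderiv_id|apply cderiv_const]|].
      replace (z - z)%C with (RtoC 0) by ring. apply cderiv_cexp_0.
    + ring.
Qed.

Definition circ (r t : R) : C := (r * cos t, r * sin t).

Lemma Cmod_circ (r t : R) : Cmod (circ r t) = Rabs r.
Proof.
  unfold Cmod, circ; simpl. rewrite <- sqrt_Rsqr_abs. f_equal. unfold Rsqr.
  pose proof (sin2_cos2 t) as E. unfold Rsqr in E. nra.
Qed.

Lemma cexp_circ (s t : R) : cexp (s, t) = circ (exp s) t.
Proof. reflexivity. Qed.

(** Not normalized: a constant has mean 2 PI times itself. Integration is against dt, that is dz /
    (i z), whence the Cauchy kernel takes the form z / (z - a). *)
Definition mean (G : C -> C) (r : R) : C := CInt (fun t => G (circ r t)) 0 (2 * PI).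

Lemma two_PI_pos : 0 < 2 * PI.
Proof. pose proof PI_RGT_0. lra. Qed.

Lemma pcont_circ (r t : R) : pcont (circ r) t.
Proof.
  apply (pcont_pair (fun t => r * cos t) (fun t => r * sin t));
    apply continuity_pt_mult; try (apply continuity_pt_const; intros ? ?; reflexivity).
  - apply continuity_cos.
  - apply continuity_sin.
Qed.

Lemma Cint_circ (G : C -> C) (r : R) :
  0 <= r -> (forall z, Cmod z = r -> ccont G z) -> Cint (fun t => G (circ r t)) 0 (2 * PI).
Proof.
  intros Hr H. apply Cint_pcont; [left; apply two_PI_pos|]. intros t _.
  apply (pcont_comp G (circ r)); [apply pcont_circ|]. apply H. rewrite Cmod_circ, Rabs_right; lra.
Qed.

(** [cexp] wraps the rectangle [ln r1, ln r2] x [0, 2 PI] around the annulus. By periodicity the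
    horizontal sides cancel, and the vertical sides are the two means. *)
Lemma mean_annulus (G : C -> C) (r1 r2 : R) :
  0 < r1 -> r1 <= r2 -> (forall z, r1 <= Cmod z <= r2 -> exists l, cderiv G z l) ->
  mean G r1 = mean G r2.
Proof.
  intros H1 H2 H. pose proof two_PI_pos as HPI.
  assert (K : rect_int (fun z => G (cexp z)) (ln r1) (ln r2) 0 (2 * PI) = 0).
  { apply goursat; [|lra|].
    - destruct H2 as [H2| ->]; [left; apply ln_increasing; lra|right; reflexivity].
    - intros x y Hx _. destruct (H (cexp (x, y))) as [l Hl].
      + rewrite cexp_circ, Cmod_circ, Rabs_right by (apply Rle_ge; left; apply exp_pos).
        rewrite <- (exp_ln r1), <- (exp_ln r2) by lra.
        assert (M : forall u v, u <= v -> exp u <= exp v).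
        { intros u v [L| ->]; [left; apply exp_increasing; exact L|right; reflexivity]. }
        split; apply M; lra.
      + exists (l * cexp (x, y))%C. apply cderiv_comp; [apply cderiv_cexp|exact Hl]. }
  unfold rect_int in K.
  rewrite (CInt_ext (fun s => G (cexp (s, 2 * PI))) (fun s => G (cexp (s, 0)))) in K.
  2:{ destruct H2 as [H2| ->]; [left; apply ln_increasing; lra|right; reflexivity]. }
  2:{ intros t _. f_equal. unfold cexp; simpl fst; simpl snd.
      rewrite cos_2PI, sin_2PI, cos_0, sin_0. reflexivity. }
  assert (E : forall r, 0 < r -> CInt (fun t => G (cexp (ln r, t))) 0 (2 * PI) = mean G r).
  { intros r Hr. apply CInt_ext; [lra|]. intros t _. rewrite cexp_circ, exp_ln by exact Hr. reflexivity. }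
  rewrite !E in K by lra.
  assert (K2 : (Ci * (mean G r2 - mean G r1))%C = 0) by (rewrite <- K; ring).
  replace (mean G r2) with (mean G r1 + (- Ci) * (Ci * (mean G r2 - mean G r1)))%C.
  - rewrite K2. ring.
  - apply injective_projections; simpl; ring.
Qed.

Lemma circ_0 (t : R) : circ 0 t = 0.
Proof. unfold circ. rewrite !Rmult_0_l. reflexivity. Qed.

Lemma continuity_2d_circ (G : C -> C) (t r : R) :
  ccont G (circ r t) ->
  continuity_2d_pt (fun u v => fst (G (circ v u))) t r /\
  continuity_2d_pt (fun u v => snd (G (circ v u))) t r.
Proof.
  intros H.
  assert (Hc : continuity_2d_pt (fun u v => v * cos u) t r).
  { apply continuity_2d_pt_mult; [apply continuity_2d_pt_id2|].
    apply (continuity_1d_2d_pt_comp cos (fun u _ => u)); [apply continuity_cos|apply continuity_2d_pt_id1]. }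
  assert (Hs : continuity_2d_pt (fun u v => v * sin u) t r).
  { apply continuity_2d_pt_mult; [apply continuity_2d_pt_id2|].
    apply (continuity_1d_2d_pt_comp sin (fun u _ => u)); [apply continuity_sin|apply continuity_2d_pt_id1]. }
  assert (K : forall eps : posreal, exists d : posreal, forall u v,
    Rabs (u - t) < d -> Rabs (v - r) < d -> Cmod (G (circ v u) - G (circ r t)) < eps).
  { intros eps. destruct (H eps (cond_pos eps)) as [d [Hd Hn]].
    assert (Hd3 : 0 < d / 3) by lra.
    destruct (Hc (mkposreal _ Hd3)) as [d1 K1]. destruct (Hs (mkposreal _ Hd3)) as [d2 K2].
    assert (Hm : 0 < Rmin d1 d2) by (apply Rmin_glb_lt; apply cond_pos).
    exists (mkposreal _ Hm). simpl. intros u v Hu Hv. apply Hn.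
    pose proof (Rmin_l d1 d2). pose proof (Rmin_r d1 d2).
    eapply Rle_lt_trans; [apply (Cmod_le_components _ (d / 3))|lra].
    - left. apply (K1 u v); lra.
    - left. apply (K2 u v); lra. }
  split; intros eps; destruct (K eps) as [d Hd]; exists d; intros u v Hu Hv;
    (eapply Rle_lt_trans; [|apply (Hd u v Hu Hv)]).
  - exact (fst_le_Cmod (G (circ v u) - G (circ r t))).
  - exact (snd_le_Cmod (G (circ v u) - G (circ r t))).
Qed.

Lemma mean_continuous (G : C -> C) (rho c : R) :
  (forall z, Cmod z < rho -> ccont G z) -> 0 <= c < rho ->
  forall e, 0 < e -> exists d, 0 < d /\
    forall r, 0 <= r < rho -> Rabs (r - c) < d -> Cmod (mean G r - mean G c) < e.
Proof.
  intros H Hc e He. pose proof two_PI_pos as HPI.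
  (* The components and the integral bound each cost a factor 2, so the result will be 2 * 2 PI * 2
     * e / (12 PI) = 2 e / 3. *)
  assert (Heps : 0 < e / (12 * PI)) by (apply Rdiv_lt_0_compat; lra).
  assert (HG : forall t, ccont G (circ c t)).
  { intros t. apply H. rewrite Cmod_circ, Rabs_right; lra. }
  destruct (uniform_continuity_2d_1d (fun u v => fst (G (circ v u))) 0 (2 * PI) c
    (fun x _ => proj1 (continuity_2d_circ G x c (HG x))) (mkposreal _ Heps)) as [d1 H1].
  destruct (uniform_continuity_2d_1d (fun u v => snd (G (circ v u))) 0 (2 * PI) c
    (fun x _ => proj2 (continuity_2d_circ G x c (HG x))) (mkposreal _ Heps)) as [d2 H2].
  exists (Rmin d1 d2). split; [apply Rmin_glb_lt; apply cond_pos|].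
  intros r Hr Hrc.
  pose proof (Rmin_l d1 d2). pose proof (Rmin_r d1 d2).
  assert (Ir : Cint (fun t => G (circ r t)) 0 (2 * PI))
    by (apply Cint_circ; [lra|intros z Hz; apply H; lra]).
  assert (Ic : Cint (fun t => G (circ c t)) 0 (2 * PI))
    by (apply Cint_circ; [lra|intros z Hz; apply H; lra]).
  unfold mean. rewrite <- CInt_minus by assumption.
  assert (B : forall t, 0 <= t <= 2 * PI -> Cmod (G (circ r t) - G (circ c t)) <= 2 * (e / (12 * PI))).
  { intros t Ht. apply Rabs_def2 in Hrc.
    pose proof (cond_pos d1). pose proof (cond_pos d2).
    assert (Z : Rabs (t - t) < Rmin d1 d2).
    { replace (t - t) with 0 by ring. rewrite Rabs_R0. apply Rmin_glb_lt; lra. }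
    apply Cmod_le_components; left.
    - apply (H1 t c t r); lra.
    - apply (H2 t c t r); lra. }
  eapply Rle_lt_trans.
  - apply CInt_bound; [lra| |exact B].
    apply (Cint_plus (fun t => G (circ r t)) (fun t => - G (circ c t))%C); [exact Ir|].
    destruct Ic as [I1 I2]. split; [exact (ex_RInt_opp _ _ _ I1)|exact (ex_RInt_opp _ _ _ I2)].
  - replace (2 * ((2 * PI - 0) * (2 * (e / (12 * PI))))) with (2 * e / 3) by (field; lra). lra.
Qed.

Lemma Cmod_small_eq (a b : C) : (forall e, 0 < e -> Cmod (a - b) < e) -> a = b.
Proof.
  intros H. apply Ceq_minus, Cmod_eq_0. apply Rle_antisym; [|apply Cmod_ge_0].
  apply Rnot_lt_le. intros K. specialize (H _ K). lra.
Qed.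

(* An exceptional circle, on which [G] need only be continuous, costs nothing:
   the circle means are constant on both sides of it and continuous across it. *)
Lemma mean_value (G : C -> C) (rho s r : R) :
  (forall z, Cmod z < rho -> ccont G z) ->
  (forall z, Cmod z < rho -> z <> 0 -> Cmod z <> s -> exists l, cderiv G z l) ->
  0 < r < rho -> mean G r = (RtoC (2 * PI) * G 0)%C.
Proof.
  intros HC HD Hr.
  assert (M0 : mean G 0 = (RtoC (2 * PI) * G 0)%C).
  { unfold mean. rewrite (CInt_ext _ (fun _ => G 0)).
    - rewrite CInt_const. f_equal. f_equal. ring.
    - left. apply two_PI_pos.
    - intros t _. rewrite circ_0. reflexivity. }
  rewrite <- M0. clear M0.
  assert (A : forall r1 r2, 0 < r1 -> r1 <= r2 -> r2 < rho -> (s < r1 \/ r2 < s) -> mean G r1 = mean G r2).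
  { intros r1 r2 H1 H2 H3 H4. apply mean_annulus; [lra|lra|]. intros z Hz. apply HD; try lra.
    apply Cmod_gt_0. lra. }
  (* [A] needs a closed annulus that meets neither the center nor the circle of radius [s]. By
     continuity of the means, [Left] lets the inner radius be 0 or [s], and [Right] the outer radius
     be [s]. *)
  assert (Left : forall c q, 0 <= c -> c < q -> q < rho -> (s <= c \/ q < s) -> mean G q = mean G c).
  { intros c q H1 H2 H3 H4. apply Cmod_small_eq. intros e He.
    destruct (mean_continuous G rho c HC ltac:(lra) e He) as [d [Hd Hn]].
    set (t := Rmin q (c + d / 2)).
    assert (T1 : t <= q) by apply Rmin_l. assert (T2 : t <= c + d / 2) by apply Rmin_r.
    assert (T3 : c < t) by (apply Rmin_glb_lt; lra).
    rewrite <- (A t q) by lra. apply Hn; [lra|]. rewrite Rabs_right; lra. }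
  assert (Right : forall c q, 0 < q -> q < c -> c < rho -> (s < q \/ c <= s) -> mean G q = mean G c).
  { intros c q H1 H2 H3 H4. apply Cmod_small_eq. intros e He.
    destruct (mean_continuous G rho c HC ltac:(lra) e He) as [d [Hd Hn]].
    set (t := Rmax q (c - d / 2)).
    assert (T1 : q <= t) by apply Rmax_l. assert (T2 : c - d / 2 <= t) by apply Rmax_r.
    assert (T3 : t < c) by (apply Rmax_lub_lt; lra).
    rewrite (A q t) by lra. apply Hn; [lra|]. rewrite Rabs_left; lra. }
  destruct (Rle_lt_dec s 0) as [Hs|Hs]; [apply Left; lra|].
  destruct (Rtotal_order r s) as [L|[L|L]].
  - apply Left; lra.
  - rewrite <- (Right r (r / 2)) by lra. apply Left; lra.
  - rewrite (Left s r) by lra. rewrite <- (Right s (s / 2)) by lra. apply Left; lra.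
Qed.

(** * Cauchy's formula and its consequences *)

Definition holo (rho : R) (f : C -> C) : Prop :=
  forall z, Cmod z < rho -> exists l, cderiv f z l.

Lemma circ_neq (r t : R) (a : C) : Cmod a < r -> circ r t <> a.
Proof.
  intros H E. pose proof (Cmod_circ r t) as K. rewrite E in K.
  pose proof (Cmod_ge_0 a). rewrite Rabs_right in K; lra.
Qed.

Lemma Cmod_circ_minus (r t : R) (a : C) : Cmod a < r -> r - Cmod a <= Cmod (circ r t - a).
Proof.
  intros H. pose proof (Cmod_triangle_inv (circ r t) a) as K. pose proof (Cmod_ge_0 a).
  rewrite Cmod_circ, Rabs_right in K; lra.
Qed.

Lemma Cint_circ' (G : C -> C) (r : R) :
  0 <= r -> (forall t, ccont G (circ r t)) -> Cint (fun t => G (circ r t)) 0 (2 * PI).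
Proof.
  intros Hr H. apply Cint_pcont; [left; apply two_PI_pos|]. intros t _.
  apply (pcont_comp G (circ r)); [apply pcont_circ|apply H].
Qed.

Lemma mean_bound (G : C -> C) (r m : R) :
  0 <= r -> (forall t, ccont G (circ r t)) -> (forall t, Cmod (G (circ r t)) <= m) ->
  Cmod (mean G r) <= 4 * PI * m.
Proof.
  intros Hr HG Hm. replace (4 * PI * m) with (2 * ((2 * PI - 0) * m)) by ring.
  apply CInt_bound; [left; apply two_PI_pos|apply Cint_circ'; assumption|auto].
Qed.

Lemma ccont_kernel (a z : C) : z <> a -> ccont (fun z => z / (z - a))%C z.
Proof.
  intros H. apply (ccont_div (fun z => z) (fun z => z - a)%C);
    [apply ccont_id|apply ccont_minus; [apply ccont_id|apply ccont_const]|].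
  apply Cminus_eq_contra. exact H.
Qed.

(** z / (z - a) = 1 + a / (z - a), and the mean of the second term tends to 0 as the radius grows,
    while [mean_annulus] makes the total independent of the radius. *)
Lemma mean_kernel (a : C) (r : R) :
  Cmod a < r -> mean (fun z => z / (z - a))%C r = RtoC (2 * PI).
Proof.
  intros Ha. pose proof (Cmod_ge_0 a) as Ha0. pose proof two_PI_pos.
  apply Cmod_small_eq. intros e He.
  (* Chosen so that 4 PI |a| / (q - |a|) < e. *)
  set (q := Rmax r (Cmod a + 1 + 4 * PI * Cmod a / e)).
  assert (Q1 : r <= q) by apply Rmax_l.
  assert (Q2 : Cmod a + 1 + 4 * PI * Cmod a / e <= q) by apply Rmax_r.
  assert (Q3 : 0 <= 4 * PI * Cmod a / e) by (apply Rdiv_le_0_compat; [nra|lra]).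
  rewrite (mean_annulus _ r q).
  2: lra. 2: lra.
  2:{ intros z Hz. assert (z <> a) by (intros ->; lra).
      exists (1 * / (z - a) + z * (- (1) / ((z - a) * (z - a))))%C.
      apply (cderiv_mult (fun z => z) (fun z => / (z - a))%C); [apply cderiv_id|].
      apply (cderiv_inv (fun z => z - a)%C); [|apply Cminus_eq_contra; assumption].
      apply cderiv_eq with (1 - 0)%C; [|ring].
      apply (cderiv_minus (fun z => z) (fun _ => a)); [apply cderiv_id|apply cderiv_const]. }
  assert (E : mean (fun z => z / (z - a))%C q =
    (mean (fun _ => 1) q + mean (fun z => a / (z - a))%C q)%C).
  { unfold mean. rewrite <- CInt_plus.
    - apply CInt_ext; [lra|]. intros t _. field. apply Cminus_eq_contra, circ_neq; lra.
    - apply (Cint_circ' (fun _ => RtoC 1) q); [lra|]. intros t. apply ccont_const.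
    - apply (Cint_circ' (fun z => a / (z - a))%C); [lra|]. intros t.
      apply ccont_div; [apply ccont_const|apply ccont_minus; [apply ccont_id|apply ccont_const]|].
      apply Cminus_eq_contra, circ_neq; lra. }
  rewrite E. unfold mean at 1. rewrite CInt_const.
  replace (RtoC (2 * PI - 0)) with (RtoC (2 * PI)) by (f_equal; ring).
  replace (RtoC (2 * PI) * 1 + mean (fun z => a / (z - a)) q - RtoC (2 * PI))%C
    with (mean (fun z => a / (z - a))%C q) by ring.
  eapply Rle_lt_trans.
  - apply (mean_bound _ q (Cmod a / (q - Cmod a))); [lra| |].
    + intros t. apply ccont_div; [apply ccont_const|apply ccont_minus; [apply ccont_id|apply ccont_const]|].
      apply Cminus_eq_contra, circ_neq; lra.
    + intros t. rewrite Cmod_div by (apply Cminus_eq_contra, circ_neq; lra).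
      apply Rmult_le_compat_l; [lra|]. apply Rinv_le_contravar; [lra|]. apply Cmod_circ_minus; lra.
  - apply Rmult_lt_reg_r with (q - Cmod a); [lra|].
    replace (4 * PI * (Cmod a / (q - Cmod a)) * (q - Cmod a)) with (4 * PI * Cmod a) by (field; lra).
    assert (K : 4 * PI * Cmod a = e * (4 * PI * Cmod a / e)) by (field; lra).
    rewrite K at 1. apply Rmult_lt_compat_l; lra.
Qed.

Lemma ccont_quotient (f : C -> C) (a l : C) :
  cderiv f a l -> ccont (fun z => if Ceq_dec z a then l else ((f z - f a) / (z - a))%C) a.
Proof.
  intros [q [Hq [Hl Hn]]]. apply ccont_ext with q; [|exact Hq].
  eapply cnear_impl; [|exact Hn]. intros w Hw. simpl in *.
  destruct (Ceq_dec w a) as [->|Hne]; [exact Hl|].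
  rewrite Hw. field. apply Cminus_eq_contra. exact Hne.
Qed.

Lemma cnear_neq (z a : C) : z <> a -> cnear z (fun w => w <> a).
Proof.
  intros H. exists (Cmod (z - a)). split; [apply Cmod_gt_0, Cminus_eq_contra; exact H|].
  intros w Hw ->. rewrite Cmod_minus_sym in Hw. lra.
Qed.

(** The function z q(z), with q the difference quotient at [a], is continuous, and differentiable
    off [a]. So [mean_value] applies with the exceptional circle through [a], and the mean is 0
    because the function vanishes at 0. What remains is f(a) times the mean of the kernel. *)
Lemma cauchy_formula (f : C -> C) (rho r : R) (a : C) :
  holo rho f -> Cmod a < r < rho ->
  mean (fun z => f z * (z / (z - a)))%C r = (RtoC (2 * PI) * f a)%C.
Proof.
  intros Hf Hr. pose proof (Cmod_ge_0 a) as Ha.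
  destruct (Hf a) as [l Hl]; [lra|].
  set (q := fun z => if Ceq_dec z a then l else ((f z - f a) / (z - a))%C).
  assert (HD : forall z, Cmod z < rho -> z <> a -> exists l, cderiv (fun z => z * q z)%C z l).
  { intros z Hz Hne. destruct (Hf z Hz) as [m Hm].
    eexists. apply cderiv_ext with (fun z => z * ((f z - f a) * / (z - a)))%C.
    - eapply cnear_impl; [|apply (cnear_neq z a Hne)]. intros w Hw. unfold q.
      destruct (Ceq_dec w a); [congruence|reflexivity].
    - apply (cderiv_mult (fun z => z) (fun z => (f z - f a) * / (z - a))%C); [apply cderiv_id|].
      apply (cderiv_mult (fun z => f z - f a)%C (fun z => / (z - a))%C).
      + apply (cderiv_minus f (fun _ => f a)); [exact Hm|apply cderiv_const].
      + apply (cderiv_inv (fun z => z - a)%C); [|apply Cminus_eq_contra; exact Hne].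
        apply (cderiv_minus (fun z => z) (fun _ => a)); [apply cderiv_id|apply cderiv_const]. }
  assert (M : mean (fun z => z * q z)%C r = (RtoC (2 * PI) * (0 * q 0))%C).
  { apply (mean_value (fun z => z * q z)%C rho (Cmod a)); [|intros z Hz _ Hne; apply HD; congruence|lra].
    intros z Hz. destruct (Ceq_dec z a) as [->|Hne].
    - apply ccont_mult; [apply ccont_id|apply ccont_quotient; exact Hl].
    - destruct (HD z Hz Hne) as [m Hm]. eapply cderiv_ccont, Hm. }
  assert (Hcf : forall t, ccont f (circ r t)).
  { intros t. destruct (Hf (circ r t)) as [m Hm].
    - rewrite Cmod_circ, Rabs_right; lra.
    - eapply cderiv_ccont, Hm. }
  assert (Hck : forall t, ccont (fun z => z / (z - a))%C (circ r t)).
  { intros t. apply ccont_kernel, circ_neq; lra. }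
  assert (E : mean (fun z => f z * (z / (z - a)))%C r =
    (mean (fun z => z * q z)%C r + f a * mean (fun z => z / (z - a))%C r)%C).
  { unfold mean. rewrite <- CInt_scal.
    - rewrite <- CInt_plus.
      + apply CInt_ext; [left; apply two_PI_pos|]. intros t _. unfold q.
        assert (K : circ r t <> a) by (apply circ_neq; lra).
        destruct (Ceq_dec (circ r t) a); [congruence|]. field. apply Cminus_eq_contra. exact K.
      + apply (Cint_circ' (fun z => z * q z)%C); [lra|]. intros t.
        destruct (HD (circ r t)) as [m Hm]; [rewrite Cmod_circ, Rabs_right; lra|apply circ_neq; lra|].
        eapply cderiv_ccont, Hm.
      + apply Cint_scal, (Cint_circ' (fun z => z / (z - a))%C); [lra|exact Hck].
    - apply (Cint_circ' (fun z => z / (z - a))%C); [lra|exact Hck]. }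
  rewrite E, M, mean_kernel by lra. ring.
Qed.

Lemma RtoC_neq_0 (x : R) : x <> 0 -> RtoC x <> 0.
Proof. intros H E. apply H, RtoC_inj. exact E. Qed.

(* Power series with explicit remainders: iterating the recurrence,
   f a = c_0 + c_1 a + ... + c_(n-1) a^(n-1) + a^n T_n(a). *)
Lemma cauchy_expansion (f : C -> C) (rho r m : R) :
  holo rho f -> 0 < r < rho -> (forall z, Cmod z = r -> Cmod (f z) <= m) ->
  exists T : nat -> C -> C,
    (forall a, Cmod a < r -> T O a = f a) /\
    (forall n a, Cmod a < r -> T n a = (T n 0 + a * T (S n) a)%C) /\
    (forall n a, Cmod a < r -> Cmod (T n a) <= 2 * m / r ^ n * (r / (r - Cmod a))).
Proof.
  intros Hf Hr Hm. pose proof two_PI_pos as HPI.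
  assert (HP : RtoC (2 * PI) <> 0) by (apply RtoC_neq_0; lra).
  assert (Hcf : forall t, ccont f (circ r t)).
  { intros t. destruct (Hf (circ r t)) as [l Hl].
    - rewrite Cmod_circ, Rabs_right; lra.
    - eapply cderiv_ccont, Hl. }
  assert (Hz : forall t, circ r t <> 0).
  { intros t. apply circ_neq. rewrite Cmod_0. lra. }
  assert (Hpow : forall n z, ccont (fun z => z ^ n)%C z).
  { intros n z. induction n as [|n IH].
    - apply (ccont_const 1).
    - apply ccont_ext with (fun z => z * z ^ n)%C; [apply cnear_true; intros w; reflexivity|].
      apply ccont_mult; [apply ccont_id|exact IH]. }
  assert (Hc1 : forall n t, ccont (fun z => f z / z ^ n)%C (circ r t)).
  { intros n t. apply ccont_div; [apply Hcf|apply Hpow|apply Cpow_nz, Hz]. }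
  assert (Hc2 : forall n a t, Cmod a < r -> ccont (fun z => f z / z ^ n * (z / (z - a)))%C (circ r t)).
  { intros n a t Ha. apply ccont_mult; [apply Hc1|apply ccont_kernel, circ_neq; exact Ha]. }
  (* T_n is the Cauchy integral of f(z) / z^n. The recurrence is z / (z - a) = 1 + a / (z - a), the
     1 being written z / (z - 0). *)
  exists (fun n a => (mean (fun z => f z / z ^ n * (z / (z - a))) r / RtoC (2 * PI))%C).
  split; [|split].
  - intros a Ha.
    replace (mean (fun z => f z / z ^ 0 * (z / (z - a)))%C r)
      with (mean (fun z => f z * (z / (z - a)))%C r).
    + rewrite (cauchy_formula f rho r a Hf ltac:(lra)). field. exact HP.
    + apply CInt_ext; [lra|]. intros t _. simpl. field. apply Cminus_eq_contra, circ_neq; exact Ha.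
  - intros n a Ha.
    assert (E : mean (fun z => f z / z ^ n * (z / (z - a)))%C r =
      (mean (fun z => f z / z ^ n * (z / (z - 0)))%C r +
       a * mean (fun z => f z / z ^ S n * (z / (z - a)))%C r)%C).
    { unfold mean. rewrite <- CInt_scal.
      - rewrite <- CInt_plus.
        + apply CInt_ext; [lra|]. intros t _. rewrite Cpow_S. field.
          repeat split; try apply Cpow_nz; try apply Hz.
          apply Cminus_eq_contra, circ_neq; exact Ha.
        + apply (Cint_circ' (fun z => f z / z ^ n * (z / (z - 0)))%C); [lra|]. intros t.
          apply Hc2. rewrite Cmod_0. lra.
        + apply Cint_scal, (Cint_circ' (fun z => f z / z ^ S n * (z / (z - a)))%C); [lra|].
          intros t. apply Hc2. exact Ha.
      - apply (Cint_circ' (fun z => f z / z ^ S n * (z / (z - a)))%C); [lra|].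
        intros t. apply Hc2. exact Ha. }
    rewrite E. field. exact HP.
  - intros n a Ha. rewrite Cmod_div by exact HP. rewrite Cmod_R, Rabs_right by lra.
    apply Rmult_le_reg_r with (2 * PI); [exact HPI|].
    unfold Rdiv at 1. rewrite Rmult_assoc, Rinv_l, Rmult_1_r by lra.
    replace (2 * m / r ^ n * (r / (r - Cmod a)) * (2 * PI))
      with (4 * PI * (m / r ^ n * (r / (r - Cmod a)))) by (field; split; [lra|apply pow_nonzero; lra]).
    apply mean_bound; [lra|intros t; apply Hc2; exact Ha|].
    intros t. pose proof (Cmod_ge_0 a).
    assert (Hr' : Cmod (circ r t) = r) by (rewrite Cmod_circ, Rabs_right; lra).
    rewrite Cmod_mult, !Cmod_div, Cmod_pow, Hr'; try (apply Cpow_nz, Hz).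
    2:{ apply Cminus_eq_contra, circ_neq; exact Ha. }
    apply Rmult_le_compat.
    + apply Rdiv_le_0_compat; [apply Cmod_ge_0|apply pow_lt; lra].
    + apply Rdiv_le_0_compat; [lra|]. pose proof (Cmod_circ_minus r t a Ha). lra.
    + apply Rmult_le_compat_r; [left; apply Rinv_0_lt_compat, pow_lt; lra|]. apply Hm. exact Hr'.
    + apply Rmult_le_compat_l; [lra|]. apply Rinv_le_contravar; [lra|]. apply Cmod_circ_minus. exact Ha.
Qed.

(** * Taylor estimates, the mean value inequality and isolated zeros *)

Lemma cderiv_unique (f : C -> C) (z l m : C) : cderiv f z l -> cderiv f z m -> l = m.
Proof.
  intros H1 H2.
  apply is_derive_cderiv in H1. apply is_derive_cderiv in H2.
  rewrite <- (is_C_derive_unique _ _ _ H1). apply is_C_derive_unique. exact H2.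
Qed.

(** A quadratic remainder with a fixed constant, unlike an o-term, passes to limits of sequences;
    [weierstrass] relies on this. *)
Lemma cderiv_quadratic (f : C -> C) (z l : C) (K : R) :
  cnear z (fun w => Cmod (f w - f z - l * (w - z)) <= K * (Cmod (w - z) * Cmod (w - z))) ->
  cderiv f z l.
Proof.
  intros H. apply cderiv_eps. intros e He.
  assert (HK : 0 < e / (Rabs K + 1)) by (apply Rdiv_lt_0_compat; [lra|pose proof (Rabs_pos K); lra]).
  eapply cnear_impl; [|apply cnear_and; [exact H|exists (e / (Rabs K + 1)); split; [exact HK|intros w Hw; exact Hw]]].
  intros w [H1 H2]. simpl in *. eapply Rle_trans; [exact H1|].
  pose proof (Cmod_ge_0 (w - z)). pose proof (Rabs_pos K). pose proof (Rle_abs K).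
  assert (E : e = e / (Rabs K + 1) * (Rabs K + 1)) by (field; lra).
  rewrite <- Rmult_assoc. apply Rmult_le_compat_r; [assumption|]. rewrite E. nra.
Qed.

Lemma holo_translate (f : C -> C) (z0 : C) (rho : R) :
  (forall z, Cmod (z - z0) < rho -> exists l, cderiv f z l) -> holo rho (fun w => f (z0 + w)%C).
Proof.
  intros H w Hw. destruct (H (z0 + w)%C) as [l Hl].
  - replace (z0 + w - z0)%C with w by ring. exact Hw.
  - exists (l * (0 + 1))%C. apply cderiv_comp; [|exact Hl].
    apply (cderiv_plus (fun _ => z0) (fun w => w)); [apply cderiv_const|apply cderiv_id].
Qed.

Lemma cderiv_translate (f : C -> C) (z0 w l : C) :
  cderiv (fun w => f (z0 + w)%C) w l -> cderiv f (z0 + w) l.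
Proof.
  intros H. apply cderiv_ext with (fun v => f (z0 + (v - z0)))%C.
  - apply cnear_true. intros v. f_equal. ring.
  - replace l with (l * (1 - 0))%C by ring.
    apply (cderiv_comp (fun w => f (z0 + w)%C) (fun v => v - z0)%C).
    + apply (cderiv_minus (fun v => v) (fun _ => z0)); [apply cderiv_id|apply cderiv_const].
    + replace (z0 + w - z0)%C with w by ring. exact H.
Qed.

(** T_1(0) is the derivative and a^2 T_2(a) the remainder; for |a| <= r / 2 the factor r / (r - |a|)
    is at most 2. *)
Lemma taylor_first_order_0 (f : C -> C) (rho r m : R) :
  holo rho f -> 0 < r < rho -> (forall z, Cmod z = r -> Cmod (f z) <= m) ->
  exists l, cderiv f 0 l /\ Cmod l <= 2 * m / r /\
    forall a, Cmod a <= r / 2 -> Cmod (f a - f 0 - l * a) <= 4 * m / r ^ 2 * (Cmod a * Cmod a).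
Proof.
  intros Hf Hr Hm. destruct (cauchy_expansion f rho r m Hf Hr Hm) as [T [T0 [TS TB]]].
  assert (Z0 : Cmod 0 < r) by (rewrite Cmod_0; lra).
  assert (Hm0 : 0 <= m).
  { assert (Hc : Cmod (RtoC r) = r) by (rewrite Cmod_R, Rabs_right; lra).
    pose proof (Hm (RtoC r) Hc). pose proof (Cmod_ge_0 (f (RtoC r))). lra. }
  assert (B : forall a, Cmod a <= r / 2 ->
    Cmod (f a - f 0 - T 1%nat 0 * a) <= 4 * m / r ^ 2 * (Cmod a * Cmod a)).
  { intros a Ha. pose proof (Cmod_ge_0 a).
    assert (Ha' : Cmod a < r) by lra.
    assert (E : (f a - f 0 - T 1%nat 0 * a)%C = (a * a * T 2%nat a)%C).
    { rewrite <- (T0 a Ha'), <- (T0 0 Z0). rewrite (TS O a Ha'), (TS 1%nat a Ha'). ring. }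
    rewrite E, !Cmod_mult. rewrite (Rmult_comm (4 * m / r ^ 2)).
    apply Rmult_le_compat_l; [nra|]. eapply Rle_trans; [apply TB; exact Ha'|].
    replace (4 * m / r ^ 2) with (2 * m / r ^ 2 * 2) by (field; lra).
    apply Rmult_le_compat_l; [apply Rdiv_le_0_compat; [lra|apply pow_lt; lra]|].
    apply Rmult_le_reg_r with (r - Cmod a); [lra|].
    unfold Rdiv. rewrite Rmult_assoc, Rinv_l by lra. lra. }
  exists (T 1%nat 0). split; [|split; [|exact B]].
  - apply cderiv_quadratic with (4 * m / r ^ 2). exists (r / 2). split; [lra|].
    intros w Hw. rewrite (Cminus_0_r w) in *. apply B. lra.
  - eapply Rle_trans; [apply TB; exact Z0|]. rewrite Cmod_0.
    right. field. lra.
Qed.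

Lemma taylor_first_order (f : C -> C) (z0 : C) (rho r m : R) :
  (forall z, Cmod (z - z0) < rho -> exists l, cderiv f z l) -> 0 < r < rho ->
  (forall z, Cmod (z - z0) = r -> Cmod (f z) <= m) ->
  exists l, cderiv f z0 l /\ Cmod l <= 2 * m / r /\
    forall z, Cmod (z - z0) <= r / 2 ->
      Cmod (f z - f z0 - l * (z - z0)) <= 4 * m / r ^ 2 * (Cmod (z - z0) * Cmod (z - z0)).
Proof.
  intros Hf Hr Hm.
  destruct (taylor_first_order_0 (fun w => f (z0 + w)%C) rho r m) as [l [H1 [H2 H3]]].
  - apply holo_translate. exact Hf.
  - exact Hr.
  - intros z Hz. apply Hm. replace (z0 + z - z0)%C with z by ring. exact Hz.
  - assert (E0 : (z0 + 0)%C = z0) by ring.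
    exists l. split; [|split; [exact H2|]].
    + apply cderiv_translate in H1. rewrite E0 in H1. exact H1.
    + intros z Hz. specialize (H3 (z - z0)%C Hz). rewrite E0 in H3.
      replace (z0 + (z - z0))%C with z in H3 by ring. exact H3.
Qed.

(** A maximum principle up to a factor 2, which Hurwitz' argument tolerates. *)
Lemma mean_value_disk (f : C -> C) (z0 : C) (rho r m : R) :
  (forall z, Cmod (z - z0) < rho -> exists l, cderiv f z l) -> 0 < r < rho ->
  (forall z, Cmod (z - z0) = r -> Cmod (f z) <= m) -> Cmod (f z0) <= 2 * m.
Proof.
  intros Hf Hr Hm.
  destruct (cauchy_expansion (fun w => f (z0 + w)%C) rho r m) as [T [T0 [_ TB]]].
  - apply holo_translate. exact Hf.
  - exact Hr.
  - intros z Hz. apply Hm. replace (z0 + z - z0)%C with z by ring. exact Hz.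
  - assert (Z0 : Cmod 0 < r) by (rewrite Cmod_0; lra).
    specialize (TB O 0 Z0). rewrite (T0 0 Z0) in TB.
    replace (z0 + 0)%C with z0 in TB by ring. rewrite Cmod_0 in TB.
    replace (2 * m / r ^ 0 * (r / (r - 0))) with (2 * m) in TB by (simpl; field; lra). exact TB.
Qed.

(** If all coefficients vanish, then f(z) = z^n T_n(z) for every n, where T_n(z) is of order r^(-n),
    so f(z) = 0. Otherwise the first nonzero coefficient dominates on small circles. *)
Lemma isolated_zeros_0 (f : C -> C) (rho r m : R) :
  holo rho f -> 0 < r < rho -> (forall z, Cmod z = r -> Cmod (f z) <= m) ->
  (forall z, Cmod z < r -> f z = 0) \/
  (forall d, 0 < d -> exists s e, 0 < s < d /\ 0 < e /\ forall z, Cmod z = s -> e <= Cmod (f z)).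
Proof.
  intros Hf Hr Hm. destruct (cauchy_expansion f rho r m Hf Hr Hm) as [T [T0 [TS TB]]].
  assert (Hm0 : 0 <= m).
  { assert (Hc : Cmod (RtoC r) = r) by (rewrite Cmod_R, Rabs_right; lra).
    pose proof (Hm (RtoC r) Hc). pose proof (Cmod_ge_0 (f (RtoC r))). lra. }
  assert (F : forall n, (forall k, (k < n)%nat -> T k 0 = 0) ->
    forall a, Cmod a < r -> f a = (a ^ n * T n a)%C).
  { induction n as [|n IH]; intros H0 a Ha.
    - rewrite (T0 a Ha). simpl. ring.
    - rewrite (IH ltac:(intros k Hk; apply H0; lia) a Ha), (TS n a Ha), (H0 n) by lia.
      rewrite Cpow_S. ring. }
  destruct (classic (exists n, T n 0 <> 0)) as [[n Hn]|Hall].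
  - right.
    assert (Hmin : exists n, T n 0 <> 0 /\ forall k, (k < n)%nat -> T k 0 = 0).
    { revert Hn. induction n as [n IH] using (well_founded_induction Wf_nat.lt_wf). intros Hn.
      destruct (classic (exists k, (k < n)%nat /\ T k 0 <> 0)) as [[k [Hk Hk']]|Hno].
      - exact (IH k Hk Hk').
      - exists n. split; [exact Hn|]. intros k Hk. apply NNPP. intros Hne. apply Hno. eauto. }
    clear n Hn. destruct Hmin as [n [Hn H0]].
    intros d Hd. apply Cmod_gt_0 in Hn. set (c := Cmod (T n 0)) in *.
    set (B := 2 * m / r ^ S n * 2).
    assert (HB : 0 <= B) by (apply Rmult_le_pos; [apply Rdiv_le_0_compat; [lra|apply pow_lt; lra]|lra]).
    (* So small that the tail s |T_(n+1)| stays below c / 2. *)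
    set (s := Rmin (d / 2) (Rmin (r / 2) (c / (2 * (B + 1))))).
    assert (S1 : s <= d / 2) by apply Rmin_l.
    assert (S2 : s <= r / 2) by (eapply Rle_trans; [apply Rmin_r|apply Rmin_l]).
    assert (S3 : s <= c / (2 * (B + 1))) by (eapply Rle_trans; [apply Rmin_r|apply Rmin_r]).
    assert (S0 : 0 < s) by (repeat apply Rmin_glb_lt; try lra; apply Rdiv_lt_0_compat; lra).
    exists s, (s ^ n * (c / 2)). split; [lra|split].
    + apply Rmult_lt_0_compat; [apply pow_lt; exact S0|lra].
    + intros z Hz. rewrite (F n H0 z) by lra. rewrite Cmod_mult, Cmod_pow, Hz.
      apply Rmult_le_compat_l; [apply pow_le; lra|].
      rewrite (TS n z) by lra.
      pose proof (TB (S n) z ltac:(lra)) as TBz.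
      assert (Q : r / (r - Cmod z) <= 2).
      { apply Rmult_le_reg_r with (r - Cmod z); [lra|].
        unfold Rdiv. rewrite Rmult_assoc, Rinv_l by lra. lra. }
      assert (TBB : Cmod (T (S n) z) <= B).
      { eapply Rle_trans; [exact TBz|]. apply Rmult_le_compat_l; [|exact Q].
        apply Rdiv_le_0_compat; [lra|apply pow_lt; lra]. }
      pose proof (Cmod_triangle_inv (T n 0) (- (z * T (S n) z))) as K.
      replace (T n 0 - - (z * T (S n) z))%C with (T n 0 + z * T (S n) z)%C in K by ring.
      rewrite Cmod_opp, Cmod_mult, Hz in K. fold c in K.
      assert (s * Cmod (T (S n) z) <= s * B) by (apply Rmult_le_compat_l; lra).
      assert (s * (B + 1) <= c / (2 * (B + 1)) * (B + 1)) by (apply Rmult_le_compat_r; lra).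
      replace (c / (2 * (B + 1)) * (B + 1)) with (c / 2) in * by (field; lra).
      lra.
  - left. intros z Hz.
    assert (H0 : forall n, T n 0 = 0) by (intros n; apply NNPP; intros Hne; apply Hall; eauto).
    apply Cmod_eq_0. pose proof (Cmod_ge_0 z). pose proof (Cmod_ge_0 (f z)).
    destruct (Req_dec (Cmod (f z)) 0) as [|Hne]; [assumption|exfalso].
    set (K := 2 * m * (r / (r - Cmod z))).
    assert (HK : 0 <= K) by (apply Rmult_le_pos; [lra|]; apply Rdiv_le_0_compat; lra).
    assert (Hb : forall n, Cmod (f z) <= (Cmod z / r) ^ n * K).
    { intros n. rewrite (F n ltac:(intros; apply H0) z Hz), Cmod_mult, Cmod_pow.
      unfold Rdiv at 1. rewrite Rpow_mult_distr, pow_inv, Rmult_assoc.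
      apply Rmult_le_compat_l; [apply pow_le; lra|].
      eapply Rle_trans; [apply (TB n z Hz)|]. right. unfold K. field.
      repeat split; first [lra|apply pow_nonzero; lra]. }
    assert (Hq : Rabs (Cmod z / r) < 1).
    { rewrite Rabs_right by (apply Rle_ge, Rdiv_le_0_compat; lra).
      apply Rmult_lt_reg_r with r; [lra|]. unfold Rdiv. rewrite Rmult_assoc, Rinv_l; lra. }
    destruct (pow_lt_1_zero _ Hq (Cmod (f z) / (K + 1))) as [N HN].
    { apply Rdiv_lt_0_compat; lra. }
    specialize (HN N (le_n N)). specialize (Hb N).
    assert (Hp : (Cmod z / r) ^ N < Cmod (f z) / (K + 1)) by (eapply Rle_lt_trans; [apply Rle_abs|exact HN]).
    assert (Hp0 : 0 <= (Cmod z / r) ^ N) by (apply pow_le, Rdiv_le_0_compat; lra).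
    assert ((Cmod z / r) ^ N * (K + 1) < Cmod (f z) / (K + 1) * (K + 1)) by (apply Rmult_lt_compat_r; lra).
    replace (Cmod (f z) / (K + 1) * (K + 1)) with (Cmod (f z)) in * by (field; lra).
    nra.
Qed.

Lemma isolated_zeros (f : C -> C) (z0 : C) (rho r m : R) :
  (forall z, Cmod (z - z0) < rho -> exists l, cderiv f z l) -> 0 < r < rho ->
  (forall z, Cmod (z - z0) = r -> Cmod (f z) <= m) ->
  (forall z, Cmod (z - z0) < r -> f z = 0) \/
  (forall d, 0 < d -> exists s e, 0 < s < d /\ 0 < e /\
     forall z, Cmod (z - z0) = s -> e <= Cmod (f z)).
Proof.
  intros Hf Hr Hm.
  destruct (isolated_zeros_0 (fun w => f (z0 + w)%C) rho r m) as [H|H].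
  - apply holo_translate. exact Hf.
  - exact Hr.
  - intros z Hz. apply Hm. replace (z0 + z - z0)%C with z by ring. exact Hz.
  - left. intros z Hz. specialize (H (z - z0)%C Hz).
    replace (z0 + (z - z0))%C with z in H by ring. exact H.
  - right. intros d Hd. destruct (H d Hd) as [s [e [Hs [He K]]]].
    exists s, e. split; [exact Hs|split; [exact He|]]. intros z Hz.
    specialize (K (z - z0)%C Hz). replace (z0 + (z - z0))%C with z in K by ring. exact K.
Qed.

(** * Moebius maps and radial estimates *)

Definition moebius (a z : C) : C := ((z + a) / (1 + Cconj a * z))%C.

(* [sinhd z w] is the hyperbolic sine of the hyperbolic distance of [z] and [w]. *)
Definition sinhd (z w : C) : R :=
  Cmod (z - w) / (sqrt (1 - Cmod z ^ 2) * sqrt (1 - Cmod w ^ 2)).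

Lemma disk_sqr (z : C) : Cmod z < 1 -> 0 < 1 - Cmod z ^ 2.
Proof. intros H. pose proof (Cmod_ge_0 z). nra. Qed.

Lemma moebius_den (a z : C) : Cmod a < 1 -> Cmod z < 1 -> (1 + Cconj a * z)%C <> 0.
Proof.
  intros Ha Hz. apply Cmod_gt_0.
  pose proof (Cmod_triangle_inv 1 (- (Cconj a * z))) as K.
  replace (1 - - (Cconj a * z))%C with (1 + Cconj a * z)%C in K by ring.
  rewrite Cmod_opp, Cmod_mult, Cmod_conj, Cmod_1 in K.
  pose proof (Cmod_ge_0 a). pose proof (Cmod_ge_0 z). nra.
Qed.

Lemma moebius_identity (a z : C) : Cmod a < 1 -> Cmod z < 1 ->
  1 - Cmod (moebius a z) ^ 2 =
    (1 - Cmod a ^ 2) * (1 - Cmod z ^ 2) / Cmod (1 + Cconj a * z) ^ 2.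
Proof.
  intros Ha Hz. pose proof (moebius_den a z Ha Hz) as D. unfold moebius.
  rewrite Cmod_div by exact D. apply Cmod_gt_0 in D.
  assert (E : Cmod (1 + Cconj a * z) ^ 2 - Cmod (z + a) ^ 2 = (1 - Cmod a ^ 2) * (1 - Cmod z ^ 2)).
  { rewrite !Cmod_sqr. destruct a, z; simpl. ring. }
  rewrite <- E. field. lra.
Qed.

Lemma moebius_disk (a z : C) : Cmod a < 1 -> Cmod z < 1 -> Cmod (moebius a z) < 1.
Proof.
  intros Ha Hz. pose proof (moebius_identity a z Ha Hz) as E.
  pose proof (proj1 (Cmod_gt_0 _) (moebius_den a z Ha Hz)) as D.
  assert (0 < 1 - Cmod (moebius a z) ^ 2).
  { rewrite E. apply Rdiv_lt_0_compat; [|apply pow_lt; exact D].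
    apply Rmult_lt_0_compat; apply disk_sqr; assumption. }
  pose proof (Cmod_ge_0 (moebius a z)). nra.
Qed.

Lemma moebius_0 (a : C) : moebius a 0 = a.
Proof. unfold moebius. field. Qed.

Lemma one_minus_conj_neq_0 (a : C) : Cmod a < 1 -> (1 - Cconj a * a)%C <> 0.
Proof.
  intros Ha E. apply (moebius_den (- a) a); [rewrite Cmod_opp; exact Ha|exact Ha|].
  rewrite <- E. rewrite Copp_conj. ring.
Qed.

Lemma moebius_opp_l (a z : C) : Cmod a < 1 -> Cmod z < 1 -> moebius (- a) (moebius a z) = z.
Proof.
  intros Ha Hz. unfold moebius. pose proof (moebius_den a z Ha Hz) as D.
  pose proof (one_minus_conj_neq_0 a Ha) as D2. rewrite Copp_conj.
  field. split; [exact D|].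
  intros E. apply D2. rewrite <- E. ring.
Qed.

Lemma moebius_opp_r (a z : C) : Cmod a < 1 -> Cmod z < 1 -> moebius a (moebius (- a) z) = z.
Proof.
  intros Ha Hz. replace a with (- - a)%C at 1 by ring.
  apply moebius_opp_l; [rewrite Cmod_opp; exact Ha|exact Hz].
Qed.

Definition moebius_deriv (a z : C) : C :=
  ((1 - Cconj a * a) / ((1 + Cconj a * z) * (1 + Cconj a * z)))%C.

Lemma cderiv_moebius (a z : C) : Cmod a < 1 -> Cmod z < 1 ->
  cderiv (moebius a) z (moebius_deriv a z).
Proof.
  intros Ha Hz. pose proof (moebius_den a z Ha Hz) as D. unfold moebius, moebius_deriv.
  eapply cderiv_eq.
  - apply (cderiv_mult (fun z => z + a)%C (fun z => / (1 + Cconj a * z))%C).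
    + apply (cderiv_plus (fun z => z) (fun _ => a)); [apply cderiv_id|apply cderiv_const].
    + apply (cderiv_inv (fun z => 1 + Cconj a * z)%C); [|exact D].
      apply (cderiv_plus (fun _ => RtoC 1) (fun z => Cconj a * z)%C); [apply cderiv_const|].
      apply (cderiv_mult (fun _ => Cconj a) (fun z => z)); [apply cderiv_const|apply cderiv_id].
  - field. exact D.
Qed.

Lemma Cmod_one_minus_conj (a : C) : Cmod a < 1 -> Cmod (1 - Cconj a * a) = 1 - Cmod a ^ 2.
Proof.
  intros Ha. replace (1 - Cconj a * a)%C with (RtoC (1 - Cmod a ^ 2)).
  - rewrite Cmod_R, Rabs_right; [reflexivity|]. pose proof (disk_sqr a Ha). lra.
  - rewrite Cmod_sqr. destruct a. apply injective_projections; simpl; ring.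
Qed.

(** Equality in the Schwarz-Pick inequality: Moebius maps preserve the hyperbolic metric |dz| / (1 -
    |z|^2). *)
Lemma moebius_deriv_mod (a z : C) : Cmod a < 1 -> Cmod z < 1 ->
  (1 - Cmod z ^ 2) * Cmod (moebius_deriv a z) = 1 - Cmod (moebius a z) ^ 2.
Proof.
  intros Ha Hz. pose proof (moebius_den a z Ha Hz) as D.
  rewrite moebius_identity by assumption. unfold moebius_deriv.
  rewrite Cmod_div, Cmod_mult, Cmod_one_minus_conj by (try apply Cmult_neq_0; assumption).
  apply Cmod_gt_0 in D. field. lra.
Qed.

(** Moving [w] to 0 gives [sinhd] the shape of the bound in [radial_bound]. *)
Lemma sinhd_moebius (z w : C) : Cmod z < 1 -> Cmod w < 1 ->
  sinhd z w = Cmod (moebius (- w) z) / sqrt (1 - Cmod (moebius (- w) z) ^ 2).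
Proof.
  intros Hz Hw. assert (Hw' : Cmod (- w) < 1) by (rewrite Cmod_opp; exact Hw).
  rewrite moebius_identity by assumption. rewrite Cmod_opp.
  pose proof (moebius_den (- w) z Hw' Hz) as D. unfold moebius at 1.
  rewrite Cmod_div by exact D. apply Cmod_gt_0 in D. set (m := Cmod (1 + Cconj (- w) * z)) in *.
  pose proof (disk_sqr z Hz). pose proof (disk_sqr w Hw).
  rewrite sqrt_div_alt by (apply pow_lt; exact D). rewrite sqrt_pow2 by lra.
  rewrite sqrt_mult by lra.
  pose proof (sqrt_lt_R0 _ H). pose proof (sqrt_lt_R0 _ H0).
  unfold sinhd. replace (z - w)%C with (z + - w)%C by ring. field. repeat split; lra.
Qed.

Lemma disk_automorphism_moebius (a : C) : Cmod a < 1 -> disk_automorphism (moebius a).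
Proof.
  intros Ha. unfold disk_automorphism, analytic_on, unit_disk. repeat split.
  - intros z Hz. exists (moebius_deriv a z). apply is_derive_cderiv, cderiv_moebius; assumption.
  - intros z Hz. apply moebius_disk; assumption.
  - intros z w Hz Hw E. rewrite <- (moebius_opp_l a z), <- (moebius_opp_l a w) by assumption.
    rewrite E. reflexivity.
  - intros w Hw. exists (moebius (- a) w). split.
    + apply moebius_disk; [rewrite Cmod_opp|]; assumption.
    + apply moebius_opp_r; assumption.
Qed.

Lemma is_derive_ray (f : C -> C) (b l : C) (t : R) :
  cderiv f (RtoC t * b)%C l ->
  is_derive (fun s => fst (f (RtoC s * b)%C)) t (fst (l * b)%C) /\
  is_derive (fun s => snd (f (RtoC s * b)%C)) t (snd (l * b)%C).
Proof.
  intros H.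
  assert (K : forall e, 0 < e -> exists d : posreal, forall h, h <> 0 -> Rabs h < d ->
    Cmod ((f (RtoC (t + h) * b)%C - f (RtoC t * b)%C) / RtoC h - l * b) < e).
  { intros e He. pose proof (Cmod_ge_0 b) as Hb.
    (* [Cmod b + 1] in place of [Cmod b] covers [b = 0]. *)
    assert (He' : 0 < e / (2 * (Cmod b + 1))) by (apply Rdiv_lt_0_compat; lra).
    destruct (proj1 (cderiv_eps _ _ _) H _ He') as [d [Hd Hn]].
    assert (Hd' : 0 < d / (Cmod b + 1)) by (apply Rdiv_lt_0_compat; lra).
    exists (mkposreal _ Hd'). simpl. intros h Hh Hhd.
    assert (E : (RtoC (t + h) * b - RtoC t * b)%C = (RtoC h * b)%C) by (rewrite RtoC_plus; ring).
    pose proof (Rabs_pos_lt h Hh) as Hp.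
    assert (Hh' : RtoC h <> 0) by (apply RtoC_neq_0; exact Hh).
    assert (L : Rabs h * (Cmod b + 1) < d).
    { apply Rmult_lt_compat_r with (r := Cmod b + 1) in Hhd; [|lra].
      replace (d / (Cmod b + 1) * (Cmod b + 1)) with d in Hhd by (field; lra). exact Hhd. }
    specialize (Hn (RtoC (t + h) * b)%C). rewrite E in Hn.
    rewrite Cmod_mult, Cmod_R in Hn. specialize (Hn ltac:(nra)).
    replace ((f (RtoC (t + h) * b)%C - f (RtoC t * b)%C) / RtoC h - l * b)%C
      with ((f (RtoC (t + h) * b)%C - f (RtoC t * b)%C - l * (RtoC h * b)) / RtoC h)%C by (field; exact Hh').
    rewrite Cmod_div, Cmod_R by exact Hh'.
    apply Rmult_lt_reg_r with (Rabs h); [exact Hp|].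
    unfold Rdiv at 1. rewrite Rmult_assoc, Rinv_l, Rmult_1_r by lra.
    eapply Rle_lt_trans; [exact Hn|].
    replace (e / (2 * (Cmod b + 1)) * (Rabs h * Cmod b))
      with ((e * Rabs h) * (Cmod b / (2 * (Cmod b + 1)))) by (field; lra).
    assert (Cmod b / (2 * (Cmod b + 1)) < 1).
    { apply Rmult_lt_reg_r with (2 * (Cmod b + 1)); [lra|].
      unfold Rdiv. rewrite Rmult_assoc, Rinv_l by lra. lra. }
    rewrite <- (Rmult_1_r (e * Rabs h)) at 2. apply Rmult_lt_compat_l; [apply Rmult_lt_0_compat; lra|assumption]. }
  assert (Ef : forall (A B L : C) h, h <> 0 ->
    (fst A - fst B) / h - fst L = fst ((A - B) / RtoC h - L)%C).
  { intros [u v] [u' v'] [x y] h Hh. simpl. field. exact Hh. }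
  assert (Es : forall (A B L : C) h, h <> 0 ->
    (snd A - snd B) / h - snd L = snd ((A - B) / RtoC h - L)%C).
  { intros [u v] [u' v'] [x y] h Hh. simpl. field. exact Hh. }
  split; apply is_derive_Reals; intros e He; destruct (K e He) as [d Hd]; exists d; intros h Hh Hhd;
    specialize (Hd h Hh Hhd); (eapply Rle_lt_trans; [|exact Hd]).
  - rewrite Ef by exact Hh. apply fst_le_Cmod.
  - rewrite Es by exact Hh. apply snd_le_Cmod.
Qed.

(* The hyperbolic length [artanh s] of a radius is at most [s / sqrt (1 - s^2)]. *)
Lemma radial_bound (u du : R -> R) (K s : R) :
  0 <= K -> 0 <= s < 1 ->
  (forall t, 0 <= t <= 1 -> is_derive u t (du t)) ->
  (forall t, 0 <= t <= 1 -> (1 - (t * s) ^ 2) * Rabs (du t) <= K * s) ->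
  Rabs (u 1 - u 0) <= K * (s / sqrt (1 - s ^ 2)).
Proof.
  intros HK Hs Hd Hb.
  (* The comparison function: its derivative K s / (1 - (t s)^2)^(3/2) dominates the bound K s / (1
     - (t s)^2) on |du|. *)
  set (v := fun t => K * (t * s / sqrt (1 - (t * s) ^ 2))).
  set (dv := fun t => K * s / ((1 - (t * s) ^ 2) * sqrt (1 - (t * s) ^ 2))).
  assert (P : forall t, 0 <= t <= 1 -> 0 < 1 - (t * s) ^ 2 <= 1).
  { intros t Ht. assert (0 <= t * s <= s) by nra. nra. }
  assert (D : forall t, 0 <= t <= 1 -> is_derive v t (dv t)).
  { intros t Ht. specialize (P t Ht). unfold v, dv.
    pose proof (sqrt_lt_R0 _ (proj1 P)) as Q.
    evar_last.
    - apply (is_derive_scal (fun t => t * s / sqrt (1 - (t * s) ^ 2)) t K).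
      auto_derive; [|reflexivity].
      replace (1 + - (t * s * (t * s * 1))) with (1 - (t * s) ^ 2) by ring.
      repeat split; lra.
    - unfold scal; simpl; unfold mult; simpl.
      replace (1 + - (t * s * (t * s * 1))) with (1 - (t * s) ^ 2) by ring.
      assert (E : sqrt (1 - (t * s) ^ 2) ^ 2 = 1 - (t * s) ^ 2) by (apply pow2_sqrt; lra).
      set (q := sqrt (1 - (t * s) ^ 2)) in *.
      change (sqrt (1 - t * s * (t * s * 1))) with q.
      replace (1 - t * s * (t * s * 1)) with (q ^ 2) by (rewrite E; ring).
      transitivity (K * s * (q ^ 2 + (t * s) ^ 2) / q ^ 3); [field; lra|].
      replace (q ^ 2 + (t * s) ^ 2) with 1 by (rewrite E; ring). field. lra. }
  (* v - sg * u is nondecreasing from 0 to 1 for both signs, which yields the absolute value. *)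
  assert (C : forall sg, (sg = 1 \/ sg = -1) -> sg * (u 1 - u 0) <= v 1 - v 0).
  { intros sg Hsg.
    destruct (MVT_gen (fun t => v t - sg * u t) 0 1 (fun t => dv t - sg * du t)) as [c [Hc E]].
    - intros x Hx. rewrite Rmin_left, Rmax_right in Hx by lra.
      apply (is_derive_minus (fun t => v t) (fun t => sg * u t)); [apply D; lra|].
      apply (is_derive_scal u x sg). apply Hd. lra.
    - intros x Hx. rewrite Rmin_left, Rmax_right in Hx by lra.
      apply derivable_continuous_pt. exists (dv x - sg * du x). apply is_derive_Reals.
      apply (is_derive_minus (fun t => v t) (fun t => sg * u t)); [apply D; lra|].
      apply (is_derive_scal u x sg). apply Hd. lra.
    - rewrite Rmin_left, Rmax_right in Hc by lra.
      specialize (P c Hc). specialize (Hb c Hc).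
      assert (G : sg * du c <= dv c).
      { apply Rle_trans with (Rabs (du c)).
        - destruct Hsg as [-> | ->]; pose proof (Rle_abs (du c)); pose proof (Rle_abs (- du c));
            rewrite ?Rabs_Ropp in *; lra.
        - pose proof (sqrt_lt_R0 _ (proj1 P)) as Q.
          assert (Q1 : sqrt (1 - (c * s) ^ 2) <= 1) by (apply Rle_trans with (sqrt 1); [apply sqrt_le_1; lra|rewrite sqrt_1; lra]).
          unfold dv. pose proof (Rabs_pos (du c)) as Hdu. assert (HKs : 0 <= K * s) by nra.
          set (q := sqrt (1 - (c * s) ^ 2)) in *. set (X := 1 - (c * s) ^ 2) in *.
          assert (HXq : 0 < X * q) by (apply Rmult_lt_0_compat; lra).
          apply Rmult_le_reg_r with (X * q); [exact HXq|].
          unfold Rdiv. rewrite (Rmult_assoc (K * s)), Rinv_l, Rmult_1_r by lra.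
          replace (Rabs (du c) * (X * q)) with ((X * Rabs (du c)) * q) by ring.
          assert (0 <= X * Rabs (du c)) by (apply Rmult_le_pos; lra). nra. }
      nra. }
  assert (V : v 1 - v 0 = K * (s / sqrt (1 - s ^ 2))).
  { unfold v. rewrite Rmult_1_l, Rmult_0_l. unfold Rdiv. rewrite !Rmult_0_l, Rmult_0_r. ring. }
  rewrite V in C. apply Rabs_le.
  pose proof (C 1 (or_introl eq_refl)). pose proof (C (-1) (or_intror eq_refl)). lra.
Qed.

(** * Lipschitz estimates for the hyperbolic distance *)

(** [Phi] changes along a curve at most at its speed in the metric with density [W]. This lets one
    integration serve the Euclidean metric ([W] = 1) and the spherical one. *)
Definition conformal_bound (Phi W : C -> R) : Prop :=
  forall (x y : R -> R) (t dx dy : R), is_derive x t dx -> is_derive y t dy ->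
    exists d, is_derive (fun s => Phi (x s, y s)) t d /\ Rabs d <= W (x t, y t) * Cmod (dx, dy).

(** Precomposition with [moebius w] preserves the bound [K] and puts [w] at the center, so that
    [radial_bound] applies on the radius towards the image [b] of [z]. *)
Lemma hyperbolic_lipschitz (Phi W : C -> R) (g : C -> C) (K : R) :
  conformal_bound Phi W -> (forall p, 0 <= W p) -> holo 1 g ->
  (forall z l, Cmod z < 1 -> cderiv g z l -> (1 - Cmod z ^ 2) * (W (g z) * Cmod l) <= K) ->
  forall z w, Cmod z < 1 -> Cmod w < 1 -> Rabs (Phi (g z) - Phi (g w)) <= K * sinhd z w.
Proof.
  intros HPhi HW Hg HK z w Hz Hw.
  assert (Hw' : Cmod (- w) < 1) by (rewrite Cmod_opp; exact Hw).
  rewrite sinhd_moebius by assumption.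
  set (b := moebius (- w) z).
  assert (Hb : Cmod b < 1) by (apply moebius_disk; assumption).
  pose proof (Cmod_ge_0 b) as Hb0.
  assert (Eb : moebius w b = z) by (apply moebius_opp_r; assumption).
  set (h := fun v => g (moebius w v)).
  set (u := fun t => Phi (h (RtoC t * b)%C)).
  assert (Hu : forall t, 0 <= t <= 1 -> exists d, is_derive u t d /\
    (1 - (t * Cmod b) ^ 2) * Rabs d <= K * Cmod b).
  { intros t Ht. set (v := (RtoC t * b)%C).
    assert (Ev : Cmod v = t * Cmod b) by (unfold v; rewrite Cmod_mult, Cmod_R, Rabs_right; lra).
    assert (Hv : Cmod v < 1) by (rewrite Ev; nra).
    destruct (Hg (moebius w v) (moebius_disk w v Hw Hv)) as [l Hl].
    assert (Hh : cderiv h v (l * moebius_deriv w v)%C)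
      by (apply (cderiv_comp g (moebius w)); [apply cderiv_moebius; assumption|exact Hl]).
    destruct (is_derive_ray h b _ t Hh) as [D1 D2].
    destruct (HPhi _ _ _ _ _ D1 D2) as [d [Hd1 Hd2]].
    assert (Ep : forall p : C, (fst p, snd p) = p) by (intros [? ?]; reflexivity).
    exists d. split.
    - eapply is_derive_ext; [|exact Hd1]. intros s. unfold u. simpl. rewrite Ep. reflexivity.
    - rewrite !Ep in Hd2. fold v in Hd2. rewrite !Cmod_mult in Hd2.
      rewrite <- Ev. pose proof (HK _ _ (moebius_disk w v Hw Hv) Hl) as HKv.
      rewrite <- (moebius_deriv_mod w v Hw Hv) in HKv. fold (h v) in HKv.
      pose proof (disk_sqr v Hv).
      eapply Rle_trans; [apply Rmult_le_compat_l; [lra|exact Hd2]|].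
      apply Rmult_le_compat_r with (r := Cmod b) in HKv; [|exact Hb0].
      eapply Rle_trans; [|exact HKv]. right. ring. }
  (* The sign of [K] is read off from the bound at the origin. *)
  assert (HK0 : 0 <= K).
  { destruct (Hg 0) as [l Hl]; [rewrite Cmod_0; lra|].
    eapply Rle_trans; [|apply (HK 0 l); [rewrite Cmod_0; lra|exact Hl]].
    rewrite Cmod_0. pose proof (HW (g 0)). pose proof (Cmod_ge_0 l). nra. }
  replace (Phi (g z)) with (u 1).
  2:{ unfold u, h. replace (RtoC 1 * b)%C with b by ring. rewrite Eb. reflexivity. }
  replace (Phi (g w)) with (u 0).
  2:{ unfold u, h. replace (RtoC 0 * b)%C with (RtoC 0) by ring. rewrite moebius_0. reflexivity. }
  apply (radial_bound u (Derive u)); [exact HK0|lra| |].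
  - intros t Ht. destruct (Hu t Ht) as [d [Hd _]]. apply Derive_correct. exists d. exact Hd.
  - intros t Ht. destruct (Hu t Ht) as [d [Hd HB]]. rewrite (is_derive_unique _ _ _ Hd). exact HB.
Qed.

Lemma conformal_fst : conformal_bound fst (fun _ => 1).
Proof.
  intros x y t dx dy Hx Hy. exists dx. split; [exact Hx|].
  rewrite Rmult_1_l. exact (fst_le_Cmod (dx, dy)).
Qed.

Lemma conformal_snd : conformal_bound snd (fun _ => 1).
Proof.
  intros x y t dx dy Hx Hy. exists dy. split; [exact Hy|].
  rewrite Rmult_1_l. exact (snd_le_Cmod (dx, dy)).
Qed.

(* Cartesian coordinates of the stereographic projection onto the unit sphere. *)
Definition ster1 (p : C) : R := 2 * fst p / (1 + (fst p ^ 2 + snd p ^ 2)).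
Definition ster2 (p : C) : R := 2 * snd p / (1 + (fst p ^ 2 + snd p ^ 2)).
Definition ster3 (p : C) : R := 1 - 2 / (1 + (fst p ^ 2 + snd p ^ 2)).

(** Density of the metric that stereographic projection pulls back from the unit sphere. *)
Definition sph_weight (p : C) : R := 2 / (1 + Cmod p ^ 2).

Lemma Rabs_le_sqr (a b : R) : 0 <= b -> a ^ 2 <= b ^ 2 -> Rabs a <= b.
Proof.
  intros Hb H. rewrite <- (Rabs_pos_eq b Hb). apply Rsqr_le_abs_0. unfold Rsqr. lra.
Qed.

Lemma one_plus_sqr_pos (x y : R) : 0 < 1 + (x ^ 2 + y ^ 2).
Proof. pose proof (pow2_ge_0 x). pose proof (pow2_ge_0 y). lra. Qed.

(** The three stereographic coordinates all have derivatives of the form 2 num / (1 + x^2 + y^2)^2;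
    this leaves a polynomial inequality for each. *)
Lemma sph_bound (x y dx dy num : R) :
  num ^ 2 <= (1 + (x ^ 2 + y ^ 2)) ^ 2 * (dx ^ 2 + dy ^ 2) ->
  Rabs (2 * num / (1 + (x ^ 2 + y ^ 2)) ^ 2) <= sph_weight (x, y) * Cmod (dx, dy).
Proof.
  intros H. pose proof (one_plus_sqr_pos x y) as P. unfold sph_weight.
  rewrite Cmod_sqr. simpl fst; simpl snd. set (q := 1 + (x ^ 2 + y ^ 2)) in *.
  replace (2 * num / q ^ 2) with (2 / q * (num / q)) by (field; lra).
  rewrite Rabs_mult, (Rabs_right (2 / q)) by (apply Rle_ge, Rdiv_le_0_compat; lra).
  apply Rmult_le_compat_l; [apply Rdiv_le_0_compat; lra|].
  apply Rabs_le_sqr; [apply Cmod_ge_0|]. rewrite Cmod_sqr. simpl fst; simpl snd.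
  apply Rmult_le_reg_l with (q ^ 2); [apply pow_lt; exact P|].
  replace (q ^ 2 * (num / q) ^ 2) with (num ^ 2) by (field; lra). exact H.
Qed.

Ltac ster_tac x y t dx dy :=
  let P := fresh "P" in
  pose proof (one_plus_sqr_pos (x t) (y t)) as P;
  split;
  [ auto_derive;
    [ repeat split; try (eexists; eassumption); simpl in P; lra
    | replace (Derive (fun s => x s) t) with dx by (symmetry; apply is_derive_unique; assumption);
      replace (Derive (fun s => y s) t) with dy by (symmetry; apply is_derive_unique; assumption);
      simpl in *; field; lra ]
  | apply sph_bound ].

Lemma conformal_ster1 : conformal_bound ster1 sph_weight.
Proof.
  intros x y t dx dy Hx Hy. unfold ster1; simpl fst; simpl snd.
  exists (2 * ((1 + y t ^ 2 - x t ^ 2) * dx - 2 * x t * y t * dy) / (1 + (x t ^ 2 + y t ^ 2)) ^ 2).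
  ster_tac x y t dx dy.
  generalize (x t) (y t). intros a b.
  (* Lagrange's identity: the squared numerator plus this square is ((1 + b^2 - a^2)^2 + 4 a^2 b^2)
     (dx^2 + dy^2), whose first factor falls short of (1 + a^2 + b^2)^2 by (2 a)^2. *)
  assert (0 <= ((1 + b ^ 2 - a ^ 2) * dy + 2 * a * b * dx) ^ 2) by apply pow2_ge_0.
  assert (0 <= (2 * a) ^ 2 * (dx ^ 2 + dy ^ 2)).
  { apply Rmult_le_pos; [apply pow2_ge_0|]. pose proof (pow2_ge_0 dx). pose proof (pow2_ge_0 dy). lra. }
  lra.
Qed.

Lemma conformal_ster2 : conformal_bound ster2 sph_weight.
Proof.
  intros x y t dx dy Hx Hy. unfold ster2; simpl fst; simpl snd.
  exists (2 * ((1 + x t ^ 2 - y t ^ 2) * dy - 2 * x t * y t * dx) / (1 + (x t ^ 2 + y t ^ 2)) ^ 2).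
  ster_tac x y t dx dy.
  generalize (x t) (y t). intros a b.
  assert (0 <= ((1 + a ^ 2 - b ^ 2) * dx + 2 * a * b * dy) ^ 2) by apply pow2_ge_0.
  assert (0 <= (2 * b) ^ 2 * (dx ^ 2 + dy ^ 2)).
  { apply Rmult_le_pos; [apply pow2_ge_0|]. pose proof (pow2_ge_0 dx). pose proof (pow2_ge_0 dy). lra. }
  lra.
Qed.

Lemma conformal_ster3 : conformal_bound ster3 sph_weight.
Proof.
  intros x y t dx dy Hx Hy. unfold ster3; simpl fst; simpl snd.
  exists (2 * (2 * (x t * dx + y t * dy)) / (1 + (x t ^ 2 + y t ^ 2)) ^ 2).
  ster_tac x y t dx dy.
  generalize (x t) (y t). intros a b.
  (* Lagrange's identity again, now with (1 + s)^2 - 4 s = (1 - s)^2 for s = a^2 + b^2. *)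
  assert (0 <= (2 * (a * dy - b * dx)) ^ 2) by apply pow2_ge_0.
  assert (0 <= (1 - (a ^ 2 + b ^ 2)) ^ 2 * (dx ^ 2 + dy ^ 2)).
  { apply Rmult_le_pos; [apply pow2_ge_0|]. pose proof (pow2_ge_0 dx). pose proof (pow2_ge_0 dy). lra. }
  lra.
Qed.

(** Half the Euclidean distance of the stereographic images. The quotient in the normal case is
    [chord (f z) (f w) / sinhd z w]. *)
Definition chord (a b : C) : R :=
  Cmod (a - b) / (sqrt (1 + Cmod a ^ 2) * sqrt (1 + Cmod b ^ 2)).

Lemma sph_pos (a : C) : 0 < 1 + Cmod a ^ 2.
Proof. pose proof (pow2_ge_0 (Cmod a)). lra. Qed.

Lemma sph_sqrt_pos (a : C) : 0 < sqrt (1 + Cmod a ^ 2).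
Proof. apply sqrt_lt_R0, sph_pos. Qed.

Lemma chord_ge_0 (a b : C) : 0 <= chord a b.
Proof.
  apply Rdiv_le_0_compat; [apply Cmod_ge_0|].
  apply Rmult_lt_0_compat; apply sph_sqrt_pos.
Qed.

Lemma chord_ster (a b : C) :
  4 * chord a b ^ 2 = (ster1 a - ster1 b) ^ 2 + (ster2 a - ster2 b) ^ 2 + (ster3 a - ster3 b) ^ 2.
Proof.
  pose proof (sph_sqrt_pos a). pose proof (sph_sqrt_pos b).
  unfold chord. unfold Rdiv at 1. rewrite Rpow_mult_distr, pow_inv, Rpow_mult_distr.
  rewrite !pow2_sqrt by (left; apply sph_pos).
  rewrite !Cmod_sqr. destruct a as [a1 a2], b as [b1 b2]. unfold ster1, ster2, ster3. simpl fst; simpl snd.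
  pose proof (one_plus_sqr_pos a1 a2). pose proof (one_plus_sqr_pos b1 b2).
  field. lra.
Qed.

(** Closeness of the stereographic images in the maximum norm. Unlike [chord], it inherits the
    triangle inequality and compactness directly from real numbers. *)
Definition nster (a b : C) (e : R) : Prop :=
  Rabs (ster1 a - ster1 b) <= e /\ Rabs (ster2 a - ster2 b) <= e /\ Rabs (ster3 a - ster3 b) <= e.

(** By [chord_ster], 4 chord^2 <= 3 e^2. *)
Lemma nster_chord (a b : C) (e : R) : nster a b e -> chord a b <= e.
Proof.
  intros [H1 [H2 H3]]. pose proof (chord_ster a b) as E. pose proof (chord_ge_0 a b).
  assert (0 <= e) by (pose proof (Rabs_pos (ster1 a - ster1 b)); lra).
  assert (K : forall x, Rabs x <= e -> x ^ 2 <= e ^ 2).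
  { intros x Hx. rewrite <- (pow2_abs x). apply pow_incr. split; [apply Rabs_pos|exact Hx]. }
  apply K in H1, H2, H3. nra.
Qed.

(** The weighted spherical derivative is at most [K], cleared of denominators. *)
Definition marty (g : C -> C) (K : R) : Prop :=
  forall z l, Cmod z < 1 -> cderiv g z l -> (1 - Cmod z ^ 2) * Cmod l <= K * (1 + Cmod (g z) ^ 2).

(** The factor 2 is the numerator of [sph_weight]. *)
Lemma marty_sinhd (g : C -> C) (K : R) : holo 1 g -> marty g K ->
  forall z w, Cmod z < 1 -> Cmod w < 1 -> nster (g z) (g w) (2 * K * sinhd z w).
Proof.
  intros Hg HK.
  assert (HW : forall p, 0 <= sph_weight p).
  { intros p. apply Rdiv_le_0_compat; [lra|apply sph_pos]. }
  assert (HB : forall z l, Cmod z < 1 -> cderiv g z l ->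
    (1 - Cmod z ^ 2) * (sph_weight (g z) * Cmod l) <= 2 * K).
  { intros z l Hz Hl. specialize (HK z l Hz Hl). pose proof (sph_pos (g z)). unfold sph_weight.
    apply Rmult_le_reg_r with (1 + Cmod (g z) ^ 2); [assumption|].
    replace ((1 - Cmod z ^ 2) * (2 / (1 + Cmod (g z) ^ 2) * Cmod l) * (1 + Cmod (g z) ^ 2))
      with (2 * ((1 - Cmod z ^ 2) * Cmod l)) by (field; lra). lra. }
  intros z w Hz Hw. split; [|split].
  - exact (hyperbolic_lipschitz _ _ g _ conformal_ster1 HW Hg HB z w Hz Hw).
  - exact (hyperbolic_lipschitz _ _ g _ conformal_ster2 HW Hg HB z w Hz Hw).
  - exact (hyperbolic_lipschitz _ _ g _ conformal_ster3 HW Hg HB z w Hz Hw).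
Qed.

(** * From difference quotients to derivative bounds, and the two equivalences *)

Definition rcont (F : C -> R) (z : C) : Prop := ccont (fun w => RtoC (F w)) z.

Lemma rcont_mult (F G : C -> R) (z : C) : rcont F z -> rcont G z -> rcont (fun w => F w * G w) z.
Proof.
  intros HF HG. eapply ccont_ext; [|apply (ccont_mult _ _ z HF HG)].
  apply cnear_true. intros w. rewrite RtoC_mult. reflexivity.
Qed.

Lemma rcont_minus (F G : C -> R) (z : C) : rcont F z -> rcont G z -> rcont (fun w => F w - G w) z.
Proof.
  intros HF HG. eapply ccont_ext; [|apply (ccont_minus _ _ z HF HG)].
  apply cnear_true. intros w. rewrite RtoC_minus. reflexivity.
Qed.

Lemma rcont_const (c : R) (z : C) : rcont (fun _ => c) z.
Proof. exact (ccont_const (RtoC c) z). Qed.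

Lemma rcont_Cmod (f : C -> C) (z : C) : ccont f z -> rcont (fun w => Cmod (f w)) z.
Proof.
  intros Hf e He. eapply cnear_impl; [|apply (Hf e He)]. intros w Hw. simpl in *.
  rewrite <- RtoC_minus, Cmod_R. apply Rabs_def1.
  - pose proof (Cmod_triangle_inv (f w) (f z)). lra.
  - rewrite Cmod_minus_sym in Hw. pose proof (Cmod_triangle_inv (f z) (f w)). lra.
Qed.

Lemma rcont_sqrt (F : C -> R) (z : C) : rcont F z -> 0 < F z -> rcont (fun w => sqrt (F w)) z.
Proof.
  intros HF Hz e He. destruct (continuity_pt_sqrt (F z) (Rlt_le _ _ Hz) e He) as [d [Hd H]].
  eapply cnear_impl; [|apply (HF d Hd)]. intros w Hw. simpl in *.
  rewrite <- RtoC_minus, Cmod_R in *.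
  destruct (Req_dec (F w) (F z)) as [E|E].
  - rewrite E. replace (sqrt (F z) - sqrt (F z)) with 0 by ring. rewrite Rabs_R0. exact He.
  - apply (H (F w)). split; [split; [exact I|congruence]|exact Hw].
Qed.

Lemma rcont_limit_le (F : C -> R) (z : C) :
  rcont F z -> cnear z (fun w => w <> z -> F w <= 0) -> F z <= 0.
Proof.
  intros HF HN. apply Rnot_lt_le. intros K.
  destruct (cnear_and _ _ _ (HF _ K) HN) as [d [Hd H]].
  assert (Hz : Cmod (z + RtoC (d / 2) - z) = d / 2).
  { replace (z + RtoC (d / 2) - z)%C with (RtoC (d / 2)) by ring. rewrite Cmod_R, Rabs_right; lra. }
  destruct (H (z + RtoC (d / 2))%C) as [H1 H2]; [lra|].
  assert (Hne : (z + RtoC (d / 2))%C <> z).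
  { intros E. rewrite E in Hz. replace (z - z)%C with (RtoC 0) in Hz by ring. rewrite Cmod_0 in Hz. lra. }
  specialize (H2 Hne). rewrite <- RtoC_minus, Cmod_R in H1. apply Rabs_def2 in H1. lra.
Qed.

Lemma cnear_disk (z : C) : Cmod z < 1 -> cnear z (fun w => Cmod w < 1).
Proof.
  intros H. exists (1 - Cmod z). split; [lra|]. intros w Hw.
  pose proof (Cmod_triangle_inv w z). lra.
Qed.

(** For w <> z the quotient is |q(w)|, with q the slope function; continuity of q at [z] carries the
    inequality to w = z. *)
Lemma quotient_limit (f : C -> C) (A B : C -> R) (z l : C) :
  Cmod z < 1 -> cderiv f z l -> rcont A z -> rcont B z ->
  (forall w, Cmod w < 1 -> w <> z -> A w * (Cmod (f z - f w) / Cmod (z - w)) <= B w) ->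
  A z * Cmod l <= B z.
Proof.
  intros Hz [q [Hq [Hl Hn]]] HA HB H.
  cut (A z * Cmod (q z) - B z <= 0); [rewrite Hl; lra|].
  apply (rcont_limit_le (fun w => A w * Cmod (q w) - B w)).
  - apply rcont_minus; [|exact HB]. apply rcont_mult; [exact HA|]. apply rcont_Cmod. exact Hq.
  - eapply cnear_impl; [|apply cnear_and; [exact Hn|apply (cnear_disk z Hz)]].
    intros w [H1 H2] Hne. simpl in *. specialize (H w H2 Hne).
    assert (Hm : 0 < Cmod (w - z)) by (apply Cmod_gt_0, Cminus_eq_contra; exact Hne).
    rewrite Cmod_minus_sym, (Cmod_minus_sym z w), H1, Cmod_mult in H.
    replace (Cmod (q w) * Cmod (w - z) / Cmod (w - z)) with (Cmod (q w)) in H by (field; lra). lra.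
Qed.

Lemma holo_analytic (f : C -> C) : analytic_on unit_disk f <-> holo 1 f.
Proof.
  split; intros H z Hz; destruct (H z Hz) as [l Hl]; exists l; apply is_derive_cderiv; exact Hl.
Qed.

Lemma rcont_disk_weight (z : C) : Cmod z < 1 ->
  rcont (fun w => sqrt (1 - Cmod z ^ 2) * sqrt (1 - Cmod w ^ 2)) z.
Proof.
  intros Hz. apply rcont_mult; [apply rcont_const|].
  apply (rcont_sqrt (fun w => 1 - Cmod w ^ 2)); [|apply disk_sqr; exact Hz].
  apply rcont_minus; [apply rcont_const|].
  apply (rcont_mult (fun w => Cmod w) (fun w => Cmod w * 1)); [apply (rcont_Cmod (fun w => w)), ccont_id|].
  apply rcont_mult; [apply (rcont_Cmod (fun w => w)), ccont_id|apply rcont_const].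
Qed.

(** The quantity is |f(z) - f(w)| / [sinhd z w]; real and imaginary parts are each Lipschitz with
    constant M, and recombining them costs a factor 2. *)
Lemma bloch_iff (f : C -> C) (hf : analytic_on unit_disk f) :
  is_bloch f <->
    exists M : R, forall z w : C, unit_disk z -> unit_disk w -> z <> w ->
      sqrt (1 - Cmod z ^ 2) * sqrt (1 - Cmod w ^ 2) *
        (Cmod (f z - f w) / Cmod (z - w)) <= M.
Proof.
  unfold unit_disk in *. split.
  - intros [_ [M HM]]. exists (2 * M). intros z w Hz Hw Hne.
    assert (HB : forall z l, Cmod z < 1 -> cderiv f z l -> (1 - Cmod z ^ 2) * (1 * Cmod l) <= M).
    { intros v l Hv Hl. rewrite Rmult_1_l.
      rewrite (cderiv_unique f v l (C_derive f v) Hl); [apply HM; exact Hv|].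
      apply cderiv_C_derive, hf. exact Hv. }
    assert (Hh : holo 1 f) by (apply holo_analytic; exact hf).
    assert (L : Cmod (f z - f w) <= 2 * (M * sinhd z w)).
    { apply Cmod_le_components.
      - exact (hyperbolic_lipschitz fst _ f M conformal_fst (fun _ => Rle_0_1) Hh HB z w Hz Hw).
      - exact (hyperbolic_lipschitz snd _ f M conformal_snd (fun _ => Rle_0_1) Hh HB z w Hz Hw). }
    unfold sinhd in L.
    pose proof (sqrt_lt_R0 _ (disk_sqr z Hz)). pose proof (sqrt_lt_R0 _ (disk_sqr w Hw)).
    assert (Hm : 0 < Cmod (z - w)) by (apply Cmod_gt_0, Cminus_eq_contra; exact Hne).
    set (p := sqrt (1 - Cmod z ^ 2)) in *. set (q := sqrt (1 - Cmod w ^ 2)) in *.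
    assert (Hpq : 0 < p * q) by (apply Rmult_lt_0_compat; assumption).
    apply Rmult_le_reg_r with (Cmod (z - w) / (p * q)); [apply Rdiv_lt_0_compat; assumption|].
    replace (p * q * (Cmod (f z - f w) / Cmod (z - w)) * (Cmod (z - w) / (p * q)))
      with (Cmod (f z - f w)) by (field; lra). lra.
  - intros [M HM]. split; [exact hf|]. exists M. intros z Hz.
    pose proof (cderiv_C_derive f z (hf z Hz)) as Hl.
    pose proof (quotient_limit f (fun w => sqrt (1 - Cmod z ^ 2) * sqrt (1 - Cmod w ^ 2)) (fun _ => M)
      z _ Hz Hl (rcont_disk_weight z Hz) (rcont_const M z)) as Q.
    cbv beta in Q. rewrite sqrt_sqrt in Q by (left; apply disk_sqr; exact Hz). apply Q.
    intros w Hw Hne. apply HM; auto.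
Qed.

Lemma rcont_sph_weight (f : C -> C) (z : C) (M : R) : ccont f z ->
  rcont (fun w => M * (sqrt (1 + Cmod (f z) ^ 2) * sqrt (1 + Cmod (f w) ^ 2))) z.
Proof.
  intros Hf. apply rcont_mult; [apply rcont_const|]. apply rcont_mult; [apply rcont_const|].
  apply (rcont_sqrt (fun w => 1 + Cmod (f w) ^ 2)); [|apply sph_pos].
  apply ccont_ext with (fun w => RtoC (1 - (- (1) * (Cmod (f w) * Cmod (f w))))).
  - apply cnear_true. intros w. f_equal. ring.
  - apply rcont_minus; [apply rcont_const|]. apply rcont_mult; [apply rcont_const|].
    apply rcont_mult; apply rcont_Cmod; exact Hf.
Qed.

Lemma marty_iff (f : C -> C) : holo 1 f ->
  (exists K, marty f K) <->
  exists M : R, forall z w : C, unit_disk z -> unit_disk w -> z <> w ->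
      (sqrt (1 - Cmod z ^ 2) * sqrt (1 - Cmod w ^ 2)) /
        (sqrt (1 + Cmod (f z) ^ 2) * sqrt (1 + Cmod (f w) ^ 2)) *
        (Cmod (f z - f w) / Cmod (z - w)) <= M.
Proof.
  intros Hf. unfold unit_disk. split.
  - intros [K HK]. exists (2 * K). intros z w Hz Hw Hne.
    pose proof (nster_chord _ _ _ (marty_sinhd f K Hf HK z w Hz Hw)) as L. unfold sinhd, chord in L.
    pose proof (sqrt_lt_R0 _ (disk_sqr z Hz)). pose proof (sqrt_lt_R0 _ (disk_sqr w Hw)).
    assert (Hm : 0 < Cmod (z - w)) by (apply Cmod_gt_0, Cminus_eq_contra; exact Hne).
    pose proof (sph_sqrt_pos (f z)). pose proof (sph_sqrt_pos (f w)).
    set (p := sqrt (1 - Cmod z ^ 2)) in *. set (q := sqrt (1 - Cmod w ^ 2)) in *.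
    set (P := sqrt (1 + Cmod (f z) ^ 2)) in *. set (Q := sqrt (1 + Cmod (f w) ^ 2)) in *.
    assert (Hpq : 0 < p * q) by (apply Rmult_lt_0_compat; assumption).
    apply Rmult_le_reg_r with (Cmod (z - w) / (p * q)); [apply Rdiv_lt_0_compat; assumption|].
    replace (p * q / (P * Q) * (Cmod (f z - f w) / Cmod (z - w)) * (Cmod (z - w) / (p * q)))
      with (Cmod (f z - f w) / (P * Q)) by (field; lra). exact L.
  - intros [M HM]. exists M. intros z l Hz Hl.
    pose proof (quotient_limit f (fun w => sqrt (1 - Cmod z ^ 2) * sqrt (1 - Cmod w ^ 2)) _
      z _ Hz Hl (rcont_disk_weight z Hz) (rcont_sph_weight f z M (cderiv_ccont _ _ _ Hl))) as Q.
    cbv beta in Q. rewrite sqrt_sqrt in Q by (left; apply disk_sqr; exact Hz).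
    rewrite sqrt_sqrt in Q by (left; apply sph_pos). apply Q.
    intros w Hw Hne. specialize (HM z w Hz Hw (fun E => Hne (eq_sym E))).
    pose proof (sph_sqrt_pos (f z)). pose proof (sph_sqrt_pos (f w)).
    set (P := sqrt (1 + Cmod (f z) ^ 2)) in *. set (R := sqrt (1 + Cmod (f w) ^ 2)) in *.
    assert (HPR : 0 < P * R) by (apply Rmult_lt_0_compat; assumption).
    apply Rmult_le_compat_r with (r := P * R) in HM; [|lra].
    eapply Rle_trans; [|exact HM]. right.
    assert (Hm : 0 < Cmod (z - w)) by (apply Cmod_gt_0, Cminus_eq_contra; congruence).
    field. lra.
Qed.

(** * Marty's criterion: necessity *)

Lemma strict_ge (s : nat -> nat) :
  (forall i j : nat, (i < j)%nat -> (s i < s j)%nat) -> forall n, (n <= s n)%nat.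
Proof.
  intros H. induction n as [|n IH]; [lia|]. pose proof (H n (S n) ltac:(lia)). lia.
Qed.

Lemma INR_unbounded (x : R) : exists n : nat, x < INR n.
Proof.
  destruct (nfloor_ex (Rmax x 0)) as [n [_ H]]; [apply Rmax_r|].
  exists (S n). rewrite S_INR. pose proof (Rmax_l x 0). lra.
Qed.

Lemma not_marty_sequence (f : C -> C) : ~ (exists K, marty f K) ->
  exists z : nat -> C, forall n, Cmod (z n) < 1 /\
    exists l, cderiv f (z n) l /\ INR n * (1 + Cmod (f (z n)) ^ 2) < (1 - Cmod (z n) ^ 2) * Cmod l.
Proof.
  intros H.
  assert (E : forall n : nat, exists z, Cmod z < 1 /\
    exists l, cderiv f z l /\ INR n * (1 + Cmod (f z) ^ 2) < (1 - Cmod z ^ 2) * Cmod l).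
  { intros n. apply NNPP. intros Hn. apply H. exists (INR n). intros z l Hz Hl.
    apply Rnot_lt_le. intros K. apply Hn. exists z. split; [exact Hz|]. exists l. split; assumption. }
  exists (fun n => proj1_sig (constructive_indefinite_description _ (E n))).
  intros n. apply (proj2_sig (constructive_indefinite_description _ (E n))).
Qed.

Lemma normal_marty (f : C -> C) : is_normal f -> exists K, marty f K.
Proof.
  intros [hf HN]. apply NNPP. intros Hno.
  assert (Hf : holo 1 f) by (apply holo_analytic; exact hf).
  destruct (not_marty_sequence f Hno) as [z Hz].
  set (g := fun n w => f (moebius (z n) w)).
  assert (Hg : forall n, holo 1 (g n)).
  { intros n w Hw. destruct (Hz n) as [Hzn _].
    destruct (Hf _ (moebius_disk _ _ Hzn Hw)) as [m Hm].
    eexists. apply (cderiv_comp f (moebius (z n))); [apply cderiv_moebius; assumption|exact Hm]. }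
  (* [moebius (z n)] moves the bad point to 0, and its derivative there absorbs the weight 1 -
     |z|^2. *)
  assert (Hl : forall n l, cderiv (g n) 0 l -> INR n * (1 + Cmod (g n 0) ^ 2) < Cmod l).
  { intros n l Hl. destruct (Hz n) as [Hzn [m [Hm HB]]].
    assert (Z0 : Cmod 0 < 1) by (rewrite Cmod_0; lra).
    assert (El : l = (m * moebius_deriv (z n) 0)%C).
    { eapply cderiv_unique; [exact Hl|]. apply (cderiv_comp f (moebius (z n))).
      - apply cderiv_moebius; assumption.
      - rewrite moebius_0. exact Hm. }
    pose proof (moebius_deriv_mod (z n) 0 Hzn Z0) as D. rewrite moebius_0, Cmod_0 in D.
    replace ((1 - 0 ^ 2) * Cmod (moebius_deriv (z n) 0)) with (Cmod (moebius_deriv (z n) 0)) in D by ring.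
    unfold g. rewrite moebius_0, El, Cmod_mult, D. lra. }
  assert (O0 : unit_disk 0) by (unfold unit_disk; rewrite Cmod_0; lra).
  destruct (HN g) as [s [Hs HD]].
  { intros n. exists (moebius (z n)). split; [apply disk_automorphism_moebius, Hz|]. intros; reflexivity. }
  pose proof (strict_ge s Hs) as Hge.
  destruct HD as [[h [Hh Hc]]|Hd].
  - destruct (Hc 0 O0) as [V [HV HE]].
    destruct (locally_cnear _ _ HV) as [d [Hd0 HdV]].
    destruct (HE 1 Rlt_0_1) as [N HNn].
    set (rho := Rmin d 1). assert (R1 : rho <= d) by apply Rmin_l. assert (R2 : rho <= 1) by apply Rmin_r.
    assert (R0 : 0 < rho) by (apply Rmin_glb_lt; lra).
    apply holo_analytic in Hh. destruct (Hh 0 O0) as [lh Hlh].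
    (* On radius rho / 2 the difference g - h is below 1, so its derivative at 0 is at most 4 / rho;
       [N'] exceeds the resulting bound on |g'(0)|. *)
    destruct (INR_unbounded (Cmod lh + 4 / rho)) as [N' HN'].
    set (n := Nat.max N N').
    destruct (taylor_first_order_0 (fun w => g (s n) w - h w)%C rho (rho / 2) 1) as [l [H1 [H2 _]]].
    + intros w Hw. destruct (Hg (s n) w ltac:(lra)) as [l1 L1]. destruct (Hh w ltac:(lra)) as [l2 L2].
      exists (l1 - l2)%C. apply cderiv_minus; assumption.
    + lra.
    + intros w Hw. left. apply (HNn n); [unfold n; lia|unfold unit_disk; lra|].
      apply HdV. rewrite Cminus_0_r. lra.
    + assert (L : cderiv (g (s n)) 0 (l + lh)%C).
      { eapply cderiv_ext; [|apply (cderiv_plus _ _ _ _ _ H1 Hlh)]. apply cnear_true. intros w. ring. }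
      apply Hl in L. pose proof (Cmod_triangle l lh).
      assert (INR N' <= INR (s n)) by (apply le_INR; specialize (Hge n); unfold n in *; lia).
      pose proof (pow2_ge_0 (Cmod (g (s n) 0))). pose proof (pos_INR (s n)).
      replace (2 * 1 / (rho / 2)) with (4 / rho) in H2 by (field; lra). nra.
  - destruct (Hd 0 O0) as [V [HV HE]].
    destruct (locally_cnear _ _ HV) as [d [Hd0 HdV]].
    destruct (HE 1) as [N HNn].
    set (rho := Rmin d 1). assert (R1 : rho <= d) by apply Rmin_l. assert (R2 : rho <= 1) by apply Rmin_r.
    assert (R0 : 0 < rho) by (apply Rmin_glb_lt; lra).
    destruct (INR_unbounded (4 / rho)) as [N' HN'].
    set (n := Nat.max N N').
    assert (Hbig : forall w, Cmod w < rho -> 1 < Cmod (g (s n) w)).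
    { intros w Hw. apply (HNn n); [unfold n; lia|unfold unit_disk; lra|].
      apply HdV. rewrite Cminus_0_r. lra. }
    assert (Hnz : forall w, Cmod w < rho -> g (s n) w <> 0).
    { intros w Hw. apply (Cmod_pos_neq _ 1); [lra|apply Hbig; exact Hw]. }
    destruct (taylor_first_order_0 (fun w => / g (s n) w)%C rho (rho / 2) 1) as [l [H1 [H2 _]]].
    + intros w Hw. destruct (Hg (s n) w ltac:(lra)) as [l1 L1].
      eexists. apply cderiv_inv; [exact L1|apply Hnz; exact Hw].
    + lra.
    + intros w Hw. pose proof (Hbig w ltac:(lra)). rewrite Cmod_inv by (apply Hnz; lra).
      rewrite <- Rinv_1. apply Rinv_le_contravar; lra.
    (* |(1/g)'(0)| = |g'(0)| / |g(0)|^2 <= 4 / rho is incompatible with the lower bound INR (s n) *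
       (1 + |g(0)|^2) for |g'(0)|. *)
    + destruct (Hg (s n) 0 O0) as [l1 L1]. pose proof (Hl _ _ L1) as B.
      assert (Z : g (s n) 0 <> 0) by (apply Hnz; rewrite Cmod_0; lra).
      assert (E : l = (- l1 / (g (s n) 0 * g (s n) 0))%C).
      { eapply cderiv_unique; [exact H1|]. apply cderiv_inv; assumption. }
      rewrite E, Cmod_div, Cmod_opp, Cmod_mult in H2 by (apply Cmult_neq_0; exact Z).
      apply Cmod_gt_0 in Z. set (a := Cmod (g (s n) 0)) in *.
      assert (INR N' <= INR (s n)) by (apply le_INR; specialize (Hge n); unfold n in *; lia).
      replace (2 * 1 / (rho / 2)) with (4 / rho) in H2 by (field; lra).
      apply Rmult_le_compat_r with (r := a * a) in H2; [|nra].
      replace (Cmod l1 / (a * a) * (a * a)) with (Cmod l1) in H2 by (field; lra).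
      pose proof (pos_INR (s n)). nra.
Qed.

(** Moebius maps on both sides move [z] and [phi z] to 0. Cauchy's estimate on the circle of radius
    1/2 then gives 4 in place of the sharp constant 1. *)
Lemma schwarz_pick_weak (phi : C -> C) (z l : C) :
  disk_automorphism phi -> Cmod z < 1 -> cderiv phi z l ->
  (1 - Cmod z ^ 2) * Cmod l <= 4 * (1 - Cmod (phi z) ^ 2).
Proof.
  intros [Ha [Hd _]] Hz Hl. unfold unit_disk in *.
  apply holo_analytic in Ha. pose proof (Hd z Hz) as Hb. set (b := phi z) in *.
  assert (Hb' : Cmod (- b) < 1) by (rewrite Cmod_opp; exact Hb).
  assert (Z0 : Cmod 0 < 1) by (rewrite Cmod_0; lra).
  set (psi := fun w => moebius (- b) (phi (moebius z w))).
  assert (Hder : forall w m, Cmod w < 1 -> cderiv phi (moebius z w) m ->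
    cderiv psi w (moebius_deriv (- b) (phi (moebius z w)) * (m * moebius_deriv z w))).
  { intros w m Hw Hm. pose proof (moebius_disk z w Hz Hw) as Hv.
    apply (cderiv_comp (moebius (- b)) (fun w => phi (moebius z w))).
    - apply (cderiv_comp phi (moebius z)); [apply cderiv_moebius; assumption|exact Hm].
    - apply cderiv_moebius; [exact Hb'|]. apply Hd. exact Hv. }
  destruct (taylor_first_order_0 psi 1 (1 / 2) 1) as [m [H1 [H2 _]]].
  - intros w Hw. destruct (Ha _ (moebius_disk z w Hz Hw)) as [m Hm]. eexists. apply Hder; eassumption.
  - lra.
  - intros w Hw. left. apply moebius_disk; [exact Hb'|]. apply Hd, moebius_disk; lra.
  - assert (E : m = (moebius_deriv (- b) b * (l * moebius_deriv z 0))%C).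
    { eapply cderiv_unique; [exact H1|]. pose proof (Hder 0 l Z0) as K.
      rewrite moebius_0 in K. exact (K Hl). }
    pose proof (moebius_deriv_mod (- b) b Hb' Hb) as D1.
    replace (moebius (- b) b) with (RtoC 0) in D1
      by (rewrite <- (moebius_0 b) at 2; rewrite moebius_opp_l; [reflexivity|exact Hb|exact Z0]).
    pose proof (moebius_deriv_mod z 0 Hz Z0) as D2. rewrite moebius_0 in D2.
    rewrite Cmod_0 in D1, D2. rewrite E, !Cmod_mult in H2.
    replace ((1 - 0 ^ 2) * Cmod (moebius_deriv z 0)) with (Cmod (moebius_deriv z 0)) in D2 by ring.
    rewrite D2 in H2. pose proof (disk_sqr b Hb).
    apply Rmult_le_compat_l with (r := 1 - Cmod b ^ 2) in H2; [|lra].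
    rewrite <- Rmult_assoc, D1 in H2. lra.
Qed.

Lemma marty_automorphism (f phi g : C -> C) (K : R) :
  holo 1 f -> marty f K -> disk_automorphism phi ->
  (forall z, Cmod z < 1 -> g z = f (phi z)) -> holo 1 g /\ marty g (4 * K).
Proof.
  intros Hf HK Hphi Hg. pose proof Hphi as [Ha [Hd _]]. apply holo_analytic in Ha. unfold unit_disk in Hd.
  assert (D : forall z l m, Cmod z < 1 -> cderiv phi z l -> cderiv f (phi z) m -> cderiv g z (m * l)).
  { intros z l m Hz Hl Hm. apply cderiv_ext with (fun z => f (phi z)).
    - eapply cnear_impl; [|apply (cnear_disk z Hz)]. intros w Hw. symmetry. apply Hg. exact Hw.
    - apply cderiv_comp; assumption. }
  split.
  - intros z Hz. destruct (Ha z Hz) as [l Hl]. destruct (Hf _ (Hd z Hz)) as [m Hm].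
    eexists. apply D; eassumption.
  - intros z k Hz Hk. destruct (Ha z Hz) as [l Hl]. destruct (Hf _ (Hd z Hz)) as [m Hm].
    rewrite (cderiv_unique _ _ _ _ Hk (D z l m Hz Hl Hm)), Cmod_mult, (Hg z Hz).
    pose proof (schwarz_pick_weak phi z l Hphi Hz Hl) as SP.
    pose proof (HK _ _ (Hd z Hz) Hm) as M. pose proof (Cmod_ge_0 m).
    apply Rmult_le_compat_r with (r := Cmod m) in SP; [|assumption]. lra.
Qed.

(** * Compactness for the chordal metric *)

Definition strict (s : nat -> nat) : Prop := forall i j : nat, (i < j)%nat -> (s i < s j)%nat.

Lemma strict_S (s : nat -> nat) : (forall n, (s n < s (S n))%nat) -> strict s.
Proof. intros H i j Hij. induction Hij as [|j _ IH]; [apply H|]. specialize (H j). lia. Qed.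

Lemma bolzano_weierstrass_subseq (v : nat -> R) (m : R) : (forall n, Rabs (v n) <= m) ->
  exists s, strict s /\ exists l : R, is_lim_seq (fun n => v (s n)) l.
Proof.
  intros Hm.
  destruct (Bolzano_Weierstrass v (fun x => - m <= x <= m) (compact_P3 (- m) m)) as [l Hl].
  { intros n. apply Rabs_le_between, Hm. }
  assert (E : forall N k : nat, exists p, (N <= p)%nat /\ Rabs (v p - l) < / (INR k + 1)).
  { intros N k.
    assert (Hk : 0 < / (INR k + 1)) by (apply Rinv_0_lt_compat; pose proof (pos_INR k); lra).
    destruct (Hl (disc l (mkposreal _ Hk)) N) as [p [Hp1 Hp2]].
    - exists (mkposreal _ Hk). intros x Hx. exact Hx.
    - exists p. split; assumption. }
  set (pick := fun N k => proj1_sig (constructive_indefinite_description _ (E N k))).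
  assert (Hp : forall N k, (N <= pick N k)%nat /\ Rabs (v (pick N k) - l) < / (INR k + 1))
    by (intros N k; apply (proj2_sig (constructive_indefinite_description _ (E N k)))).
  (* Each index lies beyond the previous one, and its value is within 1 / (n + 1) of the cluster
     point. *)
  set (s := fix s n := match n with O => pick O O | S n' => pick (S (s n')) (S n') end).
  exists s. split.
  - apply strict_S. intros n. simpl. pose proof (Hp (S (s n)) (S n)). lia.
  - exists l. apply is_lim_seq_spec. intros e.
    destruct (INR_unbounded (/ e)) as [N HN]. exists N. intros n Hn.
    assert (B : Rabs (v (s n) - l) < / (INR n + 1)) by (destruct n; apply Hp).
    eapply Rlt_trans; [exact B|]. pose proof (cond_pos e) as He. apply le_INR in Hn.
    rewrite <- (Rinv_inv e). apply Rinv_lt_contravar; [|lra].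
    pose proof (Rinv_0_lt_compat _ He). apply Rmult_lt_0_compat; lra.
Qed.

Lemma diagonal_subseq (u : nat -> nat -> R) (m : R) : (forall k n, Rabs (u k n) <= m) ->
  exists s, strict s /\ forall k, exists l : R, is_lim_seq (fun n => u k (s n)) l.
Proof.
  intros Hm.
  assert (E : forall (k : nat) (s : nat -> nat), exists t, strict t /\
    exists l : R, is_lim_seq (fun n => u k (s (t n))) l).
  { intros k s. destruct (bolzano_weierstrass_subseq (fun n => u k (s n)) m) as [t [Ht [l Hl]]].
    - intros n. apply Hm.
    - exists t. split; [exact Ht|]. exists l. exact Hl. }
  set (t := fun k s => proj1_sig (constructive_indefinite_description _ (E k s))).
  assert (Ht : forall k s, strict (t k s) /\ exists l : R, is_lim_seq (fun n => u k (s (t k s n))) l)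
    by (intros k s; apply (proj2_sig (constructive_indefinite_description _ (E k s)))).
  (* [S_ k] is the k-th of the successively refined subsequences; its diagonal is the one sought. *)
  set (S_ := fix S_ k : nat -> nat := match k with O => fun n => n | S k' => fun n => S_ k' (t k' (S_ k') n) end).
  assert (HS : forall k, strict (S_ k)).
  { induction k as [|k IH]; intros i j Hij; simpl; [exact Hij|].
    apply IH. apply (proj1 (Ht k (S_ k))). exact Hij. }
  exists (fun n => S_ n n). split.
  - apply strict_S. intros n. simpl. apply HS.
    pose proof (strict_ge _ (proj1 (Ht n (S_ n))) (S n)). lia.
  - intros k. destruct (proj2 (Ht k (S_ k))) as [l Hl]. exists l.
    (* Every later stage is a subsequence of stage [S k], so the diagonal is one too from index
       [S k] on. *)
    assert (F : forall j n, exists p, (n <= p)%nat /\ S_ (S k + j)%nat n = S_ (S k) p).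
    { induction j as [|j IH]; intros n.
      - exists n. rewrite Nat.add_0_r. split; [lia|reflexivity].
      - rewrite Nat.add_succ_r. simpl.
        destruct (IH (t (S k + j)%nat (S_ (S k + j)%nat) n)) as [p [Hp1 Hp2]].
        exists p. split; [|exact Hp2].
        pose proof (strict_ge _ (proj1 (Ht (S k + j)%nat (S_ (S k + j)%nat))) n). simpl in *. lia. }
    apply is_lim_seq_spec. intros e. apply is_lim_seq_spec in Hl. destruct (Hl e) as [N HN].
    exists (Nat.max N (S k)). intros n Hn.
    destruct (F (n - S k)%nat n) as [p [Hp1 Hp2]].
    replace (S k + (n - S k))%nat with n in Hp2 by lia. rewrite Hp2. simpl. apply HN. lia.
Qed.

Lemma nster_sym (a b : C) (e : R) : nster a b e -> nster b a e.
Proof.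
  intros [H1 [H2 H3]]. unfold nster. rewrite Rabs_minus_sym, (Rabs_minus_sym (ster2 b)), (Rabs_minus_sym (ster3 b)).
  auto.
Qed.

Lemma Rabs_triang_3 (a b c e e' : R) : Rabs (a - b) <= e -> Rabs (b - c) <= e' -> Rabs (a - c) <= e + e'.
Proof.
  intros H1 H2. replace (a - c) with ((a - b) + (b - c)) by ring.
  eapply Rle_trans; [apply Rabs_triang|lra].
Qed.

Lemma nster_trans (a b c : C) (e e' : R) : nster a b e -> nster b c e' -> nster a c (e + e').
Proof.
  intros [H1 [H2 H3]] [H4 [H5 H6]].
  split; [|split]; eapply Rabs_triang_3; eassumption.
Qed.

Lemma nster_weaken (a b : C) (e e' : R) : nster a b e -> e <= e' -> nster a b e'.
Proof. intros [H1 [H2 H3]] H. repeat split; lra. Qed.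

Lemma ster_sphere (a : C) : ster1 a ^ 2 + ster2 a ^ 2 + ster3 a ^ 2 = 1.
Proof.
  unfold ster1, ster2, ster3. pose proof (one_plus_sqr_pos (fst a) (snd a)). field. lra.
Qed.

Lemma ster_bound (a : C) : Rabs (ster1 a) <= 1 /\ Rabs (ster2 a) <= 1 /\ Rabs (ster3 a) <= 1.
Proof.
  pose proof (ster_sphere a). pose proof (pow2_ge_0 (ster1 a)).
  pose proof (pow2_ge_0 (ster2 a)). pose proof (pow2_ge_0 (ster3 a)).
  repeat split; apply Rabs_le_sqr; lra.
Qed.

(** On |v| <= 1 - d one has 1 - |v|^2 >= d, so [sinhd] is at most |z - w| / d: equicontinuity with a
    constant that depends on [K] and [d] alone. *)
Lemma marty_nster (g : C -> C) (K d : R) (z w : C) : holo 1 g -> marty g K -> 0 <= K -> 0 < d ->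
  Cmod z <= 1 - d -> Cmod w <= 1 - d -> nster (g z) (g w) (2 * K / d * Cmod (z - w)).
Proof.
  intros Hg HM HK Hd Hz Hw.
  assert (S : 2 * K * sinhd z w <= 2 * K / d * Cmod (z - w)).
  { assert (W : forall v, Cmod v <= 1 - d -> sqrt d <= sqrt (1 - Cmod v ^ 2)).
    { intros v Hv. pose proof (Cmod_ge_0 v). apply sqrt_le_1_alt. nra. }
    pose proof (W z Hz). pose proof (W w Hw). pose proof (sqrt_lt_R0 _ Hd).
    pose proof (sqrt_sqrt d (Rlt_le _ _ Hd)).
    replace (2 * K / d * Cmod (z - w)) with (2 * K * (Cmod (z - w) / d)) by (field; lra).
    apply Rmult_le_compat_l; [lra|]. unfold sinhd. apply Rmult_le_compat_l; [apply Cmod_ge_0|].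
    apply Rinv_le_contravar; [exact Hd|]. rewrite <- H2 at 1. apply Rmult_le_compat; lra. }
  assert (Hz1 : Cmod z < 1) by lra. assert (Hw1 : Cmod w < 1) by lra.
  eapply nster_weaken; [apply (marty_sinhd g K); assumption|exact S].
Qed.

(** Dyadic points; the shift by 1 lets natural indices up to 2 * 2^j cover the square [-1, 1]^2. *)
Definition grid (j i l : nat) : C := (INR i / 2 ^ j - 1, INR l / 2 ^ j - 1).

Lemma grid_coordinate (x : R) (j : nat) : Rabs x <= 1 ->
  exists i, (i <= 2 * 2 ^ j)%nat /\ Rabs (x - (INR i / 2 ^ j - 1)) <= / 2 ^ j.
Proof.
  intros Hx. apply Rabs_le_between in Hx. pose proof (two_pow_pos j) as P.
  destruct (nfloor_ex ((x + 1) * 2 ^ j)) as [i [H1 H2]]; [apply Rmult_le_pos; lra|].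
  exists i. split.
  - apply INR_le. rewrite mult_INR, pow_INR. replace (INR 2) with 2 by (simpl; ring). nra.
  - apply Rmult_le_reg_r with (2 ^ j); [exact P|]. rewrite Rinv_l by lra.
    rewrite <- (Rabs_right (2 ^ j)) at 2 by lra. rewrite <- Rabs_mult.
    replace ((x - (INR i / 2 ^ j - 1)) * 2 ^ j) with ((x + 1) * 2 ^ j - INR i) by (field; lra).
    apply Rabs_le. lra.
Qed.

Lemma grid_dense (w : C) (j : nat) : Cmod w < 1 ->
  exists i l, (i <= 2 * 2 ^ j)%nat /\ (l <= 2 * 2 ^ j)%nat /\ Cmod (w - grid j i l) <= 2 / 2 ^ j.
Proof.
  intros Hw. pose proof (fst_le_Cmod w). pose proof (snd_le_Cmod w).
  destruct (grid_coordinate (fst w) j ltac:(lra)) as [i [Hi1 Hi2]].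
  destruct (grid_coordinate (snd w) j ltac:(lra)) as [l [Hl1 Hl2]].
  exists i, l. repeat split; try assumption. apply Cmod_le_components; assumption.
Qed.

Lemma bounded_uniform (P : nat -> nat -> Prop) (B : nat) :
  (forall i N N', (N <= N')%nat -> P i N -> P i N') ->
  (forall i, exists N, P i N) -> exists N, forall i, (i <= B)%nat -> P i N.
Proof.
  intros Hm H. induction B as [|B [N IH]].
  - destruct (H O) as [N HN]. exists N. intros i Hi. replace i with O by lia. exact HN.
  - destruct (H (S B)) as [N' HN']. exists (Nat.max N N'). intros i Hi.
    destruct (Nat.eq_dec i (S B)) as [-> |Hne].
    + eapply Hm; [|exact HN']. lia.
    + eapply Hm; [|apply IH; lia]. lia.
Qed.

(** A Cauchy condition, since the limit may take the value infinity. The quarter of the distance to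
    the circle leaves room for a nearby grid point. *)
Definition locally_uniformly_cauchy (G : nat -> C -> C) : Prop :=
  forall z0, Cmod z0 < 1 -> forall e, 0 < e -> exists N, forall n m, (N <= n)%nat -> (N <= m)%nat ->
    forall w, Cmod (w - z0) < (1 - Cmod z0) / 4 -> nster (G n w) (G m w) e.

Lemma is_lim_seq_cauchy (u : nat -> R) (l e : R) : is_lim_seq u l -> 0 < e ->
  exists N, forall n m, (N <= n)%nat -> (N <= m)%nat -> Rabs (u n - u m) <= e.
Proof.
  intros H He. apply is_lim_seq_spec in H. destruct (H (pos_div_2 (mkposreal e He))) as [N HN].
  exists N. intros n m Hn Hm. pose proof (HN n Hn) as A. pose proof (HN m Hm) as B. simpl in A, B.
  replace e with (e / 2 + e / 2) by field. apply (Rabs_triang_3 _ l).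
  - left. exact A.
  - left. rewrite Rabs_minus_sym. exact B.
Qed.

Lemma arzela_ascoli_sphere (g : nat -> C -> C) (K : R) : 0 <= K ->
  (forall n, holo 1 (g n)) -> (forall n, marty (g n) K) ->
  exists s, strict s /\ locally_uniformly_cauchy (fun n => g (s n)).
Proof.
  intros HK Hg HM.
  (* Cantor pairing enumerates the grid points of all meshes, and [u] the three coordinates of the
     values there. Grid points outside the disk do no harm, since [ster_bound] holds for all
     values. *)
  set (pt := fun k => let (j, p) := Cantor.of_nat k in let (i, l) := Cantor.of_nat p in grid j i l).
  set (u := fun k n => let (c, p) := Cantor.of_nat k in
    match c with O => ster1 (g n (pt p)) | S O => ster2 (g n (pt p)) | _ => ster3 (g n (pt p)) end).
  destruct (diagonal_subseq u 1) as [s [Hs HL]].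
  { intros k n. unfold u. destruct (Cantor.of_nat k) as [c p].
    destruct (ster_bound (g n (pt p))) as [B1 [B2 B3]]. destruct c as [|[|c]]; assumption. }
  exists s. split; [exact Hs|]. intros z0 Hz0 e He.
  assert (Pt : forall j i l e, 0 < e -> exists N, forall n m, (N <= n)%nat -> (N <= m)%nat ->
    nster (g (s n) (grid j i l)) (g (s m) (grid j i l)) e).
  { intros j i l e' He'.
    assert (Ept : pt (Cantor.to_nat (j, Cantor.to_nat (i, l))) = grid j i l).
    { unfold pt. rewrite !Cantor.cancel_of_to. reflexivity. }
    assert (Q : forall c, exists N, forall n m, (N <= n)%nat -> (N <= m)%nat ->
      Rabs (u (Cantor.to_nat (c, Cantor.to_nat (j, Cantor.to_nat (i, l)))) (s n) - u (Cantor.to_nat (c, Cantor.to_nat (j, Cantor.to_nat (i, l)))) (s m)) <= e').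
    { intros c. destruct (HL (Cantor.to_nat (c, Cantor.to_nat (j, Cantor.to_nat (i, l))))) as [x Hx].
      apply (is_lim_seq_cauchy _ x e' Hx He'). }
    assert (Eu : forall c n, u (Cantor.to_nat (c, Cantor.to_nat (j, Cantor.to_nat (i, l)))) n =
      match c with O => ster1 (g n (grid j i l)) | S O => ster2 (g n (grid j i l)) | _ => ster3 (g n (grid j i l)) end).
    { intros c n. unfold u. rewrite Cantor.cancel_of_to, Ept. reflexivity. }
    destruct (Q 0%nat) as [N0 Q0]. destruct (Q 1%nat) as [N1 Q1]. destruct (Q 2%nat) as [N2 Q2].
    exists (Nat.max N0 (Nat.max N1 N2)). intros n m Hn Hm.
    specialize (Q0 n m ltac:(lia) ltac:(lia)). specialize (Q1 n m ltac:(lia) ltac:(lia)).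
    specialize (Q2 n m ltac:(lia) ltac:(lia)). rewrite !Eu in Q0, Q1, Q2.
    split; [exact Q0|split; [exact Q1|exact Q2]]. }
  (* [w] uses up a quarter of 1 - |z0| and its grid neighbour another quarter, so both stay in |v|
     <= 1 - d. *)
  set (d := (1 - Cmod z0) / 2). assert (Hd : 0 < d) by (unfold d; lra).
  set (L := 2 * K / d). assert (HL0 : 0 <= L) by (apply Rdiv_le_0_compat; lra).
  (* The first term makes the grid distance at most d / 2, the second makes the oscillation over it
     at most e / 3. *)
  destruct (pow2_unbounded (4 / d + 6 * (L + 1) / e)) as [j Hj].
  assert (A1 : 0 < 4 / d) by (apply Rdiv_lt_0_compat; lra).
  assert (A2 : 0 < 6 * (L + 1) / e) by (apply Rdiv_lt_0_compat; lra).
  pose proof (two_pow_pos j) as P.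
  assert (J1 : 2 / 2 ^ j <= d / 2).
  { apply Rmult_le_reg_r with (2 ^ j * (2 / d)); [apply Rmult_lt_0_compat; [exact P|apply Rdiv_lt_0_compat; lra]|].
    replace (2 / 2 ^ j * (2 ^ j * (2 / d))) with (4 / d) by (field; lra).
    replace (d / 2 * (2 ^ j * (2 / d))) with (2 ^ j) by (field; lra). lra. }
  assert (J2 : L * (2 / 2 ^ j) <= e / 3).
  { apply Rmult_le_reg_r with (2 ^ j * (3 / e)); [apply Rmult_lt_0_compat; [exact P|apply Rdiv_lt_0_compat; lra]|].
    replace (L * (2 / 2 ^ j) * (2 ^ j * (3 / e))) with (6 * L / e) by (field; lra).
    replace (e / 3 * (2 ^ j * (3 / e))) with (2 ^ j) by (field; lra).
    replace (6 * (L + 1) / e) with (6 * L / e + 6 / e) in * by (field; lra).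
    assert (0 < 6 / e) by (apply Rdiv_lt_0_compat; lra). lra. }
  set (B := (2 * 2 ^ j)%nat).
  destruct (bounded_uniform (fun i N => forall l, (l <= B)%nat -> forall n m, (N <= n)%nat -> (N <= m)%nat ->
    nster (g (s n) (grid j i l)) (g (s m) (grid j i l)) (e / 3)) B) as [N HN].
  { intros i N N' HNN H l Hl n m Hn Hm. apply H; (assumption || lia). }
  { intros i. apply (bounded_uniform (fun l N => forall n m, (N <= n)%nat -> (N <= m)%nat ->
      nster (g (s n) (grid j i l)) (g (s m) (grid j i l)) (e / 3)) B).
    - intros l N N' HNN H n m Hn Hm. apply H; lia.
    - intros l. apply Pt. lra. }
  exists N. intros n m Hn Hm w Hw.
  pose proof (Cmod_triangle_inv w z0).
  assert (Hw1 : Cmod w <= 1 - d) by (unfold d in *; lra).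
  destruct (grid_dense w j ltac:(lra)) as [i [l [Hi [Hl Hq]]]].
  set (q := grid j i l) in *.
  assert (Hq1 : Cmod q <= 1 - d).
  { pose proof (Cmod_triangle_inv q w). rewrite (Cmod_minus_sym q w) in *. unfold d in *. lra. }
  assert (T : forall n, nster (g (s n) w) (g (s n) q) (e / 3)).
  { intros k. eapply nster_weaken; [apply (marty_nster (g (s k)) K d); auto|].
    fold L. eapply Rle_trans; [apply Rmult_le_compat_l; [exact HL0|exact Hq]|exact J2]. }
  replace e with (e / 3 + (e / 3 + e / 3)) by field.
  eapply nster_trans; [apply T|]. eapply nster_trans; [apply (HN i Hi l Hl n m Hn Hm)|].
  apply nster_sym, T.
Qed.

(** * Marty's criterion: sufficiency *)

Definition Clim (u : nat -> C) (l : C) : Prop :=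
  forall e, 0 < e -> exists N, forall n, (N <= n)%nat -> Cmod (u n - l) < e.

Lemma Ccauchy_lim (u : nat -> C) :
  (forall e, 0 < e -> exists N, forall n m, (N <= n)%nat -> (N <= m)%nat -> Cmod (u n - u m) <= e) ->
  exists l, Clim u l.
Proof.
  intros H.
  assert (E : forall p : C -> R, (forall a b, Rabs (p a - p b) <= Cmod (a - b)) ->
    exists x : R, is_lim_seq (fun n => p (u n)) x).
  { intros p Hp. apply ex_lim_seq_cauchy_corr. intros e.
    destruct (H (e / 2)) as [N HN]; [pose proof (cond_pos e); lra|].
    exists N. intros n m Hn Hm. pose proof (HN n m Hn Hm). pose proof (Hp (u n) (u m)).
    pose proof (cond_pos e). lra. }
  destruct (E fst) as [x Hx]; [intros a b; exact (fst_le_Cmod (a - b))|].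
  destruct (E snd) as [y Hy]; [intros a b; exact (snd_le_Cmod (a - b))|].
  exists (x, y). intros e He.
  assert (He3 : 0 < e / 3) by lra.
  apply is_lim_seq_spec in Hx, Hy.
  destruct (Hx (mkposreal _ He3)) as [N1 H1]. destruct (Hy (mkposreal _ He3)) as [N2 H2].
  exists (Nat.max N1 N2). intros n Hn.
  eapply Rle_lt_trans; [apply (Cmod_le_components _ (e / 3))|lra].
  - left. apply (H1 n). lia.
  - left. apply (H2 n). lia.
Qed.

Lemma Clim_bound (u : nat -> C) (l a : C) (m : R) (N : nat) :
  Clim u l -> (forall n, (N <= n)%nat -> Cmod (u n - a) <= m) -> Cmod (l - a) <= m.
Proof.
  intros H Hm. apply Rnot_lt_le. intros K.
  destruct (H (Cmod (l - a) - m)) as [N' HN']; [lra|].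
  set (n := Nat.max N N'). specialize (Hm n ltac:(lia)). specialize (HN' n ltac:(lia)).
  pose proof (Cmod_sub_triangle l (u n) a). rewrite (Cmod_minus_sym l (u n)) in *. lra.
Qed.

(* The first Taylor coefficients converge by Cauchy's estimate, and the
   uniform quadratic Taylor remainder passes to the limit. *)
Lemma weierstrass (F : nat -> C -> C) (h : C -> C) (z0 : C) (rho m : R) :
  0 < rho -> (forall n z, Cmod (z - z0) < rho -> exists l, cderiv (F n) z l) ->
  (forall n z, Cmod (z - z0) < rho -> Cmod (F n z) <= m) ->
  (forall e, 0 < e -> exists N, forall i j, (N <= i)%nat -> (N <= j)%nat ->
     forall z, Cmod (z - z0) < rho -> Cmod (F i z - F j z) <= e) ->
  (forall z, Cmod (z - z0) < rho -> Clim (fun n => F n z) (h z)) ->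
  exists l, cderiv h z0 l.
Proof.
  intros Hr HF Hm HC Hh. set (r := rho / 2).
  assert (T : forall n, exists l, cderiv (F n) z0 l /\ forall z, Cmod (z - z0) <= r / 2 ->
    Cmod (F n z - F n z0 - l * (z - z0)) <= 4 * m / r ^ 2 * (Cmod (z - z0) * Cmod (z - z0))).
  { intros n. destruct (taylor_first_order (F n) z0 rho r m) as [l [H1 [_ H2]]].
    - apply HF.
    - unfold r. lra.
    - intros z Hz. apply Hm. unfold r in Hz. lra.
    - exists l. split; assumption. }
  set (c := fun n => proj1_sig (constructive_indefinite_description _ (T n))).
  assert (Hc : forall n, cderiv (F n) z0 (c n) /\ forall z, Cmod (z - z0) <= r / 2 ->
    Cmod (F n z - F n z0 - c n * (z - z0)) <= 4 * m / r ^ 2 * (Cmod (z - z0) * Cmod (z - z0)))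
    by (intros n; apply (proj2_sig (constructive_indefinite_description _ (T n)))).
  destruct (Ccauchy_lim c) as [l Hl].
  { intros e He. destruct (HC (e * r / 2)) as [N HN].
    - unfold r. apply Rdiv_lt_0_compat; [apply Rmult_lt_0_compat|]; lra.
    - exists N. intros i j Hi Hj.
      destruct (taylor_first_order (fun z => F i z - F j z)%C z0 rho r (e * r / 2)) as [k [K1 [K2 _]]].
      + intros z Hz. destruct (HF i z Hz) as [a Ha]. destruct (HF j z Hz) as [b Hb].
        exists (a - b)%C. apply cderiv_minus; assumption.
      + unfold r. lra.
      + intros z Hz. apply HN; auto. unfold r in Hz. lra.
      + replace (c i - c j)%C with k.
        * replace (2 * (e * r / 2) / r) with e in K2 by (field; unfold r; lra). exact K2.
        * eapply cderiv_unique; [exact K1|]. apply cderiv_minus; [apply Hc|apply Hc]. }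
  exists l. apply cderiv_quadratic with (4 * m / r ^ 2).
  exists (r / 2). split; [unfold r; lra|]. intros z Hz.
  assert (Hz' : Cmod (z - z0) < rho) by (unfold r in Hz; lra).
  assert (Z0 : Cmod (z0 - z0) < rho).
  { replace (z0 - z0)%C with (RtoC 0) by ring. rewrite Cmod_0. exact Hr. }
  assert (L : Clim (fun n => F n z - F n z0 - c n * (z - z0))%C (h z - h z0 - l * (z - z0))%C).
  { intros e He. pose proof (Cmod_ge_0 (z - z0)).
    destruct (Hh z Hz' (e / 3)) as [N1 H1]; [lra|].
    destruct (Hh z0 Z0 (e / 3)) as [N2 H2]; [lra|].
    destruct (Hl (e / (3 * (Cmod (z - z0) + 1)))) as [N3 H3]; [apply Rdiv_lt_0_compat; lra|].
    exists (Nat.max N1 (Nat.max N2 N3)). intros n Hn.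
    specialize (H1 n ltac:(lia)). specialize (H2 n ltac:(lia)). specialize (H3 n ltac:(lia)).
    replace (F n z - F n z0 - c n * (z - z0) - (h z - h z0 - l * (z - z0)))%C
      with ((F n z - h z) + (- (F n z0 - h z0)) + (- ((c n - l) * (z - z0))))%C by ring.
    eapply Rle_lt_trans; [apply Cmod_triangle|].
    pose proof (Cmod_triangle (F n z - h z) (- (F n z0 - h z0))) as T1.
    rewrite Cmod_opp in *. rewrite Cmod_mult.
    assert (Cmod (c n - l) * Cmod (z - z0) <= e / (3 * (Cmod (z - z0) + 1)) * Cmod (z - z0))
      by (apply Rmult_le_compat_r; lra).
    assert (e / (3 * (Cmod (z - z0) + 1)) * Cmod (z - z0) <= e / 3).
    { apply Rmult_le_reg_r with (3 * (Cmod (z - z0) + 1)); [lra|].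
      replace (e / (3 * (Cmod (z - z0) + 1)) * Cmod (z - z0) * (3 * (Cmod (z - z0) + 1)))
        with (e * Cmod (z - z0)) by (field; lra). nra. }
    lra. }
  pose proof (Clim_bound _ _ 0 (4 * m / r ^ 2 * (Cmod (z - z0) * Cmod (z - z0))) 0%nat L) as B.
  rewrite Cminus_0_r in B. apply B. intros n _. rewrite Cminus_0_r. apply Hc. lra.
Qed.

(** * Pointwise divergence to infinity, seen from the sphere *)

Definition to_infinity (G : nat -> C -> C) (z : C) : Prop :=
  forall M, exists N, forall n, (N <= n)%nat -> M < Cmod (G n z).

(** 1 - [ster3] is the height below the north pole. It measures nearness to infinity and varies by
    at most e under [nster] with error e; the lemmas below translate it into bounds on the
    modulus. *)
Lemma ster3_Cmod (a : C) : 1 - ster3 a = 2 / (1 + Cmod a ^ 2).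
Proof. unfold ster3. rewrite Cmod_sqr. ring. Qed.

Lemma ster3_le_bound (a : C) (c : R) : 0 < c -> c <= 1 - ster3 a -> Cmod a <= 2 / c + 1.
Proof.
  intros Hc H. rewrite ster3_Cmod in H. pose proof (sph_pos a) as P. pose proof (Cmod_ge_0 a).
  apply Rmult_le_compat_r with (r := 1 + Cmod a ^ 2) in H; [|lra].
  replace (2 / (1 + Cmod a ^ 2) * (1 + Cmod a ^ 2)) with 2 in H by (field; lra).
  assert (1 + Cmod a ^ 2 <= 2 / c).
  { apply Rmult_le_reg_l with c; [exact Hc|]. replace (c * (2 / c)) with 2 by (field; lra). exact H. }
  nra.
Qed.

Lemma ster3_ge_bound (a : C) (M : R) : Cmod a <= M -> 2 / (1 + M ^ 2) <= 1 - ster3 a.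
Proof.
  intros H. rewrite ster3_Cmod. pose proof (Cmod_ge_0 a). apply Rmult_le_compat_l; [lra|].
  apply Rinv_le_contravar; [apply sph_pos|]. nra.
Qed.

Lemma ster3_small (a : C) (M c : R) : c <= 2 / (1 + M ^ 2) -> 1 - ster3 a < c -> M < Cmod a.
Proof.
  intros Hc H. apply Rnot_le_lt. intros K. apply ster3_ge_bound in K. lra.
Qed.

Lemma ster3_large (a : C) (M c : R) : 0 < c -> 2 / c <= M ^ 2 -> 0 <= M -> M < Cmod a -> 1 - ster3 a < c.
Proof.
  intros Hc H HM K. rewrite ster3_Cmod. pose proof (sph_pos a).
  apply Rmult_lt_reg_r with (1 + Cmod a ^ 2); [assumption|].
  replace (2 / (1 + Cmod a ^ 2) * (1 + Cmod a ^ 2)) with 2 by (field; lra).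
  apply Rmult_le_compat_l with (r := c) in H; [|lra]. replace (c * (2 / c)) with 2 in H by (field; lra).
  nra.
Qed.

Lemma nster_ster3 (a b : C) (e : R) : nster a b e -> 1 - ster3 a <= 1 - ster3 b + e.
Proof.
  intros [_ [_ H]]. rewrite Rabs_minus_sym in H. apply Rabs_le_between in H. lra.
Qed.

Lemma sqrt_sph_le (a : C) : sqrt (1 + Cmod a ^ 2) <= 1 + Cmod a.
Proof.
  pose proof (Cmod_ge_0 a). rewrite <- (sqrt_pow2 (1 + Cmod a)) by lra.
  apply sqrt_le_1_alt. nra.
Qed.

Lemma Cmod_le_chord (a b : C) : Cmod (a - b) <= chord a b * ((1 + Cmod a) * (1 + Cmod b)).
Proof.
  pose proof (sph_sqrt_pos a). pose proof (sph_sqrt_pos b).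
  replace (Cmod (a - b)) with (chord a b * (sqrt (1 + Cmod a ^ 2) * sqrt (1 + Cmod b ^ 2)))
    by (unfold chord; field; lra).
  apply Rmult_le_compat_l; [apply chord_ge_0|].
  apply Rmult_le_compat; try lra; apply sqrt_sph_le.
Qed.

(** Inversion preserves [chord], and outside the unit disk (1 + |a|) (1 + |b|) <= 4 |a| |b|. *)
Lemma Cmod_inv_le_chord (a b : C) : 1 <= Cmod a -> 1 <= Cmod b -> Cmod (/ a - / b) <= 4 * chord a b.
Proof.
  intros Ha Hb.
  assert (Za : a <> 0) by (apply Cmod_gt_0; lra). assert (Zb : b <> 0) by (apply Cmod_gt_0; lra).
  replace (/ a - / b)%C with ((b - a) / (a * b))%C by (field; auto).
  rewrite Cmod_div, Cmod_mult, Cmod_minus_sym by (apply Cmult_neq_0; auto).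
  pose proof (chord_ge_0 a b). pose proof (Cmod_le_chord a b).
  apply Rmult_le_reg_r with (Cmod a * Cmod b); [nra|].
  replace (Cmod (a - b) / (Cmod a * Cmod b) * (Cmod a * Cmod b)) with (Cmod (a - b)) by (field; lra).
  eapply Rle_trans; [eassumption|].
  rewrite (Rmult_comm 4), Rmult_assoc. apply Rmult_le_compat_l; [assumption|]. nra.
Qed.

(** Failure to tend to infinity bounds infinitely many values at [z0]; the Cauchy condition extends
    the bound to all large n, and equicontinuity to nearby points. *)
Lemma finite_nearby (G : nat -> C -> C) (K : R) (z0 : C) : 0 <= K ->
  (forall n, holo 1 (G n)) -> (forall n, marty (G n) K) -> locally_uniformly_cauchy G ->
  Cmod z0 < 1 -> ~ to_infinity G z0 ->
  exists d B N, 0 < d /\ forall n w, (N <= n)%nat -> Cmod (w - z0) < d -> Cmod (G n w) <= B.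
Proof.
  intros HK HG HM HC Hz Hno.
  assert (E : exists M, forall N, exists n, (N <= n)%nat /\ Cmod (G n z0) <= M).
  { apply NNPP. intros H. apply Hno. intros M. apply NNPP. intros H'. apply H. exists M. intros N.
    apply NNPP. intros H''. apply H'. exists N. intros n Hn. apply Rnot_le_lt. intros Hle.
    apply H''. exists n. split; assumption. }
  (* [c] is the height below the pole at modulus M. The Cauchy condition and the move from [z0] to
     [w] lose c / 4 each, so c / 2 is left. *)
  destruct E as [M HE]. set (c := 2 / (1 + M ^ 2)).
  assert (Hc : 0 < c) by (apply Rdiv_lt_0_compat; [lra|]; pose proof (pow2_ge_0 M); lra).
  destruct (HC z0 Hz (c / 4)) as [N HN]; [lra|].
  set (d0 := (1 - Cmod z0) / 4). assert (Hd0 : 0 < d0) by (unfold d0; lra).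
  set (L := 2 * K / d0). assert (HL : 0 <= L) by (apply Rdiv_le_0_compat; lra).
  assert (Hq : 0 < c / (4 * (L + 1))) by (apply Rdiv_lt_0_compat; lra).
  exists (Rmin d0 (c / (4 * (L + 1)))), (2 / (c / 2) + 1), N.
  split; [apply Rmin_glb_lt; assumption|]. intros n w Hn Hw.
  pose proof (Rmin_l d0 (c / (4 * (L + 1)))). pose proof (Rmin_r d0 (c / (4 * (L + 1)))).
  apply ster3_le_bound; [lra|].
  destruct (HE N) as [m [Hm HmM]]. apply ster3_ge_bound in HmM. fold c in HmM.
  assert (Z : Cmod (z0 - z0) < (1 - Cmod z0) / 4).
  { replace (z0 - z0)%C with (RtoC 0) by ring. rewrite Cmod_0. lra. }
  pose proof (nster_ster3 _ _ _ (HN m n Hm Hn z0 Z)).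
  pose proof (Cmod_triangle_inv w z0).
  assert (N1 : nster (G n z0) (G n w) (2 * K / d0 * Cmod (z0 - w)))
    by (apply marty_nster; auto; unfold d0 in *; lra).
  apply nster_ster3 in N1. rewrite Cmod_minus_sym in N1. fold L in N1.
  assert (L * Cmod (w - z0) <= (L + 1) * (c / (4 * (L + 1)))).
  { apply Rmult_le_compat; try lra. apply Cmod_ge_0. }
  replace ((L + 1) * (c / (4 * (L + 1)))) with (c / 4) in * by (field; lra). lra.
Qed.

Lemma large_nearby (G : nat -> C -> C) (K : R) (z0 : C) : 0 <= K ->
  (forall n, holo 1 (G n)) -> (forall n, marty (G n) K) ->
  Cmod z0 < 1 -> to_infinity G z0 ->
  exists d N, 0 < d /\ d <= (1 - Cmod z0) / 4 /\
    forall n w, (N <= n)%nat -> Cmod (w - z0) < d -> 1 < Cmod (G n w).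
Proof.
  intros HK HG HM Hz HI.
  set (d0 := (1 - Cmod z0) / 4). assert (Hd0 : 0 < d0) by (unfold d0; lra).
  set (L := 2 * K / d0). assert (HL : 0 <= L) by (apply Rdiv_le_0_compat; lra).
  (* Modulus 3 gives a height below 1/2; the move to [w] adds at most 1/4, and the total stays below
     1, the height at modulus 1. *)
  destruct (HI 3) as [N HN].
  assert (Hq : 0 < 1 / (4 * (L + 1))) by (apply Rdiv_lt_0_compat; lra).
  exists (Rmin d0 (1 / (4 * (L + 1)))), N.
  split; [apply Rmin_glb_lt; assumption|split; [apply Rmin_l|]]. intros n w Hn Hw.
  pose proof (Rmin_l d0 (1 / (4 * (L + 1)))). pose proof (Rmin_r d0 (1 / (4 * (L + 1)))).
  specialize (HN n Hn).
  assert (T : 1 - ster3 (G n z0) < 1 / 2) by (apply (ster3_large _ 3); lra).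
  pose proof (Cmod_triangle_inv w z0).
  assert (N1 : nster (G n w) (G n z0) (2 * K / d0 * Cmod (w - z0)))
    by (apply marty_nster; auto; unfold d0 in *; lra).
  apply nster_ster3 in N1. fold L in N1.
  assert (L * Cmod (w - z0) <= (L + 1) * (1 / (4 * (L + 1)))).
  { apply Rmult_le_compat; try lra. apply Cmod_ge_0. }
  replace ((L + 1) * (1 / (4 * (L + 1)))) with (1 / 4) in * by (field; lra).
  apply (ster3_small _ 1 1); lra.
Qed.

(* Hurwitz: the reciprocals converge to a function that vanishes at [z0]; if
   it did not vanish near [z0] it would be bounded below on a small circle,
   and the mean value property would bound the values at [z0]. *)
Lemma to_infinity_open (G : nat -> C -> C) (K : R) (z0 : C) : 0 <= K ->
  (forall n, holo 1 (G n)) -> (forall n, marty (G n) K) -> locally_uniformly_cauchy G ->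
  Cmod z0 < 1 -> to_infinity G z0 -> cnear z0 (to_infinity G).
Proof.
  intros HK HG HM HC Hz HI.
  destruct (large_nearby G K z0 HK HG HM Hz HI) as [d [N [Hd [Hd4 HN]]]].
  (* The shift by [N] makes all reciprocals analytic and bounded by 1 near [z0]. *)
  set (F := fun n w => (/ G (n + N)%nat w)%C).
  assert (Hbig : forall n w, Cmod (w - z0) < d -> 1 < Cmod (G (n + N)%nat w)) by (intros; apply HN; [lia|assumption]).
  assert (Hnz : forall n w, Cmod (w - z0) < d -> G (n + N)%nat w <> 0).
  { intros n w Hw. apply (Cmod_pos_neq _ 1); [lra|apply Hbig; exact Hw]. }
  assert (Hin : forall w, Cmod (w - z0) < d -> Cmod w < 1).
  { intros w Hw. pose proof (Cmod_triangle_inv w z0). lra. }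
  assert (HF : forall n w, Cmod (w - z0) < d -> exists l, cderiv (F n) w l).
  { intros n w Hw. destruct (HG (n + N)%nat w (Hin w Hw)) as [l Hl].
    eexists. apply cderiv_inv; [exact Hl|apply Hnz; exact Hw]. }
  assert (HB : forall n w, Cmod (w - z0) < d -> Cmod (F n w) <= 1).
  { intros n w Hw. unfold F. rewrite Cmod_inv by (apply Hnz; exact Hw).
    rewrite <- Rinv_1. pose proof (Hbig n w Hw). apply Rinv_le_contravar; lra. }
  assert (HCF : forall e, 0 < e -> exists M, forall i j, (M <= i)%nat -> (M <= j)%nat ->
    forall w, Cmod (w - z0) < d -> Cmod (F i w - F j w) <= e).
  { intros e He. destruct (HC z0 Hz (e / 4)) as [M HMM]; [lra|]. exists M. intros i j Hi Hj w Hw.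
    pose proof (Hbig i w Hw). pose proof (Hbig j w Hw).
    assert (Q : chord (G (i + N)%nat w) (G (j + N)%nat w) <= e / 4)
      by (apply nster_chord, HMM; (lia || lra)).
    eapply Rle_trans; [apply Cmod_inv_le_chord; lra|]. lra. }
  (* The membership hypothesis sits inside the existential so that choice yields a total function
     [h], with a default value outside. *)
  assert (HL : forall w, exists l, Cmod (w - z0) < d -> Clim (fun n => F n w) l).
  { intros w. destruct (Rlt_le_dec (Cmod (w - z0)) d) as [Hw|Hw].
    - destruct (Ccauchy_lim (fun n => F n w)) as [l Hl].
      + intros e He. destruct (HCF e He) as [M HMM]. exists M. intros i j Hi Hj. apply HMM; assumption.
      + exists l. intros _. exact Hl.
    - exists (RtoC 0). intros Hw'. lra. }
  set (h := fun w => proj1_sig (constructive_indefinite_description _ (HL w))).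
  assert (Hh : forall w, Cmod (w - z0) < d -> Clim (fun n => F n w) (h w))
    by (intros w; apply (proj2_sig (constructive_indefinite_description _ (HL w)))).
  assert (Hhd : forall w, Cmod (w - z0) < d -> exists l, cderiv h w l).
  { intros w Hw.
    assert (Hsub : forall v, Cmod (v - w) < d - Cmod (w - z0) -> Cmod (v - z0) < d).
    { intros v Hv. pose proof (Cmod_sub_triangle v w z0). lra. }
    apply (weierstrass F h w (d - Cmod (w - z0)) 1); [lra| | | |].
    - intros n v Hv. apply HF, Hsub, Hv.
    - intros n v Hv. apply HB, Hsub, Hv.
    - intros e He. destruct (HCF e He) as [M HMM]. exists M. intros i j Hi Hj v Hv. apply HMM; auto.
    - intros v Hv. apply Hh, Hsub, Hv. }
  assert (Hzero : forall w, Cmod (w - z0) < d -> h w = 0 -> to_infinity G w).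
  { intros w Hw H0 M. specialize (Hh w Hw). rewrite H0 in Hh.
    destruct (Hh (/ (Rabs M + 1))) as [N' HN'].
    - apply Rinv_0_lt_compat. pose proof (Rabs_pos M). lra.
    - exists (N' + N)%nat. intros n Hn. specialize (HN' (n - N)%nat ltac:(lia)).
      rewrite Cminus_0_r in HN'. unfold F in HN'. pose proof (Hnz (n - N)%nat w Hw) as Z.
      replace (n - N + N)%nat with n in * by lia. rewrite Cmod_inv in HN' by exact Z.
      apply Cmod_gt_0 in Z. pose proof (Rabs_pos M). pose proof (Rle_abs M).
      apply Rnot_le_lt. intros Hle.
      apply (Rlt_irrefl (/ Cmod (G n w))). eapply Rlt_le_trans; [exact HN'|].
      apply Rinv_le_contravar; lra. }
  assert (HBh : forall w, Cmod (w - z0) < d -> Cmod (h w) <= 1).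
  { intros w Hw. rewrite <- (Cminus_0_r (h w)). apply (Clim_bound _ _ _ _ 0%nat (Hh w Hw)).
    intros n _. rewrite Cminus_0_r. apply HB. exact Hw. }
  destruct (isolated_zeros h z0 d (d / 2) 1) as [Hall|Hiso].
  - exact Hhd.
  - lra.
  - intros w Hw. apply HBh. lra.
  - exists (d / 2). split; [lra|]. intros w Hw. apply Hzero; [lra|]. apply Hall. exact Hw.
  - exfalso. destruct (Hiso d Hd) as [s [e [Hs [He Hse]]]].
    destruct (HCF (e / 2)) as [M HMM]; [lra|].
    assert (Hlow : forall n w, (M <= n)%nat -> Cmod (w - z0) = s -> e / 2 <= Cmod (F n w)).
    { intros n w Hn Hw. assert (Hw' : Cmod (w - z0) < d) by lra.
      assert (Q : Cmod (h w - F n w) <= e / 2).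
      { apply (Clim_bound _ _ _ _ M (Hh w Hw')). intros i Hi. apply HMM; assumption. }
      pose proof (Cmod_triangle_inv (h w) (h w - F n w)) as T.
      replace (h w - (h w - F n w))%C with (F n w) in T by ring. specialize (Hse w Hw). lra. }
    (* On the circle |F| >= e / 2, so |G| <= 2 / e there, and the mean value inequality gives |G| <=
       4 / e at [z0]. *)
    destruct (HI (4 / e)) as [N' HN'].
    set (n := (M + N')%nat). specialize (HN' (n + N)%nat ltac:(unfold n; lia)).
    assert (Q : Cmod (G (n + N)%nat z0) <= 2 * (2 / e)).
    { apply (mean_value_disk _ z0 d s).
      - intros w Hw. apply HG, Hin, Hw.
      - exact Hs.
      - intros w Hw. specialize (Hlow n w ltac:(unfold n; lia) Hw).
        assert (Hw' : Cmod (w - z0) < d) by lra. pose proof (Hnz n w Hw') as Z.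
        unfold F in Hlow. rewrite Cmod_inv in Hlow by exact Z. apply Cmod_gt_0 in Z.
        rewrite <- (Rinv_inv (Cmod (G (n + N)%nat w))).
        replace (2 / e) with (/ (e / 2)) by (field; lra). apply Rinv_le_contravar; lra. }
    replace (2 * (2 / e)) with (4 / e) in Q by (field; lra). lra.
Qed.

(** * Connectedness of the disk and the dichotomy of limits *)

Lemma disk_segment (z w : C) (t : R) : Cmod z < 1 -> Cmod w < 1 -> 0 <= t <= 1 ->
  Cmod (z + RtoC t * (w - z)) < 1.
Proof.
  intros Hz Hw Ht.
  replace (z + RtoC t * (w - z))%C with (RtoC (1 - t) * z + RtoC t * w)%C
    by (rewrite RtoC_minus; ring).
  eapply Rle_lt_trans; [apply Cmod_triangle|]. rewrite !Cmod_mult, !Cmod_R, !Rabs_right by lra.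
  pose proof (Cmod_ge_0 z). pose proof (Cmod_ge_0 w).
  destruct (Rle_lt_dec t (1 / 2)); nra.
Qed.

(** On the segment from [z] to [w], the supremum of the times up to which [P] has held can neither
    violate [P] nor lie before the end. *)
Lemma disk_connected (P : C -> Prop) :
  (forall z, Cmod z < 1 -> P z -> cnear z P) ->
  (forall z, Cmod z < 1 -> ~ P z -> cnear z (fun w => ~ P w)) ->
  forall z w, Cmod z < 1 -> Cmod w < 1 -> P z -> P w.
Proof.
  intros H1 H2 z w Hz Hw HP.
  set (p := fun t => (z + RtoC t * (w - z))%C).
  assert (Hin : forall t, 0 <= t <= 1 -> Cmod (p t) < 1) by (intros t Ht; apply disk_segment; assumption).
  assert (Hp : forall s t, Cmod (p s - p t) = Rabs (s - t) * Cmod (w - z)).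
  { intros s t. unfold p. replace (z + RtoC s * (w - z) - (z + RtoC t * (w - z)))%C
      with (RtoC (s - t) * (w - z))%C by (rewrite RtoC_minus; ring). rewrite Cmod_mult, Cmod_R. reflexivity. }
  assert (P0 : P (p 0)) by (unfold p; replace (z + RtoC 0 * (w - z))%C with z by ring; exact HP).
  assert (P1 : p 1 = w) by (unfold p; ring).
  assert (Near : forall Q t, cnear (p t) Q -> exists d, 0 < d /\ forall s, Rabs (s - t) < d -> Q (p s)).
  { intros Q t [e [He HQ]]. pose proof (Cmod_ge_0 (w - z)).
    exists (e / (Cmod (w - z) + 1)). split; [apply Rdiv_lt_0_compat; lra|]. intros s Hs. apply HQ. rewrite Hp.
    apply Rmult_lt_compat_r with (r := Cmod (w - z) + 1) in Hs; [|lra].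
    replace (e / (Cmod (w - z) + 1) * (Cmod (w - z) + 1)) with e in Hs by (field; lra).
    pose proof (Rabs_pos (s - t)). lra. }
  set (E := fun t => 0 <= t <= 1 /\ forall s, 0 <= s <= t -> P (p s)).
  assert (E0 : E 0).
  { split; [lra|]. intros s Hs. replace s with 0 by lra. exact P0. }
  destruct (completeness E) as [t [T1 T2]].
  { exists 1. intros s [Hs _]. lra. }
  { exists 0. exact E0. }
  assert (Ht : 0 <= t <= 1).
  { split; [apply T1; exact E0|]. apply T2. intros s [Hs _]. lra. }
  assert (App : forall d, 0 < d -> exists s, E s /\ t - d < s <= t).
  { intros d Hd. apply NNPP. intros Hno.
    assert (t <= t - d); [|lra]. apply T2. intros s Hs. apply Rnot_lt_le. intros Hlt.
    apply Hno. exists s. split; [exact Hs|]. split; [exact Hlt|]. apply T1. exact Hs. }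
  destruct (classic (P (p t))) as [Pt|Pt].
  - destruct (Near _ _ (H1 _ (Hin t Ht) Pt)) as [d [Hd Hn]].
    destruct (App d Hd) as [s [[Hs1 Hs2] Hs]].
    assert (Ext : E (Rmin 1 (t + d / 2))).
    { split; [split; [apply Rmin_glb; lra|apply Rmin_l]|]. intros v Hv.
      pose proof (Rmin_r 1 (t + d / 2)).
      destruct (Rle_lt_dec v s) as [Hvs|Hvs]; [apply Hs2; lra|]. apply Hn. apply Rabs_def1; lra. }
    pose proof (T1 _ Ext) as Q.
    destruct (Rle_lt_dec 1 (t + d / 2)) as [Hle|Hlt].
    + rewrite Rmin_left in Ext by exact Hle. rewrite <- P1. apply Ext. lra.
    + rewrite Rmin_right in Q by lra. lra.
  - exfalso. destruct (Near _ _ (H2 _ (Hin t Ht) Pt)) as [d [Hd Hn]].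
    destruct (App d Hd) as [s [[Hs1 Hs2] Hs]].
    apply (Hn s); [apply Rabs_def1; lra|]. apply Hs2. lra.
Qed.

Lemma disk_ball_locally (z : C) (d : R) : 0 < d -> locally z (fun w => Cmod (w - z) < d).
Proof. intros Hd. apply cnear_locally. exists d. split; [exact Hd|auto]. Qed.

(** The Cauchy threshold is uniform near [z0], so it suffices to compare with one index m, which may
    depend on [w]. *)
Lemma to_infinity_diverges (G : nat -> C -> C) : locally_uniformly_cauchy G ->
  (forall z, Cmod z < 1 -> to_infinity G z) -> diverges_locally_uniformly unit_disk G.
Proof.
  unfold unit_disk. intros HC HA z0 Hz0. exists (fun w => Cmod (w - z0) < (1 - Cmod z0) / 4).
  split; [apply disk_ball_locally; lra|]. intros M.
  set (c := 2 / (1 + M ^ 2)).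
  assert (Hc : 0 < c) by (apply Rdiv_lt_0_compat; [lra|]; pose proof (pow2_ge_0 M); lra).
  destruct (HC z0 Hz0 (c / 2)) as [N HN]; [lra|]. exists N. intros n Hn w Hw HwV.
  (* 2 / (c / 2) = Q - 1 <= Q^2, so beyond modulus [Q] the height is below c / 2; the Cauchy
     condition adds at most another c / 2. *)
  set (Q := 1 + 4 / c). assert (HQ : 1 < Q) by (unfold Q; assert (0 < 4 / c) by (apply Rdiv_lt_0_compat; lra); lra).
  destruct (HA w Hw Q) as [N' HN'].
  set (m := Nat.max N N'). specialize (HN' m ltac:(lia)).
  assert (T : 1 - ster3 (G m w) < c / 2).
  { apply (ster3_large _ Q); [lra| |lra|exact HN']. replace (2 / (c / 2)) with (4 / c) by (field; lra).
    replace (4 / c) with (Q - 1) by (unfold Q; ring). nra. }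
  pose proof (nster_ster3 _ _ _ (HN n m Hn ltac:(lia) w HwV)).
  apply (ster3_small _ M c); [unfold c; lra|lra].
Qed.

(** Where the values are bounded by B, Euclidean distance is at most (1 + B)^2 times [chord], so the
    spherical Cauchy condition becomes a Euclidean one. *)
Lemma finite_converges (G : nat -> C -> C) (K : R) : 0 <= K ->
  (forall n, holo 1 (G n)) -> (forall n, marty (G n) K) -> locally_uniformly_cauchy G ->
  (forall z, Cmod z < 1 -> ~ to_infinity G z) ->
  exists h, analytic_on unit_disk h /\ converges_locally_uniformly unit_disk G h.
Proof.
  intros HK HG HM HC HA.
  assert (HU : forall z0, Cmod z0 < 1 -> exists d B N, 0 < d /\ d <= (1 - Cmod z0) / 4 /\
    (forall n w, (N <= n)%nat -> Cmod (w - z0) < d -> Cmod (G n w) <= B) /\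
    forall e, 0 < e -> exists M, forall i j, (M <= i)%nat -> (M <= j)%nat ->
      forall w, Cmod (w - z0) < d -> Cmod (G i w - G j w) <= e).
  { intros z0 Hz0. destruct (finite_nearby G K z0 HK HG HM HC Hz0 (HA z0 Hz0)) as [d [B [N [Hd HB]]]].
    exists (Rmin d ((1 - Cmod z0) / 4)), B, N.
    split; [apply Rmin_glb_lt; lra|]. split; [apply Rmin_r|].
    assert (HB' : forall n w, (N <= n)%nat -> Cmod (w - z0) < Rmin d ((1 - Cmod z0) / 4) -> Cmod (G n w) <= B).
    { intros n w Hn Hw. apply HB; [exact Hn|]. eapply Rlt_le_trans; [exact Hw|apply Rmin_l]. }
    split; [exact HB'|]. intros e He.
    assert (HB0 : 0 <= B).
    { eapply Rle_trans; [apply (Cmod_ge_0 (G N z0))|]. apply HB; [lia|].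
      replace (z0 - z0)%C with (RtoC 0) by ring. rewrite Cmod_0. exact Hd. }
    set (q := (1 + B) * (1 + B)). assert (Hq : 0 < q) by (unfold q; nra).
    destruct (HC z0 Hz0 (e / q)) as [M HMM]; [apply Rdiv_lt_0_compat; assumption|].
    exists (Nat.max N M). intros i j Hi Hj w Hw.
    assert (Q : chord (G i w) (G j w) <= e / q).
    { apply nster_chord, HMM; try lia. eapply Rlt_le_trans; [exact Hw|apply Rmin_r]. }
    pose proof (HB' i w ltac:(lia) Hw). pose proof (HB' j w ltac:(lia) Hw).
    pose proof (Cmod_ge_0 (G i w)). pose proof (Cmod_ge_0 (G j w)).
    eapply Rle_trans; [apply Cmod_le_chord|].
    apply Rle_trans with (e / q * q); [|right; field; lra].
    apply Rmult_le_compat; [apply chord_ge_0|nra|exact Q|]. unfold q. apply Rmult_le_compat; lra. }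
  assert (HL : forall w, exists l, Cmod w < 1 -> Clim (fun n => G n w) l).
  { intros w. destruct (Rlt_le_dec (Cmod w) 1) as [Hw|Hw].
    - destruct (HU w Hw) as [d [B [N [Hd [_ [_ HCw]]]]]].
      destruct (Ccauchy_lim (fun n => G n w)) as [l Hl].
      + intros e He. destruct (HCw e He) as [M HMM]. exists M. intros i j Hi Hj. apply HMM; try assumption.
        replace (w - w)%C with (RtoC 0) by ring. rewrite Cmod_0. exact Hd.
      + exists l. intros _. exact Hl.
    - exists (RtoC 0). intros Hw'. lra. }
  set (h := fun w => proj1_sig (constructive_indefinite_description _ (HL w))).
  assert (Hh : forall w, Cmod w < 1 -> Clim (fun n => G n w) (h w))
    by (intros w; apply (proj2_sig (constructive_indefinite_description _ (HL w)))).
  assert (Hin : forall z w d, d <= (1 - Cmod z) / 4 -> Cmod z < 1 -> Cmod (w - z) < d -> Cmod w < 1).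
  { intros z w d H1 H2 H3. pose proof (Cmod_triangle_inv w z). lra. }
  exists h. split.
  - apply holo_analytic. intros z Hz. destruct (HU z Hz) as [d [B [N [Hd [Hd4 [HB HCz]]]]]].
    apply (weierstrass (fun n => G (n + N)%nat) h z d B); [exact Hd| | | |].
    + intros n w Hw. apply HG. exact (Hin z w d Hd4 Hz Hw).
    + intros n w Hw. apply HB; [lia|exact Hw].
    + intros e He. destruct (HCz e He) as [M HMM]. exists M. intros i j Hi Hj w Hw. apply HMM; (lia || assumption).
    + intros w Hw e He. destruct (Hh w (Hin z w d Hd4 Hz Hw) e He) as [M HMM].
      exists M. intros n Hn. apply HMM. lia.
  - intros z Hz. destruct (HU z Hz) as [d [B [N [Hd [Hd4 [HB HCz]]]]]].
    exists (fun w => Cmod (w - z) < d). split; [apply disk_ball_locally; exact Hd|].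
    intros e He. destruct (HCz (e / 2)) as [M HMM]; [lra|]. exists M. intros n Hn w Hw HwV.
    apply Rle_lt_trans with (e / 2); [|lra]. rewrite Cmod_minus_sym.
    apply (Clim_bound _ _ _ _ M (Hh w Hw)). intros i Hi. apply HMM; assumption.
Qed.

Lemma marty_normal (f : C -> C) (K : R) : analytic_on unit_disk f -> marty f K -> is_normal f.
Proof.
  intros hf HM. split; [exact hf|]. apply holo_analytic in hf. intros g Hg.
  (* 4 is the constant of [schwarz_pick_weak]; the absolute value supplies the sign that the
     compactness argument requires. *)
  set (K' := 4 * Rabs K).
  assert (HK' : 0 <= K') by (unfold K'; pose proof (Rabs_pos K); lra).
  assert (HMK : marty f (Rabs K)).
  { intros z l Hz Hl. eapply Rle_trans; [apply (HM z l Hz Hl)|].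
    apply Rmult_le_compat_r; [left; apply sph_pos|apply Rle_abs]. }
  assert (HG : forall n, holo 1 (g n) /\ marty (g n) K').
  { intros n. destruct (Hg n) as [phi [Hphi E]].
    exact (marty_automorphism f phi (g n) (Rabs K) hf HMK Hphi E). }
  destruct (arzela_ascoli_sphere g K' HK' (fun n => proj1 (HG n)) (fun n => proj2 (HG n))) as [s [Hs HC]].
  exists s. split; [exact Hs|].
  set (G := fun n => g (s n)) in *.
  assert (HG1 : forall n, holo 1 (G n)) by (intros n; apply HG).
  assert (HG2 : forall n, marty (G n) K') by (intros n; apply HG).
  (* All or nothing: by connectedness a single point with limit infinity forces divergence
     everywhere. *)
  destruct (classic (exists z, Cmod z < 1 /\ to_infinity G z)) as [[z [Hz HI]]|Hno].
  - right. apply to_infinity_diverges; [exact HC|]. intros w Hw.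
    apply (disk_connected (to_infinity G)) with z; auto.
    + intros v Hv HIv. apply (to_infinity_open G K'); assumption.
    + intros v Hv HIv. destruct (finite_nearby G K' v HK' HG1 HG2 HC Hv HIv) as [d [B [N [Hd HB]]]].
      exists d. split; [exact Hd|]. intros u Hu HIu. destruct (HIu B) as [N' HN'].
      specialize (HN' (Nat.max N N') ltac:(lia)). specialize (HB (Nat.max N N') u ltac:(lia) Hu). lra.
  - left. apply (finite_converges G K'); auto. intros z Hz HI. apply Hno. exists z. split; assumption.
Qed.

Theorem proposition1p2 (f : C -> C) (hf : analytic_on unit_disk f) :
  (is_bloch f <->
    exists M : R, forall z w : C, unit_disk z -> unit_disk w -> z <> w ->
      sqrt (1 - Cmod z ^ 2) * sqrt (1 - Cmod w ^ 2) *
        (Cmod (f z - f w) / Cmod (z - w)) <= M) /\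
  (is_normal f <->
    exists M : R, forall z w : C, unit_disk z -> unit_disk w -> z <> w ->
      (sqrt (1 - Cmod z ^ 2) * sqrt (1 - Cmod w ^ 2)) /
        (sqrt (1 + Cmod (f z) ^ 2) * sqrt (1 + Cmod (f w) ^ 2)) *
        (Cmod (f z - f w) / Cmod (z - w)) <= M).
Proof.
  split; [apply bloch_iff; exact hf|].
  rewrite <- marty_iff by (apply holo_analytic; exact hf). split.
  - apply normal_marty.
  - intros [K HK]. exact (marty_normal f K hf HK).
Qed.
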